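(* Fix a dimension $d\ge 1$, $L>0$, $r>0$, $a>-1$, $p_0>0$. Consider random instances of minimizing $f(x)=\tfrac12 (x-x^\star)^TQ(x-x^\star)$ over $x\in\mathbf{R}^d$, where $Q$ is a random symmetric positive semidefinite $d\times d$ matrix with eigenvalues $\lambda_1,\dots,\lambda_d\in[0,L]$ that are exchangeable with common marginal distribution $\nu$, where $\nu$ has a density $p$ with $p(\lambda)\sim p_0\lambda^a$ as $\lambda\to0^+$, and where the initial error $x^0-x^\star$ is independent of $Q$, rotationally invariant in distribution, and satisfies $\mathbf{E}\|x^0-x^\star\|^2=r^2$. Fix $\alpha\in(0,1]$. Let $\phi^K=f(x^K)-f^\star$, where $f^\star=f(x^\star)=0$ and $x^K$ is the $K$-th iterate of either gradient descent (GD) or Nesterov's fast gradient method (FGM) (defined in the context), run with step size $\eta=1/L$. As $K\to\infty$, the following hold. (i) $\mathbf{CVaR}_\alpha(\phi^K)\sim\alpha^{-1}\,\mathbf{E}(\phi^K)$, where $\mathbf{E}(\phi^K)=\Theta\big(K^{-(a+2)}\big)$ for GD, and $\mathbf{E}(\phi^K)=\Theta\big(K^{-e(a)}\big)$ for FGM, with $e(a)=2(a+2)$ for $a\le-1/2$ and $e(a)=a+7/2$ for $a\ge-1/2$, with an additional factor $\log K$ at $a=-1/2$ (i.e. $\Theta(K^{-3}\log K)$ there). (ii) Suppose furthermore that $x^0-x^\star$ is Gaussian and that $\mathbf{E}(w_iw_j)\le\mathbf{E}(w_i)\mathbf{E}(w_j)$ for $i\ne j$, where $w_i=\lambda_i\rho_K(\lambda_i)^2$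 and the residual polynomial $\rho_K$ is defined by $x^K-x^\star=\rho_K(Q)(x^0-x^\star)$ for GD or FGM respectively. Then $$\mathbf{CVaR}_\alpha(\phi^K)\le\sqrt{\alpha^{-1}\,\mathbf{E}\big((\phi^K)^2\big)}=O\Big(\alpha^{-1/2}\big(d^{-1/2}K^{-h(a)}+\mathbf{E}(\phi^K)\big)\Big),$$ where $h(a)=(a+3)/2$ for GD, and for FGM $h(a)=a+3$ if $a\le0$ and $h(a)=a/2+3$ if $a\ge0$, with an additional multiplier $\sqrt{\log K}$ (on the term $K^{-h(a)}$) at $a=0$. For each fixed $d$, the expectation term is of lower order, so the bound simplifies to $O\big(\alpha^{-1/2}d^{-1/2}K^{-h(a)}\big)$ (for FGM with the additional multiplier $\sqrt{\log K}$ at $a=0$); this simplification is not uniform in $d$.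
   Context: GD: $x^{k+1}=x^k-\eta\nabla f(x^k)$, $k=0,1,\dots$. FGM: $y^0=x^0$ and $x^{k+1}=y^k-\eta\nabla f(y^k)$, $y^{k+1}=x^{k+1}+\gamma_k(x^{k+1}-x^k)$, $k=0,1,\dots$, with momentum coefficient $\gamma_k=k/(k+3)$. For a real random variable $X$ and $\alpha\in(0,1]$, $\mathbf{CVaR}_\alpha(X)=\inf_{t\in\mathbf{R}}\big(t+\alpha^{-1}\mathbf{E}(X-t)_+\big)$ with $(z)_+=\max\{z,0\}$. Expectations are over the random instance $(Q,x^\star,x^0)$. $A_K\sim B_K$ means $A_K/B_K\to1$ as $K\to\infty$; $\Theta$ and $O$ refer to $K\to\infty$. Exchangeable means that the joint law of $(\lambda_1,\dots,\lambda_d)$ is invariant under permutations (e.g. i.i.d.). The condition on $w_i$ in (ii) is understood for each iteration count $K$. *)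

(* Defs.v *)
From HB Require Import structures.
From mathcomp Require Import all_boot all_order all_algebra all_fingroup.
From mathcomp Require Import all_classical all_reals all_analysis.
Import Order.TTheory GRing.Theory Num.Theory.
Import numFieldNormedType.Exports.

Set Implicit Arguments.
Unset Strict Implicit.
Unset Printing Implicit Defensive.

Local Open Scope classical_set_scope.
Local Open Scope ring_scope.

Section methods.
Context {R : realType} {n : nat}.
Implicit Types (f : 'cV[R]_n -> R) (x xs : 'cV[R]_n) (Q : 'M[R]_n).

Definition gradient f x : 'cV[R]_n := \col_i 'D_(delta_mx i 0) f x.

Definition quadratic Q xs x : R := 2^-1 * ((x - xs)^T *m Q *m (x - xs)) 0 0.

Definition symmetric_psd Q : Prop :=
  Q^T = Q /\ forall v : 'cV[R]_n, 0 <= (v^T *m Q *m v) 0 0.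

Fixpoint gd f (eta : R) x0 (k : nat) : 'cV[R]_n :=
  if k is k'.+1 then
    let x := gd f eta x0 k' in x - eta *: gradient f x
  else x0.

(* The pair (x^k, y^k). *)
Fixpoint fgm f (eta : R) x0 (k : nat) : 'cV[R]_n * 'cV[R]_n :=
  if k is k'.+1 then
    let: (x, y) := fgm f eta x0 k' in
    let x' := y - eta *: gradient f y in
    (x', x' + (k'%:R / (k' + 3)%N%:R) *: (x' - x))
  else (x0, x0).

End methods.

Variant method := GD | FGM.

Definition iterate (R : realType) (n : nat) (m : method)
    (f : 'cV[R]_n -> R) (eta : R) (x0 : 'cV[R]_n) (k : nat) : 'cV[R]_n :=
  match m with GD => gd f eta x0 k | FGM => (fgm f eta x0 k).1 end.

(* Taking n = 0 shows that at most one sequence rho has this property. *)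
Definition residual_polynomials (R : realType) (m : method) (eta : R)
    (rho : nat -> {poly R}) : Prop :=
  forall (n : nat) (Q : 'M[R]_n.+1) (xs x0 : 'cV[R]_n.+1),
    symmetric_psd Q ->
    forall K : nat, iterate m (quadratic Q xs) eta x0 K - xs
                    = horner_mx Q (rho K) *m (x0 - xs).

Section random_matrices.
Context {R : realType} {dT : measure_display} {T : measurableType dT}.
Variable P : probability T R.
Local Open Scope ereal_scope.

(* Product sigma-algebra on matrices, i.e. the Borel one. *)
Definition measurable_mx (p q : nat) : set (set 'M[R]_(p, q)) :=
  <<s [set A | exists i j (B : set (measurableTypeR R)),
         measurable B /\ A = [set M : 'M[R]_(p, q) | B (M i j)]] >>.

Definition random_mx (p q : nat) (X : T -> 'M[R]_(p, q)) : Prop :=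
  forall i j, measurable_fun [set: T] (fun w => X w i j : measurableTypeR R).

Definition same_law (p q : nat) (X Y : T -> 'M[R]_(p, q)) : Prop :=
  forall A, measurable_mx A -> P (X @^-1` A) = P (Y @^-1` A).

Definition independent_mx (p q p' q' : nat)
    (X : T -> 'M[R]_(p, q)) (Y : T -> 'M[R]_(p', q')) : Prop :=
  forall A B, measurable_mx A -> measurable_mx B ->
    P (X @^-1` A `&` Y @^-1` B) = P (X @^-1` A) * P (Y @^-1` B).

Definition rotation_invariant (n : nat) (X : T -> 'cV[R]_n) : Prop :=
  forall U : 'M[R]_n, U *m U^T = 1%:M -> same_law (fun w => U *m X w) X.

Definition exchangeable (n : nat) (X : T -> 'rV[R]_n) : Prop :=
  forall s : 'S_n, same_law (fun w => col_perm s (X w)) X.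

Definition has_law (X : T -> R) (mu : set (measurableTypeR R) -> \bar R) : Prop :=
  forall B : set (measurableTypeR R), measurable B -> P (X @^-1` B) = mu B.

(* normal_prob m 0 is a uniform law, hence the case split. *)
Definition gaussian_law (m s : R) : set (measurableTypeR R) -> \bar R :=
  if s == 0%R then \d_m else normal_prob m s.

Definition gaussian_vector (n : nat) (X : T -> 'cV[R]_n) : Prop :=
  forall u : 'cV[R]_n, exists m s : R,
    has_law (fun w => (u^T *m X w) 0%R 0%R) (gaussian_law m s).

(* Valued in \bar R: no integrability of X is assumed. *)
Definition CVaR (alpha : R) (X : T -> R) : \bar R :=
  ereal_inf [set t%:E + (alpha^-1)%:E * 'E_P[fun w => Num.max (X w - t)%R 0%R]
            | t in [set: R]].

Definition L2_bound (alpha : R) (X : T -> R) : \bar R :=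
  sqrte ((alpha^-1)%:E * 'E_P[fun w => (X w ^+ 2)%R]).

End random_matrices.

Definition has_density (R : realType) (nu : set (measurableTypeR R) -> \bar R)
    (p : R -> R) : Prop :=
  [/\ measurable_fun [set: measurableTypeR R] (p : measurableTypeR R -> R),
      forall x, 0 <= p x &
      forall B : set (measurableTypeR R), measurable B ->
        nu B = (\int[lebesgue_measure]_(x in B) (p x)%:E)%E].

Record random_instance (R : realType) (dT : measure_display)
    (T : measurableType dT) (P : probability T R) (L r : R)
    (nu : set (measurableTypeR R) -> \bar R) (n : nat)
    (Q : T -> 'M[R]_n) (xs x0 : T -> 'cV[R]_n) (lam : T -> 'rV[R]_n) : Prop :=
  RandomInstance {
    ri_measurable_Q : random_mx Q;
    ri_measurable_xs : random_mx xs;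
    ri_measurable_x0 : random_mx x0;
    ri_measurable_lam : random_mx lam;
    ri_psd : forall w, symmetric_psd (Q w);
    ri_eigenvalues : forall w,
      char_poly (Q w) = \prod_(i < n) ('X - (lam w 0 i)%:P);
    ri_range : forall w i, 0 <= lam w 0 i <= L;
    ri_exchangeable : exchangeable P lam;
    ri_marginal : forall i, has_law P (fun w => lam w 0 i) nu;
    ri_independent : independent_mx P (fun w => x0 w - xs w) Q;
    ri_rotation : rotation_invariant P (fun w => x0 w - xs w);
    ri_second_moment :
      ('E_P[fun w => (\sum_(i < n) (x0 w - xs w) i 0%R ^+ 2)%R] = (r ^+ 2)%:E)%E
  }.

Definition suboptimality (R : realType) (T : Type) (n : nat) (m : method)
    (L : R) (Q : T -> 'M[R]_n) (xs x0 : T -> 'cV[R]_n) (K : nat) (w : T) : R :=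
  let f := quadratic (Q w) (xs w) in
  f (iterate m f L^-1 (x0 w) K) - f (xs w).

Definition spectral_weight (R : realType) (T : Type) (n : nat)
    (rho : nat -> {poly R}) (lam : T -> 'rV[R]_n) (K : nat) (i : 'I_n)
    (w : T) : R :=
  lam w 0 i * (rho K).[lam w 0 i] ^+ 2.

Definition negatively_correlated_weights (R : realType) (dT : measure_display)
    (T : measurableType dT) (P : probability T R) (n : nat)
    (rho : nat -> {poly R}) (lam : T -> 'rV[R]_n) : Prop :=
  forall (K : nat) (i j : 'I_n), i != j ->
    let W := spectral_weight rho lam K in
    ('E_P[fun w => (W i w * W j w)%R] <= 'E_P[W i] * 'E_P[W j])%E.

Section rates.
Context {R : realType}.
Implicit Types (m : method) (a : R) (K : nat).

(* Decay of E(phi^K); for FGM the exponent is e(a). *)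
Definition mean_exponent m a : R :=
  match m with
  | GD => a + 2
  | FGM => if a <= - 2^-1 then 2 * (a + 2) else a + 7 / 2
  end.

Definition mean_log m a K : R :=
  match m with
  | GD => 1
  | FGM => if a == - 2^-1 then ln K%:R else 1
  end.

Definition mean_rate m a K : R :=
  K%:R `^ (- mean_exponent m a) * mean_log m a K.

(* Decay of E(w_i^2)^(1/2); the exponent is h(a). *)
Definition rms_exponent m a : R :=
  match m with
  | GD => (a + 3) / 2
  | FGM => if a <= 0 then a + 3 else a / 2 + 3
  end.

Definition rms_log m a K : R :=
  match m with
  | GD => 1
  | FGM => if a == 0 then Num.sqrt (ln K%:R) else 1
  end.

Definition rms_rate m a K : R :=
  K%:R `^ (- rms_exponent m a) * rms_log m a K.

End rates.

(* Main.v *)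
Require Import Defs.
From HB Require Import structures.
From mathcomp Require Import all_boot all_order all_algebra all_fingroup.
From mathcomp Require Import all_classical all_reals all_analysis.
From mathcomp Require Import measurable_realfun simple_functions ring lra.
From mathcomp Require complex.
Import Order.TTheory GRing.Theory Num.Theory.
Import numFieldNormedType.Exports.

(** Write M for the matrix Q rho_K(Q)^2 and e for the initial error.  Then
    phi^K = 1/2 e^T M e, where M is positive semidefinite, independent of e, and
    has trace sum_i w_i.  Rotation invariance makes the covariance of e equal to
    (r^2/d) I, so E phi^K = (r^2/2) int w_K dnu with w_K(l) = l rho_K(l)^2
    ([mean_phi]), and everything about the mean is a statement on the
    one-dimensional integrals of w_K near 0, where nu has a density comparable to
    l^a.

    For GD, rho_K(l) = (1 - l/L)^K.  For FGM the recurrence of the momentum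
    coefficients k/(k+3) is that of the Gegenbauer polynomials of index 3/2:
    with x^2 = 1 - l/L and c_k normalised by c_k(1) = 1, one has
    rho_K(l) = x^(K+1) c_(K-1)(x) ([fgm_residual_gegenbauer]).  Put x = cos theta,
    N = k + 3/2 and u = (sin theta)^(3/2) c_k(x); the Gegenbauer equation becomes
    u'' + h u = 0 with h = N^2 - 3/(4 sin^2 theta).  As h increases on ]0, pi/2[,
    the energy F = u'^2 + h u^2 increases and F/h decreases (Sonin), which pins F
    between two multiples of 1/N once sin theta >= 1/N
    ([sonin_energy_bounds]).  The upper bound gives
    rho_K(l)^2 = O(K^-3 (l/L)^(-3/2)) ([gegenbauer_decay]); the lower bound and
    the identity 2 h u^2 = F - (u u')' show that u^2 is not small on average,
    whatever the phases of the oscillation ([oscillation_ge]).  Together with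
    rho_K^2 >= 1/8 when l <= L/(4 K^2), this yields matching bounds
    ([mean_upper], [mean_lower]): for FGM the region l of order K^-2 dominates
    when a < -1/2, the region l of order 1/K when a > -1/2, and at
    a = -1/2 every scale in between contributes equally, whence the logarithm.
    The rates for int w_K^2 dnu come out of the same two regimes, with
    the critical exponent a = 0 ([rms_upper]).

    For the risk, t = 0 in the definition gives CVaR <= E phi / alpha.
    Conversely CVaR >= E(phi 1_A) / alpha for each event A of probability at most
    alpha ([CVaR_ge]).  Take for A the event that some eigenvalue lies in ]0, z]
    with z small: outside A every component of the error that contributes to phi has
    contracted geometrically, so A carries asymptotically all of E phi.

    In the second part, (X - t)_+ <= X^2 / (4 t), optimised over t, gives
    CVaR <= sqrt(E phi^2 / alpha) ([CVaR_le_L2]).  Under sign flips the moments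
    E e_i e_j e_k e_l vanish unless the indices pair up, and Gaussian
    kurtosis bounds the others by a multiple of r^4/d^2; hence
    E phi^2 <= C (r^4/d^2) E (tr M)^2, and negative correlation of the w_i bounds
    E (tr M)^2 by d int w_K^2 dnu + (d int w_K dnu)^2 ([mean_phi_sqr_le]).  The
    remaining claims compare the exponents: the mean decays faster than the
    root mean square, but E phi^K does not depend on d whereas the
    other term carries d^(-1/2), so for fixed K the mean prevails in high
    dimension. *)

Set Implicit Arguments.
Unset Strict Implicit.
Unset Printing Implicit Defensive.
Local Open Scope classical_set_scope.
Local Open Scope ring_scope.

(** * Gegenbauer polynomials of index 3/2 *)

Section monotone.
Context {R : realType}.

Lemma ge0_is_derive_le (f f' : R -> R) (a b : R) : a <= b ->
  (forall x, a <= x <= b -> is_derive x 1 f (f' x)) ->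
  (forall x, a <= x <= b -> 0 <= f' x) -> f a <= f b.
Proof.
move=> ab df f'0.
have [||c cab E] := @MVT_segment R f f' a b ab.
- by move=> x /[!in_itv]/= /andP[ax xb]; apply: df; rewrite !ltW.
- apply: derivable_within_continuous => x /[!in_itv]/= xab.
  by have := df x xab => -[].
by rewrite -subr_ge0 E mulr_ge0 ?subr_ge0// f'0//; rewrite in_itv in cab.
Qed.

Lemma ge0_deriv_le (p : {poly R}) (a b : R) : a <= b ->
  (forall x, a <= x <= b -> 0 <= p^`().[x]) -> p.[a] <= p.[b].
Proof.
by move=> ab h; apply: (@ge0_is_derive_le (horner p) (horner p^`())).
Qed.
End monotone.

Section gegenbauer.
Context {R : realType}.
Implicit Types (j : nat) (x : R).

(** The polynomials C_j^(3/2) divided by their value at 1: with this normalisation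
    the three-term recurrence has the momentum coefficients of FGM. *)
Fixpoint gegenbauer j : {poly R} :=
  match j with
  | 0 => 1
  | j'.+1 => match j' with
     | 0 => 'X
     | j''.+1 => (j' + 3)%:R^-1%:P *
        ((j'.*2 + 3)%:R *  'X * gegenbauer j' - j'%:R * gegenbauer j'')
     end
  end.

Lemma gegenbauerS j :
  (j + 4)%:R * gegenbauer j.+2 =
  (2 * j + 5)%:R * 'X * gegenbauer j.+1 - j.+1%:R * gegenbauer j.
Proof.
rewrite [gegenbauer j.+2]/= -/(gegenbauer j.+1).
rewrite mulrA (_ : (j + 4)%:R = ((j.+1 + 3)%:R)%:P); last first.
  by rewrite addSnnS polyC_natr.
rewrite -polyCM mulfV ?mul1r; last by rewrite pnatr_eq0 addn_eq0.
by rewrite doubleS -mul2n addSnnS addSnnS.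
Qed.

Lemma deriv_natr n : (n%:R : {poly R})^`() = 0.
Proof. by rewrite -polyC_natr derivC. Qed.

Lemma horner_natr n x : (n%:R : {poly R}).[x] = n%:R.
Proof. by rewrite -polyC_natr hornerC. Qed.

(** Both relations are carried by one induction: eliminating a neighbour with the
    recurrence turns one into the other, and differentiating the recurrence gives
    the step. *)
Lemma gegenbauer_diff j :
  (1 - 'X ^+ 2) * (gegenbauer j.+1)^`() =
    j.+1%:R * (gegenbauer j - 'X * gegenbauer j.+1)
  /\ (1 - 'X ^+ 2) * (gegenbauer j)^`() =
     (j + 3)%:R * ('X * gegenbauer j - gegenbauer j.+1).
Proof.
elim: j => [|j [IHA IHB]].
  by rewrite /= derivX -polyC1 derivC; split; ring.
have B : (1 - 'X ^+ 2) * (gegenbauer j.+1)^`() =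
     (j.+1 + 3)%:R * ('X * gegenbauer j.+1 - gegenbauer j.+2).
  rewrite mulrBr (_ : (j.+1 + 3) = j + 4)%N; last by rewrite addSnnS.
  rewrite gegenbauerS IHA.
  by rewrite (natrD _ j 4) (natrD _ (2 * j) 5) natrM -!natr1; ring.
split=> //.
have n0 : (j + 4)%:R != 0 :> {poly R}.
  by rewrite -polyC_natr polyC_eq0 pnatr_eq0 addn_eq0 andbF.
apply: (mulfI n0).
have D : (j + 4)%:R * (gegenbauer j.+2)^`() =
    (2 * j + 5)%:R * (gegenbauer j.+1 + 'X * (gegenbauer j.+1)^`())
    - j.+1%:R * (gegenbauer j)^`().
  have := congr1 (@deriv R) (gegenbauerS j).
  by rewrite !(derivB, derivM) !deriv_natr derivX mul0r add0r => ->; ring.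
rewrite mulrCA D.
transitivity ((2 * j + 5)%:R * ((1 - 'X ^+ 2) * gegenbauer j.+1 +
   'X * ((1 - 'X ^+ 2) * (gegenbauer j.+1)^`()))
   - j.+1%:R * ((1 - 'X ^+ 2) * (gegenbauer j)^`())); first by ring.
rewrite IHA IHB.
transitivity ((j + 4)%:R * (j.+2%:R * gegenbauer j.+1) -
   j.+2%:R * 'X * ((j + 4)%:R * gegenbauer j.+2)); last by ring.
rewrite gegenbauerS.
rewrite !(natrD _ j) (natrD _ (2 * j) 5) natrM -!natr1; ring.
Qed.

(** Differentiating the first relation of [gegenbauer_diff] and eliminating
    c_j and c_j' with both relations. *)
Lemma gegenbauer_ode j :
  (1 - 'X ^+ 2) * (gegenbauer j)^`()^`() =
    4%:R * 'X * (gegenbauer j)^`() - (j * (j + 3))%:R * gegenbauer j.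
Proof.
case: j => [|j]; first by rewrite /= -polyC1 derivC deriv0 mul0n; ring.
have [A B] := gegenbauer_diff j.
have D := congr1 (@deriv R) A.
rewrite !(derivB, derivM) !deriv_natr (deriv_natr 1) derivX in D.
have q0 : (1 - 'X ^+ 2 : {poly R}) != 0.
  apply/eqP => /(congr1 (horner^~ 0)); rewrite !hornerE => /eqP.
  by rewrite expr0n /= subr0 oner_eq0.
apply: (mulfI q0).
have -> : (1 - 'X ^+ 2) * (gegenbauer j.+1)^`()^`() =
  j.+1%:R * ((gegenbauer j)^`() - (gegenbauer j.+1 + 'X * (gegenbauer j.+1)^`()))
  + 2%:R * 'X * (gegenbauer j.+1)^`().
  apply: (addrI ((0 - (1 * 'X + 'X * 1)) * (gegenbauer j.+1)^`())).
  by rewrite [LHS]D; ring.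
transitivity (j.+1%:R * (((1 - 'X ^+ 2) * (gegenbauer j)^`()) -
  ((1 - 'X ^+ 2) * gegenbauer j.+1 + 'X * ((1 - 'X ^+ 2) * (gegenbauer j.+1)^`())))
  + 2%:R * 'X * ((1 - 'X ^+ 2) * (gegenbauer j.+1)^`())); first by ring.
rewrite [RHS](_ : _ = 4%:R * 'X * ((1 - 'X ^+ 2) * (gegenbauer j.+1)^`()) -
  (1 - 'X ^+ 2) * ((j.+1 * (j.+1 + 3))%:R * gegenbauer j.+1)); last by ring.
rewrite A B natrM !(natrD _ _ 3) -!natr1; ring.
Qed.

Lemma gegenbauer1 j : (gegenbauer j).[1] = 1.
Proof.
have [] : (gegenbauer j).[1] = 1 /\ (gegenbauer j.+1).[1] = 1 => //.
elim: j => [|j [IH0 IH1]]; first by rewrite /= !hornerE.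
split=> //.
move: (congr1 (horner^~ 1) (gegenbauerS j)) IH0 IH1.
move: (gegenbauer j) (gegenbauer j.+1) (gegenbauer j.+2) => p q s + IH0 IH1.
rewrite !(hornerM, hornerD, hornerN, horner_natr, hornerX) IH0 IH1.
rewrite (natrD _ (2 * j) 5) natrM natrD -!natr1 => h.
have n0 : (j%:R + 4%:R : R) != 0 by rewrite -natrD pnatr_eq0 addn_eq0 andbF.
rewrite -!natr1 in n0.
by apply: (mulfI n0); rewrite h; ring.
Qed.

End gegenbauer.

(** * Sonin energy of a Gegenbauer polynomial *)

Local Ltac nneg := repeat first [by [] | assumption | exact: sqr_ge0 | exact: ler0n |
  solve [apply: ltW; assumption] | apply: exprn_ge0 | apply: mulr_ge0 | apply: addr_ge0].

Lemma deriv_onem_sqr {R : realType} (q : {poly R}) z :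
  ((1 - 'X ^+ 2) * (q * q))^`().[z] =
  2 * q.[z] * ((1 - z ^+ 2) * q^`().[z] - z * q.[z]).
Proof. by rewrite !poly.derivE !hornerE /=; ring. Qed.

Lemma deriv_onem3_sqr {R : realType} (q : {poly R}) z :
  ((1 - 'X ^+ 2) ^+ 3 * (q * q))^`().[z] =
  2 * (1 - z ^+ 2) ^+ 2 * q.[z] * ((1 - z ^+ 2) * q^`().[z] - 3 * z * q.[z]).
Proof. by rewrite !poly.derivE !hornerE /=; ring. Qed.

(** All that the energy method uses of c_j; M = j (j + 3) is the eigenvalue and
    N = j + 3/2 the frequency of the oscillations in the angular variable. *)
Record gegenbauer_equation {R : realType} (g : {poly R}) (M N : R) : Prop := {
  ge_M : 0 < M;
  ge_N : 0 < N;
  ge_NM : N ^+ 2 = M + 9 / 4;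
  ge_ode : forall x : R,
    (1 - x ^+ 2) * g^`()^`().[x] = 4 * x * g^`().[x] - M * g.[x];
  ge_1 : g.[1] = 1 }.

Section sonin.
Context {R : realType}.
Variables (g : {poly R}) (M N : R).
Hypothesis geq : gegenbauer_equation g M N.
Local Notation d := g^`().

(** The energy (1 - x^2) g'^2 + M g^2 is nondecreasing on [0, 1]: by the equation
    its derivative is 6 x g'^2.  It equals M at 1. *)
Lemma gegenbauer_le1 x : 0 <= x <= 1 -> g.[x] ^+ 2 <= 1.
Proof. have [M0 N0 NM ode g1] := geq.
move=> /andP[x0 x1].
pose E := (1 - 'X ^+ 2) * (d * d) + M%:P * (g * g).
have : E.[x] <= E.[1].
  apply: ge0_deriv_le => // y /andP[xy y1].
  have := congr1 ( *%R (2 * d.[y])) (ode y).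
  rewrite /E !poly.derivE !hornerE /= => h.
  have : 0 <= 6 * y * d.[y] ^+ 2.
    by rewrite mulr_ge0 ?sqr_ge0// mulr_ge0// (le_trans x0).
  lra.
rewrite /E !hornerE /= g1 => h.
have : M * g.[x] ^+ 2 <= M * 1.
  have : 0 <= (1 - x ^+ 2) * d.[x] ^+ 2.
    by rewrite mulr_ge0 ?sqr_ge0// subr_ge0 expr_le1.
  lra.
by rewrite ler_pM2l.
Qed.

(** The equation bounds the derivative of (1 - x^2)^2 g' by M (1 - x^2) |g|, which
    is at most that of -(M/2) (1 - x^2)^2 when x >= 1/2 and |g| <= 1; both
    functions vanish at 1. *)
Lemma gegenbauer_deriv_le (x : R) : 2^-1 <= x <= 1 -> `|d.[x]| <= M / 2.
Proof. have [M0 N0 NM ode g1] := geq.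
move=> /andP[x0 x1].
have [->|xn1] := eqVneq x 1.
  have := ode 1; rewrite g1 expr1n subrr mul0r !mulr1 => h.
  have -> : d.[1] = M / 4 by lra.
  have M4 : 0 <= M / 4 <= M / 2 by lra.
  by rewrite ger0_norm; case/andP: M4.
have t0 : 0 < 1 - x ^+ 2 by rewrite subr_gt0 expr_lt1 ?lt_neqAle ?xn1//; lra.
have gb y : x <= y <= 1 -> -1 <= g.[y] <= 1.
  move=> /andP[xy y1]; rewrite -ler_norml -(@ler_pXn2r _ 2) ?nnegrE//.
  by rewrite real_normK ?num_real// expr1n gegenbauer_le1//; apply/andP; split; lra.
have key s : (s = 1) \/ (s = -1) -> 0 <= s * d.[x] + M / 2.
  move=> hs.
  pose E := (- s%:P) * ((1 - 'X ^+ 2) ^+ 2 * d) - (M / 2)%:P * (1 - 'X ^+ 2) ^+ 2.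
  have : E.[x] <= E.[1].
    apply: ge0_deriv_le => // y xy1; have /andP[xy y1] := xy1.
    have := congr1 ( *%R (1 - y ^+ 2)) (ode y).
    have /andP[g1' g2'] := gb y xy1.
    rewrite /E !poly.derivE !hornerE /= => h.
    have ty : 0 <= 1 - y ^+ 2 by nra.
    have : 0 <= (1 - y ^+ 2) * M * (2 * y + s * g.[y]).
      apply: mulr_ge0; first by rewrite mulr_ge0 // ltW.
      by case: hs => hs; subst s; lra.
    by case: hs => hs; subst s; lra.
  rewrite /E !hornerE /= expr1n subrr => h.
  rewrite -(@pmulr_rge0 _ ((1 - x ^+ 2) ^+ 2)) ?exprn_gt0//.
  by lra.
rewrite ler_norml; have := key 1 (or_introl erefl); have := key (-1) (or_intror erefl).
lra.
Qed.

Lemma gegenbauer_ge (x : R) : 2^-1 <= x <= 1 -> 1 - M / 2 * (1 - x) <= g.[x].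
Proof. have [M0 N0 NM ode g1] := geq.
move=> /andP[x0 x1].
pose E := (M / 2)%:P * 'X - g.
have : E.[x] <= E.[1].
  apply: ge0_deriv_le => // y /andP[xy y1].
  have : `|d.[y]| <= M / 2 by apply: gegenbauer_deriv_le; rewrite y1 (le_trans x0).
  rewrite ler_norml /E !poly.derivE !hornerE /=; lra.
rewrite /E !hornerE /= g1; lra.
Qed.

(** With x = cos theta, t = 1 - x^2 and u = t^(3/4) g, one has u' = t^(1/4) P. *)
Definition soninP := (3 / 2)%:P * 'X * g - (1 - 'X ^+ 2) * d.
(** The energy F = u'^2 + (N^2 - 3/(4t)) u^2 divided by sqrt t, which makes it a
    polynomial in x. *)
Definition soninPsi :=
  soninP * soninP + ((N ^+ 2)%:P * (1 - 'X ^+ 2) - (3 / 4)%:P) * (g * g).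

(** Only the coefficient of u^2 in F depends explicitly on theta, so the derivative
    of F is that of -3/(4t) times u^2; this is the same fact in the variable x. *)
Lemma soninPsi_deriv (x : R) :
  (1 - x ^+ 2) * soninPsi^`().[x] = x * soninPsi.[x] - 3 / 2 * x * g.[x] ^+ 2.
Proof. have [M0 N0 NM ode g1] := geq.
rewrite /soninPsi /soninP !poly.derivE !hornerE /= NM.
pose c := - 2 * (3 / 2 * x * g.[x] - (1 - x ^+ 2) * d.[x]) * (1 - x ^+ 2).
have h1 : c * ((1 - x ^+ 2) * g^`()^`().[x] - (4 * x * d.[x] - M * g.[x])) = 0.
  by rewrite ode subrr mulr0.
by apply/eqP; rewrite -subr_eq0 -[X in _ == X]h1 /c; apply/eqP; field.
Qed.

End sonin.

Section sonin.
Context {R : realType}.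
Variables (g : {poly R}) (M N : R).
Hypothesis geq : gegenbauer_equation g M N.
Local Notation d := g^`().
Local Notation soninP := (soninP g).
Local Notation soninPsi := (soninPsi g N).

Lemma soninPsiE (x : R) : soninPsi.[x] =
  soninP.[x] ^+ 2 + (N ^+ 2 * (1 - x ^+ 2) - 3 / 4) * g.[x] ^+ 2.
Proof. have [M0 N0 NM ode g1] := geq. by rewrite /soninPsi !hornerE /=; ring. Qed.

Lemma soninPsi_ge0 (x : R) : 3 / 4 <= N ^+ 2 * (1 - x ^+ 2) -> 0 <= soninPsi.[x].
Proof. have [M0 N0 NM ode g1] := geq.
by move=> h; rewrite soninPsiE addr_ge0 ?sqr_ge0// mulr_ge0 ?sqr_ge0 ?subr_ge0.
Qed.

(** F decreases in x, since -3/(4t) does.  The square t Psi^2 of F is compared instead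
    because it is a polynomial. *)
Lemma sonin_energy_le (x y : R) : 0 <= x <= y -> y <= 1 ->
  3 / 4 <= N ^+ 2 * (1 - y ^+ 2) ->
  (1 - y ^+ 2) * soninPsi.[y] ^+ 2 <= (1 - x ^+ 2) * soninPsi.[x] ^+ 2.
Proof. have [M0 N0 NM ode g1] := geq.
move=> /andP[x0 xy] y1 Ny.
pose E := - ((1 - 'X ^+ 2) * (soninPsi * soninPsi)).
have : E.[x] <= E.[y].
  apply: ge0_deriv_le => // z /andP[xz zy].
  have Psi0 : 0 <= soninPsi.[z].
    apply: soninPsi_ge0; apply: (le_trans Ny); rewrite ler_pM2l ?exprn_gt0//.
    by rewrite lerB// lerXn2r ?nnegrE// (le_trans x0)// (le_trans xz).
  have h := soninPsi_deriv geq z.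
  have : 0 <= 3 * z * g.[z] ^+ 2 * soninPsi.[z].
    have z0 := le_trans x0 xz.
    nneg.
  rewrite /E derivN hornerN deriv_onem_sqr h; lra.
by rewrite /E !hornerE /= -!expr2; lra.
Qed.

(** Sonin's second monotonicity: with h = N^2 - 3/(4t), the quotient
    F/h = u^2 + u'^2/h has derivative -h' u'^2/h^2 in theta.  Here it is squared and
    written in x. *)
Lemma sonin_ratio_le (x y : R) : 0 <= x <= y -> y <= 1 ->
  3 / 4 < N ^+ 2 * (1 - y ^+ 2) ->
  (1 - x ^+ 2) ^+ 3 * soninPsi.[x] ^+ 2 / (N ^+ 2 * (1 - x ^+ 2) - 3 / 4) ^+ 2 <=
  (1 - y ^+ 2) ^+ 3 * soninPsi.[y] ^+ 2 / (N ^+ 2 * (1 - y ^+ 2) - 3 / 4) ^+ 2.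
Proof. have [M0 N0 NM ode g1] := geq.
move=> /andP[x0 xy] y1 Ny.
pose A := (1 - 'X ^+ 2) ^+ 3 * (soninPsi * soninPsi).
pose B := (N ^+ 2)%:P * (1 - 'X ^+ 2) - (3 / 4)%:P.
have AE z : A.[z] = (1 - z ^+ 2) ^+ 3 * soninPsi.[z] ^+ 2.
  by rewrite /A !hornerE /=; ring.
have BE z : B.[z] = N ^+ 2 * (1 - z ^+ 2) - 3 / 4 by rewrite /B !hornerE.
rewrite -!AE -!BE.
have Bz z : x <= z <= y -> 0 < B.[z].
  move=> /andP[xz zy]; rewrite BE subr_gt0 (lt_le_trans Ny)//.
  rewrite ler_pM2l ?exprn_gt0// lerB// lerXn2r ?nnegrE//;
    by rewrite (le_trans x0)// (le_trans xz).
pose f' z := (A^`().[z] * B.[z] - 2 * A.[z] * B^`().[z]) / B.[z] ^+ 3.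
apply: (@ge0_is_derive_le R (fun z => A.[z] / B.[z] ^+ 2) f') => // z zxy.
  have Bn : B.[z] != 0 by rewrite gt_eqF// Bz.
  have Bn2 : B.[z] ^+ 2 != 0 by rewrite expf_neq0.
  have D : is_derive z 1 (fun z => B.[z] ^+ 2) (2 * B.[z] * B^`().[z]).
    by apply: is_derive_eq; rewrite /GRing.scale /=; ring.
  have DV := @is_deriveV R (fun z => B.[z] ^+ 2) z _ 1 Bn2 D.
  have := @is_deriveM _ _ _ _ _ _ _ _ (is_derive_poly A z) DV.
  move=> DM; apply: is_derive_eq.
  rewrite /f' /GRing.scale /=; field.
  by rewrite Bn.
have /andP[xz zy] := zxy.
have z0 : 0 <= z by rewrite (le_trans x0).
have Bz0 := Bz _ zxy.
apply: divr_ge0; last by rewrite exprn_ge0 ?ltW.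
have h := soninPsi_deriv geq z.
have Psi0 : 0 <= soninPsi.[z].
  by apply: soninPsi_ge0; rewrite -subr_ge0 -BE ltW.
rewrite [A^`().[z]]deriv_onem3_sqr.
have -> : B^`().[z] = - 2 * N ^+ 2 * z.
  by rewrite /B !poly.derivE !hornerE /=; ring.
rewrite h.
have -> : 2 * (1 - z ^+ 2) ^+ 2 * soninPsi.[z] *
  (z * soninPsi.[z] - 3 / 2 * z * g.[z] ^+ 2 - 3 * z * soninPsi.[z]) * B.[z] -
  2 * A.[z] * (- 2 * N ^+ 2 * z) =
  3 * z * (1 - z ^+ 2) ^+ 2 * soninPsi.[z] * (soninP.[z] ^+ 2).
  rewrite AE (_ : soninP.[z] ^+ 2 = soninPsi.[z] - B.[z] * g.[z] ^+ 2).
    by rewrite BE; field.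
  by rewrite soninPsiE BE; ring.
nneg.
Qed.

(* The pivot t = 1/N^2, next to the turning point t = 3/(4 N^2) of h. *)
Let x0 : R := Num.sqrt (1 - N ^- 2).

Lemma soninN : 9 / 4 <= N ^+ 2.
Proof. have [M0 N0 NM ode g1] := geq. lra. Qed.

(** At the pivot the polynomial is still close to its value at 1, by
    [gegenbauer_ge], which calibrates the energy from both sides. *)
Lemma sonin_pivot : [/\ 2^-1 <= x0 <= 1, N ^+ 2 * (1 - x0 ^+ 2) = 1,
  2^-1 <= g.[x0] & soninP.[x0] ^+ 2 <= 4].
Proof. have [M0 N0 NM ode g1] := geq.
have N2 : 0 < N ^+ 2 by rewrite exprn_gt0.
have N94 := soninN.
have V0 : 0 < N ^- 2 by rewrite invr_gt0.
have V1 : N ^- 2 <= 4 / 9.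
  by rewrite -[4 / 9]invrK lef_pV2 ?posrE//; lra.
have E : x0 ^+ 2 = 1 - N ^- 2 by rewrite sqr_sqrtr//; lra.
have t1 : N ^+ 2 * (1 - x0 ^+ 2) = 1.
  by rewrite E opprB addrC subrK mulfV// gt_eqF.
have x00 : 0 <= x0 by rewrite sqrtr_ge0.
have x01 : 2^-1 <= x0 <= 1.
  apply/andP; split; nra.
have /andP[xh x1] := x01.
have MV : M * (1 - x0 ^+ 2) <= 1 by nra.
have gh : 2^-1 <= g.[x0].
  have := gegenbauer_ge geq x01; nra.
split=> //.
have : `|soninP.[x0]| <= 2.
  have dx := gegenbauer_deriv_le geq x01.
  have gx : `|g.[x0]| <= 1.
    rewrite -(@ler_pXn2r _ 2) ?nnegrE// real_normK ?num_real// expr1n.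
    by apply: (gegenbauer_le1 geq); rewrite x00.
  move: dx gx; rewrite !ler_norml => /andP[d1 d2] /andP[g1' g2'].
  have td1 : (1 - x0 ^+ 2) * d.[x0] <= 2^-1 by nra.
  have td2 : - 2^-1 <= (1 - x0 ^+ 2) * d.[x0] by nra.
  have xg1 : x0 * g.[x0] <= 1 by nra.
  have xg2 : 0 <= x0 * g.[x0] by nra.
  rewrite /soninP !hornerE /=; apply/andP; split; nra.
move=> h; rewrite -[_ ^+ 2]real_normK ?num_real//.
by rewrite (_ : 4 = 2 ^+ 2) ?lerXn2r ?nnegrE//; ring.
Qed.

Lemma sonin_pivot_le (x : R) : 0 <= x <= 1 -> 1 <= N ^+ 2 * (1 - x ^+ 2) ->
  x <= x0.
Proof. have [M0 N0 NM ode g1] := geq.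
move=> /andP[xge0 x1] h; have [/andP[xh _] t1 _ _] := sonin_pivot.
rewrite -(@ler_pXn2r _ 2) ?nnegrE//; last by apply: le_trans xh.
have : N ^+ 2 * (1 - x0 ^+ 2) <= N ^+ 2 * (1 - x ^+ 2) by rewrite t1.
by rewrite ler_pM2l ?exprn_gt0// => ?; lra.
Qed.

(** The energy F = s Psi, with s = sqrt t, is of order 1/N away from x = 1: compare
    it with its value at the pivot, from below by [sonin_energy_le] and from above
    by [sonin_ratio_le]. *)
Lemma sonin_energy_bounds (x s : R) : 0 <= x -> 0 <= s -> x ^+ 2 + s ^+ 2 = 1 ->
  1 <= N * s -> 1 / 16 <= N * (s * soninPsi.[x]) <= 17.
Proof. have [M0 N0 NM ode g1] := geq.
move=> xge0 s0 xs Ns.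
have sE : 1 - x ^+ 2 = s ^+ 2 by rewrite -xs; ring.
have x1 : x <= 1 by rewrite -(@ler_pXn2r _ 2) ?nnegrE// expr1n -subr_ge0 sE sqr_ge0.
have Ns2 : 1 <= N ^+ 2 * (1 - x ^+ 2) by rewrite sE -exprMn exprn_ege1.
have x01 : 0 <= x <= 1 by rewrite xge0.
have xx0 := sonin_pivot_le x01 Ns2.
have [/andP[xh x0l] t1 gh P4] := sonin_pivot.
have Psi0 : 0 <= soninPsi.[x] by apply: soninPsi_ge0; lra.
have x0E : soninPsi.[x0] = soninP.[x0] ^+ 2 + 1 / 4 * g.[x0] ^+ 2.
  by rewrite soninPsiE t1; congr (_ + _ * _); field.
have Y0 : 0 <= N * (s * soninPsi.[x]) by nneg.
have Ysq : (N * (s * soninPsi.[x])) ^+ 2 =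
  N ^+ 2 * ((1 - x ^+ 2) * soninPsi.[x] ^+ 2) by rewrite sE; ring.
have Y0sq : N ^+ 2 * ((1 - x0 ^+ 2) * soninPsi.[x0] ^+ 2) = soninPsi.[x0] ^+ 2.
  by rewrite mulrA t1 mul1r.
have g0 : 0 <= g.[x0] by apply: le_trans gh.
have glb : 1 / 4 <= g.[x0] ^+ 2 by nra.
have gub : g.[x0] ^+ 2 <= 1 by apply: (gegenbauer_le1 geq); rewrite (le_trans _ xh).
have P0 := sqr_ge0 soninP.[x0].
apply/andP; split.
  rewrite -(@ler_pXn2r _ 2) ?nnegrE// Ysq.
  apply: (@le_trans _ _ (N ^+ 2 * ((1 - x0 ^+ 2) * soninPsi.[x0] ^+ 2))); last first.
    rewrite ler_pM2l ?exprn_gt0//; apply: sonin_energy_le => //; first by rewrite xge0.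
    rewrite t1; lra.
  rewrite Y0sq lerXn2r ?nnegrE// x0E; lra.
rewrite -(@ler_pXn2r _ 2) ?nnegrE// Ysq.
have := @sonin_ratio_le x x0; rewrite xge0 xx0 x0l t1 => /(_ isT isT).
have -> : (3 / 4 < 1 :> R) by lra.
move=> /(_ isT).
have B0 : 0 < N ^+ 2 * (1 - x ^+ 2) - 3 / 4 by lra.
rewrite ler_pdivrMr ?exprn_gt0// => h.
have t0 : 0 < 1 - x ^+ 2 by rewrite -(@pmulr_rgt0 _ (N ^+ 2)) ?exprn_gt0//; lra.
rewrite -(@ler_pM2l _ ((1 - x ^+ 2) ^+ 2)) ?exprn_gt0//.
have -> : (1 - x ^+ 2) ^+ 2 * (N ^+ 2 * ((1 - x ^+ 2) * soninPsi.[x] ^+ 2)) =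
   N ^+ 2 * ((1 - x ^+ 2) ^+ 3 * soninPsi.[x] ^+ 2) by ring.
rewrite -(@ler_pM2l _ (N ^+ 2)) ?exprn_gt0// in h.
apply: (le_trans h).
have -> : N ^+ 2 * ((1 - x0 ^+ 2) ^+ 3 * soninPsi.[x0] ^+ 2 / (1 - 3 / 4) ^+ 2 *
  (N ^+ 2 * (1 - x ^+ 2) - 3 / 4) ^+ 2) = (N ^+ 2 * (1 - x0 ^+ 2)) ^+ 3 *
  16 * soninPsi.[x0] ^+ 2 * ((N ^+ 2 * (1 - x ^+ 2) - 3 / 4) / N ^+ 2) ^+ 2.
  by field; rewrite gt_eqF.
rewrite t1 expr1n mul1r mulrC ler_pM//.
- by rewrite sqr_ge0.
- by rewrite mulr_ge0 ?sqr_ge0.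
- apply: lerXn2r; rewrite ?nnegrE; [|exact: ltW|].
    by apply: divr_ge0; [exact: ltW|exact: exprn_ge0 (ltW N0)].
  by rewrite ler_pdivrMr ?exprn_gt0//; lra.
rewrite (_ : 16 = 4 ^+ 2); last by ring.
rewrite -exprMn lerXn2r ?nnegrE// x0E; lra.
Qed.

(** The energy dominates (N^2 - 3/(4t)) u^2, hence u^2 is O(N^-3) where N s >= 1;
    elsewhere |g| <= 1 is enough. *)
Lemma gegenbauer_decay (x s : R) : 0 <= x -> 0 <= s -> x ^+ 2 + s ^+ 2 = 1 ->
  g.[x] ^+ 2 * (N * s) ^+ 3 <= 68.
Proof. have [M0 N0 NM ode g1] := geq.
move=> xge0 s0 xs.
have sE : 1 - x ^+ 2 = s ^+ 2 by rewrite -xs; ring.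
have x1 : x <= 1 by rewrite -(@ler_pXn2r _ 2) ?nnegrE// expr1n -subr_ge0 sE sqr_ge0.
have [Ns|Ns] := leP 1 (N * s).
  have /andP[_ h] := sonin_energy_bounds xge0 s0 xs Ns.
  rewrite soninPsiE sE -exprMn in h.
  have P0 := sqr_ge0 soninP.[x]; have g0 := sqr_ge0 g.[x].
  have h2 : 1 <= (N * s) ^+ 2 by rewrite exprn_ege1.
  have : (N * s) * ((N * s) ^+ 2 / 4 * g.[x] ^+ 2) <= 17.
    apply: le_trans h; rewrite [leRHS]mulrA ler_pM2l; last by lra.
    nra.
  lra.
have Ns0 : 0 <= N * s by rewrite mulr_ge0// ltW.
apply: (@le_trans _ _ (1 * 1)); last by lra.
apply: ler_pM; rewrite ?sqr_ge0 ?exprn_ge0//.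
  by apply: (gegenbauer_le1 geq); rewrite xge0.
by rewrite expr_le1// ltW.
Qed.
End sonin.

(** * The mean size of the oscillations *)

Lemma gegenbauer_equationP {R : realType} j : (0 < j)%N ->
  gegenbauer_equation (gegenbauer j : {poly R}) (j * (j + 3))%:R (j%:R + 3 / 2).
Proof.
move=> j0; split.
- by rewrite ltr0n muln_gt0 j0 addn_gt0 j0.
- by rewrite addr_gt0// ltr0n.
- by rewrite natrM natrD; field.
- move=> x; have := congr1 (horner^~ x) (gegenbauer_ode (R := R) j).
  move: (gegenbauer j) => g.
  rewrite hornerM hornerD hornerN hornerXn -[1]polyC1 hornerC => ->.
  by rewrite hornerD hornerN !hornerM !horner_natr hornerX.
- exact: gegenbauer1.
Qed.

Section oscillation.
Context {R : realType}.
Variables (g : {poly R}) (M N : R).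
Hypothesis geq : gegenbauer_equation g M N.
Local Notation soninP := (soninP g).
Local Notation soninPsi := (soninPsi g N).

(** The product u u' as a polynomial in x. *)
Definition soninV : {poly R} := (1 - 'X ^+ 2) * (g * soninP).

(** The identity 2 h u^2 = F - (u u')' in the variable x: twice the potential energy is
    the total energy up to a derivative. *)
Lemma soninV_deriv (x : R) :
  2 * (N ^+ 2 * (1 - x ^+ 2) - 3 / 4) * g.[x] ^+ 2 = soninPsi.[x] + soninV^`().[x].
Proof.
have [M0 N0 NM ode g1] := geq.
rewrite (soninPsiE geq) NM.
have -> : soninV^`().[x] = - 2 * x * g.[x] * soninP.[x] +
   (1 - x ^+ 2) * (g^`().[x] * soninP.[x] + g.[x] * soninP^`().[x]).
  by rewrite /soninV !poly.derivE !hornerE /=; ring.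
have -> : soninP^`().[x] = 3 / 2 * g.[x] + 7 / 2 * x * g^`().[x]
    - (1 - x ^+ 2) * g^`()^`().[x].
  by rewrite /soninP !poly.derivE !hornerE /=; field.
rewrite ode.
have -> : soninP.[x] = 3 / 2 * x * g.[x] - (1 - x ^+ 2) * g^`().[x].
  by rewrite /soninP !hornerE.
by field.
Qed.

(** N |u u'| is at most the energy F, by the inequality of the two means. *)
Lemma soninV_le (x s : R) : 0 <= x -> 0 <= s -> x ^+ 2 + s ^+ 2 = 1 ->
  1 <= N * s -> `|soninV.[x]| <= 17 / N ^+ 2.
Proof.
move=> x0 s0 xs Ns; have [M0 N0 NM ode g1] := geq.
have sE : 1 - x ^+ 2 = s ^+ 2 by rewrite -xs; ring.
have /andP[_ h] := sonin_energy_bounds geq x0 s0 xs Ns.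
have -> : soninV.[x] = s ^+ 2 * (g.[x] * soninP.[x]) by rewrite /soninV !hornerE /= sE.
rewrite normrM ger0_norm ?sqr_ge0// ler_pdivlMr ?exprn_gt0//.
rewrite (soninPsiE geq) sE -exprMn in h.
apply: le_trans h.
have -> : s ^+ 2 * `|g.[x] * soninP.[x]| * N ^+ 2 =
   N * (s * ((N * s) * `|g.[x] * soninP.[x]|)) by ring.
apply: ler_wpM2l; first exact: ltW.
apply: ler_wpM2l => //.
have Ns2 : 1 <= (N * s) ^+ 2 by rewrite exprn_ege1.
have g2 := sqr_ge0 g.[x].
have P2 := sqr_ge0 soninP.[x].
apply: (@le_trans _ _ (soninP.[x] ^+ 2 + (N * s) ^+ 2 / 4 * g.[x] ^+ 2)).
  rewrite normrM -[in leRHS](real_normK (num_real g.[x])).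
  rewrite -[in leRHS](real_normK (num_real soninP.[x])).
  have := sqr_ge0 (`|soninP.[x]| - N * s / 2 * `|g.[x]|).
  lra.
rewrite lerD2l ler_wpM2r//; lra.
Qed.

(** A primitive in t of the oscillating term of [soninV_deriv] weighted by t^a: since
    dx/dt = -1/(2x), its leading term has derivative -t^a V'(x). *)
Definition soninW (a : R) (t : R) : R :=
  t `^ a * (2 * Num.sqrt (1 - t) * soninV.[Num.sqrt (1 - t)]).

Lemma soninW_is_derive (a t : R) : 0 < t < 1 -> let x := Num.sqrt (1 - t) in
  is_derive t 1 (soninW a) (t `^ a * (2 * a / t * x * soninV.[x]
     - soninV.[x] / x - soninV^`().[x])).
Proof.
move=> /andP[t0 t1] x.
have x0 : 0 < x by rewrite sqrtr_gt0 subr_gt0.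
have D1 : is_derive t 1 (fun t : R => 1 - t) (-1).
  have := is_deriveB (is_derive_cst (1:R) t 1) (is_derive_id t 1). rewrite sub0r. exact.
have Dx : is_derive t 1 (fun t : R => Num.sqrt (1 - t)) (- (2 * x)^-1).
  have onet : 0 < 1 - t by rewrite subr_gt0.
  have h := @is_derive1_comp R Num.sqrt (fun t => 1 - t) t _ _ (is_derive1_sqrt onet) D1.
  by move: h; rewrite mulrN1.
have DV : is_derive t 1 (fun t : R => soninV.[Num.sqrt (1 - t)])
    (soninV^`().[x] * (- (2 * x)^-1)).
  exact: (@is_derive1_comp R (horner soninV) (fun t => Num.sqrt (1 - t)) t _ _ (is_derive_poly soninV x) Dx).
have Dp := is_derive1_powR a t0.
have D2 := @is_deriveM R _ _ _ t 1 _ _ Dx DV.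
have D3 := @is_deriveZ R _ _ _ 2 t 1 _ D2.
have D4 := @is_deriveM R _ _ _ t 1 _ _ Dp D3.
have -> : soninW a = (fun x => x `^ a) * (2 \*: ((fun t : R => Num.sqrt (1 - t)) * (fun t : R => soninV.[Num.sqrt (1 - t)]))).
  by apply/funext => z; rewrite /soninW /= -mulrA.
apply: is_derive_eq.
rewrite -/x /GRing.scale /=.
have -> : t `^ (a - 1) = t `^ a / t.
  rewrite powRB ?powRr1 ?ltW//; apply/implyP => _; by rewrite gt_eqF.
rewrite !fctE /= -/x /GRing.scale /=.
by field; rewrite !gt_eqF.
Qed.

Lemma soninW_le (a t : R) : 1 <= N * Num.sqrt t -> 0 < t < 1 ->
  `|soninW a t| <= 34 / N ^+ 2 * t `^ a.
Proof.
move=> Nt /andP[t0 t1]; have [M0 N0 NM ode g1] := geq.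
have xs : Num.sqrt (1 - t) ^+ 2 + Num.sqrt t ^+ 2 = 1.
  by rewrite !sqr_sqrtr ?subrK// ?subr_ge0 ltW.
have := soninV_le (sqrtr_ge0 _) (sqrtr_ge0 _) xs Nt.
rewrite /soninW normrM (ger0_norm (powR_ge0 _ _)) => h; rewrite [leLHS]mulrC.
apply: ler_wpM2r; first exact: powR_ge0.
rewrite 2!normrM (ger0_norm (sqrtr_ge0 _)) ger0_norm//.
have x1 : Num.sqrt (1 - t) <= 1.
  by rewrite -[leRHS]sqrtr1 ler_wsqrtr// gerBl ltW.
have x0 := sqrtr_ge0 (1 - t).
have -> : 34 / N ^+ 2 = 2 * 1 * (17 / N ^+ 2) by ring.
by rewrite ler_pM// ?mulr_ge0// ler_pM2l.
Qed.

(** N sqrt t must exceed this for the lower-order terms of the derivative of W to be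
    absorbed by half of the energy term; 34 comes from |V| <= 17/N^2 with x >= 1/2,
    and 32 from the lower bound on the energy. *)
Definition oscA (a : R) : R := 34 * 32 * (`|a| + 1).

(** A pointwise lower bound on t^(a+1) g^2 by the positive function
    t^(a-1/2)/(64 N^3), up to an exact derivative; after integration over an
    interval only the boundary values of W, bounded by [soninW_le], are left. *)
Lemma oscillation_ge (a t : R) : let x := Num.sqrt (1 - t) in
  oscA a <= N * Num.sqrt t -> 0 < t <= 2^-1 ->
  t `^ (a - 2^-1) / (32 * N) - t `^ a * (2 * a / t * x * soninV.[x]
     - soninV.[x] / x - soninV^`().[x]) <= 2 * N ^+ 2 * (t `^ (a + 1) * g.[x] ^+ 2).
Proof.
move=> x At /andP[t0 t1]; have [M0 N0 NM ode g1] := geq.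
pose s := Num.sqrt t; rewrite -/s in At.
have A1 : 1 <= oscA a by rewrite /oscA; have := normr_ge0 a; lra.
have s0 : 0 < s by rewrite sqrtr_gt0.
have tE : t = s ^+ 2 by rewrite sqr_sqrtr// ltW.
have xE : x ^+ 2 = 1 - t by rewrite sqr_sqrtr// subr_ge0; lra.
have xs : x ^+ 2 + s ^+ 2 = 1 by rewrite xE tE subrK.
have x0 : 0 <= x by rewrite sqrtr_ge0.
have xh : 2^-1 <= x by rewrite -(@ler_pXn2r _ 2) ?nnegrE// xE; lra.
have x1 : x <= 1 by rewrite -(@ler_pXn2r _ 2) ?nnegrE// xE; lra.
have s1 : s <= 1 by rewrite -(@ler_pXn2r _ 2) ?nnegrE// ?ltW// -tE; lra.
have Ns : 1 <= N * s by apply: le_trans At.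
have hV := soninV_le x0 (ltW s0) xs Ns.
have /andP[hF _] := sonin_energy_bounds geq x0 (ltW s0) xs Ns.
have hD := soninV_deriv x.
have -> : t `^ (a - 2^-1) = t `^ a / s.
  rewrite powRB; last by apply/implyP => _; rewrite gt_eqF.
  by rewrite powR12_sqrt// ltW.
have -> : t `^ (a + 1) = t `^ a * t.
  rewrite powRD ?powRr1 ?ltW//; apply/implyP => _; by rewrite gt_eqF.
have y0 : 0 < t `^ a by rewrite powR_gt0.
set y := t `^ a; rewrite -/y in y0.
have -> : y / s / (32 * N) = y * (32 * (N * s))^-1.
  by field; rewrite !gt_eqF.
rewrite -mulrBr (_ : 2 * N ^+ 2 * (y * t * g.[x] ^+ 2) = y * (2 * N ^+ 2 * t * g.[x] ^+ 2)); last by ring.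
rewrite ler_pM2l//.
have g2 := sqr_ge0 g.[x].
have hD' : soninPsi.[x] + soninV^`().[x] <= 2 * N ^+ 2 * t * g.[x] ^+ 2.
  rewrite -hD xE; lra.
have hPsi : (16 * (N * s))^-1 <= soninPsi.[x].
  by rewrite invfM ler_pdivrMr ?mulr_gt0//; lra.
have hV1 : `|2 * a / t * x * soninV.[x]| + `|soninV.[x] / x| <= (32 * (N * s))^-1.
  have Ns0 : 0 < N * s by rewrite mulr_gt0.
  have e1 : `|2 * a / t * x * soninV.[x]| <= 34 * `|a| / (N * s) ^+ 2.
    rewrite !normrM normfV (ger0_norm x0) (gtr0_norm t0) gtr0_norm//.
    apply: (@le_trans _ _ (2 * `|a| / t * 1 * (17 / N ^+ 2))).
      apply: ler_pM => //; first by rewrite !mulr_ge0// invr_ge0 ltW.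
      by rewrite ler_wpM2l// mulr_ge0// invr_ge0 ltW.
    rewrite le_eqVlt; apply/orP; left; apply/eqP; rewrite tE; field.
    by rewrite !gt_eqF.
  have e2 : `|soninV.[x] / x| <= 34 / (N * s) ^+ 2.
    rewrite normrM normfV (ger0_norm x0).
    apply: (@le_trans _ _ (17 / N ^+ 2 * 2)).
      apply: ler_pM => //; first by rewrite invr_ge0.
      by rewrite -[2]invrK lef_pV2 ?posrE// (lt_le_trans _ xh).
    have -> : 17 / N ^+ 2 * 2 = 34 / (N * s) ^+ 2 * s ^+ 2.
      by field; rewrite !gt_eqF.
    by rewrite ler_piMr ?divr_ge0 ?sqr_ge0// expr_le1// ltW.
  apply: (le_trans (lerD e1 e2)).
  have -> : 34 * `|a| / (N * s) ^+ 2 + 34 / (N * s) ^+ 2 =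
      34 * (`|a| + 1) / (N * s) * (N * s)^-1 by field; rewrite !gt_eqF.
  have -> : (32 * (N * s))^-1 = 32^-1 * (N * s)^-1 by exact: invfM.
  rewrite ler_wpM2r ?invr_ge0 ?(ltW Ns0)// ler_pdivrMr//.
  rewrite /oscA in At; lra.
have := ler_norm (2 * a / t * x * soninV.[x]).
have := ler_norm (- (2 * a / t * x * soninV.[x])).
have := ler_norm (soninV.[x] / x).
have := ler_norm (- (soninV.[x] / x)).
rewrite !normrN.
have E16 : (16 * (N * s))^-1 = 2 * (32 * (N * s))^-1.
  by field; rewrite !gt_eqF.
rewrite E16 in hPsi.
lra.
Qed.
End oscillation.

(** * Residual polynomials of the two methods *)

Section residuals.
Context {R : realType}.

(** Along a coordinate direction the quadratic is a polynomial of degree two in the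
    increment; its linear coefficient is the directional derivative. *)
Lemma gradient_quadratic n (Q : 'M[R]_n) (xs x : 'cV[R]_n) : Q^T = Q ->
  gradient (quadratic Q xs) x = Q *m (x - xs).
Proof.
move=> QT; apply/colP => i; rewrite mxE.
set v : 'cV[R]_n := delta_mx i 0.
set e := x - xs.
pose b : R := (v^T *m Q *m e) 0 0.
pose c : R := 2^-1 * (v^T *m Q *m v) 0 0.
have bE : b = (Q *m e) i 0.
  rewrite /b -mulmxA mxE (bigD1 i)//= big1 ?addr0; last first.
    by move=> j ji; rewrite !mxE eqxx andbT (negbTE ji) mul0r.
  by rewrite !mxE !eqxx mul1r.
have sym : (e^T *m Q *m v) 0 0 = b.
  have -> : e^T *m Q *m v = (v^T *m Q *m e)^T.
    by rewrite !trmx_mul trmxK QT mulmxA.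
  by rewrite mxE.
have fE h : quadratic Q xs (h *: v + x) - quadratic Q xs x = h * b + h ^+ 2 * c.
  have -> : quadratic Q xs (h *: v + x) =
     2^-1 * ((h *: v + e)^T *m Q *m (h *: v + e)) 0 0 by rewrite /e addrA.
  have -> : quadratic Q xs x = 2^-1 * (e^T *m Q *m e) 0 0 by [].
  have -> : (h *: v + e)^T *m Q *m (h *: v + e) = h ^+ 2 *: (v^T *m Q *m v) +
     h *: (v^T *m Q *m e) + h *: (e^T *m Q *m v) + e^T *m Q *m e.
    move: (e) => e1.
    have -> : (h *: v + e1)^T = h *: v^T + e1^T by rewrite linearP.
    rewrite !mulmxDl !mulmxDr -!scalemxAl -!scalemxAr.
    by rewrite scalerA -expr2 !addrA.
  have E4 (A B C D : 'M[R]_1) : (h ^+ 2 *: A + h *: B + h *: C + D) 0 0 =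
      h ^+ 2 * A 0 0 + h * B 0 0 + h * C 0 0 + D 0 0 by rewrite !mxE.
  by rewrite E4 -/b sym /c; field.
rewrite -bE /derive.
apply/cvg_lim => //.
have : (fun h : R => b + h * c) @ 0^' --> b.
  rewrite -[in X in _ --> X](addr0 b) -[in X in _ --> X](mul0r c).
  apply: cvg_within_filter.
  apply: cvgD; first exact: cvg_cst.
  apply: cvgM; [exact: cvg_id|exact: cvg_cst].
apply: cvg_trans; apply: near_eq_cvg.
near=> h.
have h0 : h != 0 by near: h; exact: nbhs_dnbhs_neq.
by rewrite /= fE /GRing.scale /=; field.
Unshelve. all: by end_near.
Qed.

Definition step_poly (eta : R) : {poly R} := 1 - eta%:P * 'X.

Fixpoint fgm_residual (eta : R) (k : nat) : {poly R} * {poly R} :=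
  if k is k'.+1 then
    let: (p, q) := fgm_residual eta k' in
    let p' := step_poly eta * q in
    (p', p' + (k'%:R / (k' + 3)%N%:R)%:P * (p' - p))
  else (1, 1).

Definition residual (m : method) (eta : R) (k : nat) : {poly R} :=
  match m with GD => step_poly eta ^+ k | FGM => (fgm_residual eta k).1 end.

Lemma horner_mx_step n (Q : 'M[R]_n.+1) eta :
  horner_mx Q (step_poly eta) = 1%:M - eta *: Q.
Proof.
by rewrite rmorphB rmorphM rmorph1 /= horner_mx_C horner_mx_X -mulmxE mul_scalar_mx.
Qed.

Lemma residualP m eta : residual_polynomials m eta (residual m eta).
Proof.
move=> n Q xs x0 [QT _] K.
have step x e : x - xs = e ->
    x - eta *: gradient (quadratic Q xs) x - xs = horner_mx Q (step_poly eta) *m e.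
  move=> <-; rewrite gradient_quadratic// horner_mx_step mulmxBl mul1mx.
  by rewrite -scalemxAl addrAC.
case: m => /=.
  elim: K => [|K IH] /=; first by rewrite expr0 rmorph1 mul1mx.
  by rewrite (step _ _ IH) exprS rmorphM /= -mulmxE mulmxA.
have [] : (fgm (quadratic Q xs) eta x0 K).1 - xs
     = horner_mx Q (fgm_residual eta K).1 *m (x0 - xs) /\
   (fgm (quadratic Q xs) eta x0 K).2 - xs
     = horner_mx Q (fgm_residual eta K).2 *m (x0 - xs) => //.
elim: K => [|K [IH1 IH2]] /=; first by rewrite rmorph1 mul1mx.
case: (fgm _ _ _ K) (fgm_residual eta K) IH1 IH2 => [x y] [p q] /= IH1 IH2.
have E : y - eta *: gradient (quadratic Q xs) y - xs =
    horner_mx Q (step_poly eta * q) *m (x0 - xs).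
  by rewrite (step _ _ IH2) rmorphM /= -mulmxE mulmxA.
split=> //; move: (y - _) (step_poly eta * q) E => x' p' E.
rewrite (rmorphD (horner_mx Q)) /= mulmxDl -E (rmorphM (horner_mx Q)) /= -mulmxE horner_mx_C mul_scalar_mx.
rewrite (rmorphB (horner_mx Q)) /= -scalemxAl mulmxBl -E -IH1 addrAC; congr (_ + _ *: _).
by rewrite opprB addrA subrK.
Qed.

(** A nonnegative real l is a 1 x 1 positive semidefinite matrix, and the methods run
    on it determine the value at l. *)
Lemma residual_polynomials_horner m eta rho K (l : R) :
  residual_polynomials m eta rho -> 0 <= l -> (rho K).[l] = (residual m eta K).[l].
Proof.
move=> rhoP l0.
pose Q : 'M[R]_1 := l%:M.
have psd : symmetric_psd Q.
  split; first by rewrite tr_scalar_mx.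
  move=> v; rewrite mul_mx_scalar -scalemxAl mxE mulr_ge0// mxE sumr_ge0//.
  by move=> i _; rewrite mxE -expr2 sqr_ge0.
have horner1 (p : {poly R}) : (horner_mx Q p *m (1 - 0 : 'cV[R]_1)) 0 0 = p.[l].
  rewrite subr0 mulmx1 /Q.
  have -> : l%:M = diag_mx (const_mx l) :> 'M[R]_1 by rewrite diag_const_mx.
  by rewrite horner_mx_diag !mxE eqxx mulr1n.
by rewrite -!horner1 -(rhoP _ _ _ _ psd) -(residualP _ _ _ _ psd).
Qed.

(** Eliminating the extrapolated iterate, the FGM residuals satisfy
    (k+3) rho_(k+2) = x^2 ((2k+3) rho_(k+1) - k rho_k), which becomes the Gegenbauer
    recurrence after division by x^(k+3). *)
Lemma fgm_residual_gegenbauer eta K (l x : R) : x ^+ 2 = 1 - eta * l ->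
  (residual FGM eta K.+1).[l] = x ^+ K.+2 * (gegenbauer K).[x].
Proof.
move=> xE.
have qE : (step_poly eta).[l] = x ^+ 2 by rewrite /step_poly !hornerE xE.
have S1 k : (fgm_residual eta k.+1).1 = step_poly eta * (fgm_residual eta k).2.
  by rewrite /=; case: fgm_residual.
have S2 k : (fgm_residual eta k.+1).2 = (fgm_residual eta k.+1).1 +
   (k%:R / (k + 3)%N%:R)%:P * ((fgm_residual eta k.+1).1 - (fgm_residual eta k).1).
  by rewrite /=; case: fgm_residual.
move: (step_poly eta) qE S1 => sp qE S1.
have [] : (residual FGM eta K.+1).[l] = x ^+ K.+2 * (gegenbauer K).[x] /\
  (residual FGM eta K.+2).[l] = x ^+ K.+3 * (gegenbauer K.+1).[x] => //.
rewrite /residual.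
elim: K => [|K [IH1 IH2]].
  by rewrite !S1 !S2 S1 /= !hornerE qE; split; ring.
split=> //; rewrite S1 S2 hornerM hornerD hornerM hornerC hornerD hornerN IH1 IH2 qE.
have := congr1 (horner^~ x) (gegenbauerS (R := R) K).
move: (gegenbauer K) (gegenbauer K.+1) (gegenbauer K.+2) => c0 c1 c2.
rewrite !(hornerM, hornerD, hornerN, horner_natr, hornerX) => h.
have n0 : (K + 4)%:R != 0 :> R by rewrite pnatr_eq0 addn_eq0 andbF.
rewrite (_ : (K.+1 + 3) = K + 4)%N; last by rewrite addSnnS.
apply: (mulfI n0).
have -> : (K + 4)%:R * (x ^+ K.+4 * c2.[x]) = x ^+ K.+4 * ((K + 4)%:R * c2.[x]) by ring.
rewrite h !exprS (natrD _ (2 * K) 5) natrM natrD -!natr1; field.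
by move: n0; rewrite natrD.
Qed.

End residuals.

(** * Trace of a polynomial in a symmetric matrix *)

Section trace_horner.

Lemma char_poly_similar (F : fieldType) n (P D : 'M[F]_n) : P \in unitmx ->
  char_poly (invmx P *m D *m P) = char_poly D.
Proof.
move=> Pu; have PuX : map_mx polyC P \in unitmx.
  by rewrite map_unitmx.
rewrite /char_poly /char_poly_mx.
have -> : 'X%:M - map_mx polyC (invmx P *m D *m P) =
   invmx (map_mx polyC P) *m ('X%:M - map_mx polyC D) *m map_mx polyC P.
  rewrite !map_mxM /= map_invmx mulmxBr mulmxBl; congr (_ - _).
  by rewrite -mulmxA -scalar_mxC mulmxA mulVmx// mul1mx.
by rewrite !det_mulmx mulrAC -det_mulmx mulVmx// det1 mul1r.
Qed.

(** In a unitary eigenbasis the matrix is diagonal, and its diagonal is a permutation of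
    the roots of the characteristic polynomial. *)
Lemma trace_horner_normal (C : numClosedFieldType) n (A : 'M[C]_n.+1)
    (lam : 'rV[C]_n.+1) (p : {poly C}) : A \is normalmx ->
  char_poly A = \prod_(i < n.+1) ('X - (lam 0 i)%:P) ->
  \tr (horner_mx A p) = \sum_i p.[lam 0 i].
Proof.
move=> /orthomx_spectralP AE cA.
have Pu := spectral_unit A.
move: AE; set P := spectralmx A; set d := spectral_diag A => AE.
have tE : \tr (horner_mx A p) = \sum_i p.[d 0 i].
  rewrite AE horner_mx_uconjC// mxtrace_mulC mulmxA mulmxV// mul1mx.
  rewrite horner_mx_diag /mxtrace; apply: eq_bigr => i _.
  by rewrite !mxE eqxx mulr1n.
rewrite tE.
have : \prod_(i < n.+1) ('X - (d 0 i)%:P) = \prod_(i < n.+1) ('X - (lam 0 i)%:P).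
  rewrite -cA AE char_poly_similar// char_poly_trig ?diag_mx_is_trig//.
  by apply: eq_bigr => i _; rewrite !mxE eqxx mulr1n.
rewrite -(big_map (fun i => d 0 i) xpredT (fun x => 'X - x%:P)).
rewrite -(big_map (fun i => lam 0 i) xpredT (fun x => 'X - x%:P)).
move=> /prod_XsubC_eq pe.
rewrite -(big_map (fun i => d 0 i) xpredT (horner p)).
rewrite -(big_map (fun i => lam 0 i) xpredT (horner p)).
exact: perm_big.
Qed.

Import complex.
Local Open Scope complex_scope.
(** A real symmetric matrix is normal over the complex numbers, where the spectral
    theorem applies. *)
Lemma trace_horner_symmetric (R : rcfType) n (Q : 'M[R]_n.+1) (lam : 'rV[R]_n.+1)
    (p : {poly R}) : Q^T = Q ->
  char_poly Q = \prod_(i < n.+1) ('X - (lam 0 i)%:P) ->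
  \tr (horner_mx Q p) = \sum_i p.[lam 0 i].
Proof.
move=> QT cQ; pose f : {rmorphism R -> R[i]} := real_complex R.
apply: (fmorph_inj f).
rewrite -trace_map_mx map_horner_mx rmorph_sum /=.
rewrite (@trace_horner_normal _ _ _ (map_mx f lam)).
- by apply: eq_bigr => i _; rewrite mxE horner_map.
- apply/normalmxP.
  have -> : (map_mx f Q)^T = map_mx f Q by rewrite -[in RHS]QT map_trmx.
  have -> // : map_mx Num.conj (map_mx f Q) = map_mx f Q.
  by apply/matrixP => i j; rewrite !mxE; exact: conjc_real.
rewrite -map_char_poly cQ rmorph_prod; apply: eq_bigr => i _.
by rewrite rmorphB /= map_polyX map_polyC mxE.
Qed.
End trace_horner.

(** * Positive semidefinite forms *)

Section psd.
Context {R : realType}.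

Lemma trmx_horner_mx n (Q : 'M[R]_n.+1) (p : {poly R}) :
  (horner_mx Q p)^T = horner_mx Q^T p.
Proof.
elim/poly_ind: p => [|p c IH]; first by rewrite !rmorph0 trmx0.
have E (A : 'M[R]_n.+1) : horner_mx A (p * 'X + c%:P) = horner_mx A p *m A + c%:M.
  by rewrite (rmorphD (horner_mx A)) (rmorphM (horner_mx A)) /= horner_mx_X horner_mx_C.
rewrite !E linearD /= trmx_mul IH tr_scalar_mx; congr (_ + _).
by have := comm_mx_horner p (comm_mx_refl Q^T).
Qed.

Definition quad n (M : 'M[R]_n) (e : 'cV[R]_n) : R := (e^T *m M *m e) 0 0.

Lemma quadE n (M : 'M[R]_n) e : quad M e = \sum_i \sum_j e i 0 * e j 0 * M i j.
Proof.
rewrite /quad mxE exchange_big /=; apply: eq_bigr => j _.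
rewrite mxE mulr_suml; apply: eq_bigr => i _.
by rewrite mxE mulrAC.
Qed.

Lemma psd_horner n (Q : 'M[R]_n.+1) (p : {poly R}) : symmetric_psd Q ->
  symmetric_psd (horner_mx Q ('X * p ^+ 2)).
Proof.
move=> [QT Q0].
have E : horner_mx Q ('X * p ^+ 2) = (horner_mx Q p)^T *m Q *m horner_mx Q p.
  rewrite (_ : 'X * p ^+ 2 = p * 'X * p); last by ring.
  by rewrite !(rmorphM (horner_mx Q)) /= horner_mx_X trmx_horner_mx QT.
split; first by rewrite trmx_horner_mx QT.
move=> v; rewrite E.
have -> : v^T *m ((horner_mx Q p)^T *m Q *m horner_mx Q p) *m v =
  (horner_mx Q p *m v)^T *m Q *m (horner_mx Q p *m v).
  by rewrite trmx_mul !mulmxA.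
exact: Q0.
Qed.

Section entries.
Variables (n : nat) (M : 'M[R]_n).
Hypothesis psdM : symmetric_psd M.

Lemma quad_ge0 e : 0 <= quad M e.
Proof. by have [_] := psdM; apply. Qed.

Lemma psd_sym i j : M i j = M j i.
Proof. by have [MT _] := psdM; rewrite -[in LHS]MT mxE. Qed.

Lemma quad_delta2 i j (x y : R) :
  quad M (x *: delta_mx i 0 + y *: delta_mx j 0) =
  x ^+ 2 * M i i + 2 * x * y * M i j + y ^+ 2 * M j j.
Proof.
have D k l : (delta_mx k 0 : 'cV[R]_n)^T *m M *m (delta_mx l 0 : 'cV[R]_n) = (M k l)%:M.
  rewrite trmx_delta -rowE -colE; apply/matrixP => a b.
  by rewrite !mxE !ord1 eqxx mulr1n.
rewrite /quad.
have Dii := D i i; have Dij := D i j; have Dji := D j i; have Djj := D j j.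
move: Dii Dij Dji Djj; move: (delta_mx i 0) (delta_mx j 0) => u v Dii Dij Dji Djj.
have -> : (x *: u + y *: v)^T = x *: u^T + y *: v^T.
  by apply/matrixP => a b; rewrite !mxE.
rewrite !mulmxDl !mulmxDr -!scalemxAl -!scalemxAr Dii Dij Dji Djj !mxE !eqxx !mulr1n (psd_sym j i); ring.
Qed.

Lemma psd_diag_ge0 i : 0 <= M i i.
Proof.
have := quad_ge0 (1 *: delta_mx i 0 + 0 *: delta_mx i 0).
by rewrite quad_delta2; lra.
Qed.

(** The form is nonnegative on the vector -M_ij e_i + M_ii e_j; when M_ii = 0, a
    vector with a large coefficient along e_i shows that M_ij = 0. *)
Lemma psd_minor i j : M i j ^+ 2 <= M i i * M j j.
Proof.
have q x y := quad_ge0 (x *: delta_mx i 0 + y *: delta_mx j 0).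
have Mi := psd_diag_ge0 i; have Mj := psd_diag_ge0 j.
have [Mi0|Mi0] := eqVneq (M i i) 0.
  have -> : M i j = 0.
    apply/eqP; apply: contraT => Mij.
    have := q (- (M j j + 1) / (2 * M i j)) 1.
    rewrite quad_delta2 Mi0 mulr0 add0r expr1n mul1r mulr1.
    rewrite (_ : 2 * _ * M i j = - (M j j + 1)); last by field.
    lra.
  by rewrite expr0n mulr_ge0.
have Mip : 0 < M i i by rewrite lt_neqAle eq_sym Mi0.
have := q (- M i j) (M i i); rewrite quad_delta2.
rewrite (_ : _ + _ = M i i * (M i i * M j j - M i j ^+ 2)); last by ring.
by rewrite pmulr_rge0// subr_ge0.
Qed.

Lemma mxtrace_psd_ge0 : 0 <= \tr M.
Proof. by apply: sumr_ge0 => i _; exact: psd_diag_ge0. Qed.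

Lemma psd_entry_le i j : `|M i j| <= \tr M.
Proof.
rewrite -(@ler_pXn2r _ 2) ?nnegrE ?mxtrace_psd_ge0// real_normK ?num_real//.
apply: (le_trans (psd_minor i j)); rewrite expr2.
have diag_le k : M k k <= \tr M.
  rewrite /mxtrace (bigD1 k)//= lerDl sumr_ge0// => l _; exact: psd_diag_ge0.
by apply: ler_pM => //; exact: psd_diag_ge0.
Qed.

Lemma quad_le_trace e : quad M e <= \tr M * \sum_i e i 0 ^+ 2.
Proof.
rewrite quadE.
apply: (@le_trans _ _ (\sum_i \sum_j (e i 0 ^+ 2 * M j j + e j 0 ^+ 2 * M i i) / 2)).
  apply: ler_sum => i _; apply: ler_sum => j _.
  have h := psd_minor i j.
  have Mi := psd_diag_ge0 i; have Mj := psd_diag_ge0 j.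
  apply: (le_trans (ler_norm _)).
  have ei := sqr_ge0 (e i 0); have ej := sqr_ge0 (e j 0).
  have h0 : 0 <= (e i 0 ^+ 2 * M j j + e j 0 ^+ 2 * M i i) / 2.
    by rewrite divr_ge0// addr_ge0// mulr_ge0.
  rewrite -(@ler_pXn2r _ 2) ?nnegrE// real_normK ?num_real//.
  apply: (@le_trans _ _ ((e i 0 ^+ 2 * e j 0 ^+ 2) * (M i i * M j j))).
    by rewrite !exprMn ler_wpM2l// mulr_ge0.
  rewrite -subr_ge0 (_ : _ - _ = ((e i 0 ^+ 2 * M j j - e j 0 ^+ 2 * M i i) / 2) ^+ 2).
    exact: sqr_ge0.
  by field.
under eq_bigr do rewrite -mulr_suml big_split /= -mulr_sumr -mulr_suml.
rewrite -mulr_suml big_split /= -mulr_suml -mulr_sumr.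
rewrite -/(\tr M) -[X in (_ + X) / 2]mulrC le_eqVlt; apply/orP; left; apply/eqP.
by field.
Qed.
End entries.

(** The residual polynomials commute with Q, so f(x^K) is a quadratic form in the
    initial error with matrix Q rho_K(Q)^2. *)
Lemma suboptimalityE (T : Type) n m L (Q : T -> 'M[R]_n.+1)
    (xs x0 : T -> 'cV[R]_n.+1) K w : symmetric_psd (Q w) ->
  suboptimality m L Q xs x0 K w =
  2^-1 * quad (horner_mx (Q w) ('X * residual m L^-1 K ^+ 2)) (x0 w - xs w).
Proof.
move=> psdQ; have [QT _] := psdQ.
rewrite /suboptimality [X in _ - X](_ : _ = 0); last first.
  by rewrite /quadratic subrr trmx0 !mul0mx mxE mulr0.
rewrite subr0 /quadratic residualP//; congr (_ * _); rewrite /quad.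
set p := residual _ _ _; set e := x0 w - xs w.
rewrite (_ : 'X * p ^+ 2 = p * 'X * p); last by ring.
rewrite !(rmorphM (horner_mx (Q w))) /= horner_mx_X trmx_mul trmx_horner_mx QT.
by rewrite -!mulmxE !mulmxA.
Qed.
End psd.

(** * Pointwise bounds on the residuals *)

Section residual_bounds.
Context {R : realType}.
Variable L : R.
Hypothesis L0 : 0 < L.

Lemma gd_residualE K (l : R) : (residual GD L^-1 K).[l] = (1 - l / L) ^+ K.
Proof. by rewrite /= horner_exp /step_poly !hornerE [L^-1 * l]mulrC. Qed.

Lemma fgm_residual_sqrE k (l : R) : l <= L ->
  (residual FGM L^-1 k.+1).[l] ^+ 2 =
  (1 - l / L) ^+ k.+2 * (gegenbauer k).[Num.sqrt (1 - l / L)] ^+ 2.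
Proof.
move=> lL.
have x2 : Num.sqrt (1 - l / L) ^+ 2 = 1 - l / L.
  by rewrite sqr_sqrtr// subr_ge0 ler_pdivrMr// mul1r.
rewrite (@fgm_residual_gegenbauer _ _ _ _ (Num.sqrt (1 - l / L))); last first.
  by rewrite x2 mulrC.
by rewrite exprMn -exprM mulnC exprM x2.
Qed.

Lemma bernoulli_onem (t : R) K : 0 <= t <= 1 -> 1 - K%:R * t <= (1 - t) ^+ K.
Proof.
move=> /andP[t0 t1]; elim: K => [|K IH]; first by rewrite expr0 mul0r subr0.
rewrite exprS.
apply: (@le_trans _ _ ((1 - t) * (1 - K%:R * t))); last first.
  by rewrite ler_wpM2l// subr_ge0.
rewrite -natr1; have : 0 <= K%:R * t ^+ 2 by rewrite mulr_ge0 ?sqr_ge0.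
lra.
Qed.

Let tP (l : R) : 0 <= l <= L -> 0 <= l / L <= 1.
Proof.
by move=> /andP[l0 lL]; rewrite divr_ge0 ?(ltW L0)//= ler_pdivrMr// mul1r.
Qed.

Let xP (l : R) : 0 <= l <= L -> 0 <= Num.sqrt (1 - l / L) <= 1.
Proof.
move=> /tP /andP[t0 t1]; rewrite sqrtr_ge0 /= -[leRHS]sqrtr1 ler_wsqrtr//.
by rewrite gerBl.
Qed.

Lemma gegenbauer_sqr_le1 k (x : R) : 0 <= x <= 1 -> (gegenbauer k).[x] ^+ 2 <= 1.
Proof.
case: k => [|k]; first by rewrite /= hornerC expr1n.
by move=> x01; apply: (gegenbauer_le1 (gegenbauer_equationP _)).
Qed.

Lemma residual_sqr_le m K (l : R) : 0 <= l <= L ->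
  (residual m L^-1 K).[l] ^+ 2 <= (1 - l / L) ^+ K.
Proof.
move=> lL; have /andP[t0 t1] := tP lL.
have o0 : 0 <= 1 - l / L by rewrite subr_ge0.
have o1 : 1 - l / L <= 1 by rewrite gerBl.
case: m.
  by rewrite gd_residualE -exprM muln2 -addnn exprD ler_piMr ?exprn_ge0// exprn_ile1.
case: K => [|k]; first by rewrite /= hornerC expr1n expr0.
rewrite fgm_residual_sqrE; last by case/andP: lL.
rewrite -[leRHS]mulr1; apply: ler_pM; [exact: exprn_ge0|exact: sqr_ge0| |].
  by rewrite exprS ler_piMl// exprn_ge0.
exact: gegenbauer_sqr_le1 (xP lL).
Qed.

Lemma fgm_residual_decay K (l : R) : (2 <= K)%N -> 0 < l <= L ->
  (residual FGM L^-1 K).[l] ^+ 2 <=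
  68 * K%:R `^ (- 3%:R) * (l / L) `^ (- (3 / 2)) * (1 - l / L) ^+ K.
Proof.
case: K => [//|k]; rewrite ltnS => k0 /andP[l0 lL].
have lL' : 0 <= l <= L by rewrite ltW.
have /andP[t0 t1] := tP lL'.
have tp : 0 < l / L by rewrite divr_gt0.
have o0 : 0 <= 1 - l / L by rewrite subr_ge0.
rewrite fgm_residual_sqrE//.
set x := Num.sqrt (1 - l / L); pose s := Num.sqrt (l / L).
have xs : x ^+ 2 + s ^+ 2 = 1 by rewrite !sqr_sqrtr// subrK.
have h := gegenbauer_decay (gegenbauer_equationP k0) (sqrtr_ge0 _) (sqrtr_ge0 _) xs.
have s0 : 0 < s by rewrite sqrtr_gt0.
have -> : (l / L) `^ (- (3 / 2)) = (s ^+ 3)^-1.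
  rewrite powRN (_ : 3 / 2 = 2^-1 * 3%:R); last by field.
  by rewrite powRrM powR12_sqrt// powR_mulrn// sqrtr_ge0.
rewrite powRN powR_mulrn//.
have K0 : 0 < k.+1%:R :> R by rewrite ltr0n.
have g68 : (gegenbauer k).[x] ^+ 2 <= 68 / k.+1%:R ^+ 3 / s ^+ 3.
  rewrite -mulrA -invfM ler_pdivlMr ?mulr_gt0 ?exprn_gt0//.
  apply: le_trans h; rewrite ler_wpM2l ?sqr_ge0// -exprMn.
  have ks0 : 0 <= k%:R + 3 / 2 :> R by rewrite addr_ge0.
  apply: lerXn2r; [by rewrite nnegrE mulr_ge0// ltW|by rewrite nnegrE mulr_ge0// ltW|].
  by rewrite ler_pM2r// -natr1 lerD2l; lra.
rewrite mulrC; apply: ler_pM; [exact: sqr_ge0|exact: exprn_ge0|by []|].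
by rewrite exprS ler_piMl ?exprn_ge0// gerBl.
Qed.

Lemma gd_residual_ge K (l : R) : (0 < K)%N -> 0 <= l <= L / (4 * K%:R) ->
  1 / 8 <= (residual GD L^-1 K).[l] ^+ 2.
Proof.
move=> K0 /andP[l0 lK].
have K0' : 1 <= K%:R :> R by rewrite ler1n.
have Kt : K%:R * (l / L) <= 4^-1.
  have : l * (4 * K%:R) <= L by rewrite -ler_pdivlMr// mulr_gt0// (lt_le_trans _ K0').
  by move=> h; rewrite mulrA ler_pdivrMr//; lra.
have t0 : 0 <= l / L by rewrite divr_ge0// ltW.
have t1 : l / L <= 1 by apply: le_trans (ler_peMl t0 K0') _; lra.
have t01 : 0 <= l / L <= 1 by rewrite t0.
have := bernoulli_onem K t01; rewrite gd_residualE => h.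
have h2 : 1 / 2 <= (1 - l / L) ^+ K by lra.
have : (1 / 2) ^+ 2 <= ((1 - l / L) ^+ K) ^+ 2.
  by apply: lerXn2r; rewrite ?nnegrE// ?exprn_ge0 ?subr_ge0.
lra.
Qed.

(** When l <= L/(4 K^2) both factors stay near 1: the power by Bernoulli, the
    Gegenbauer polynomial because its slope is at most K^2. *)
Lemma fgm_residual_ge K (l : R) : (2 <= K)%N -> 0 <= l <= L / (4 * K%:R ^+ 2) ->
  1 / 8 <= (residual FGM L^-1 K).[l] ^+ 2.
Proof.
case: K => [//|k]; rewrite ltnS => k0 /andP[l0 lK].
have K2 : 2 <= k.+1%:R :> R by rewrite ler_nat.
set K : R := k.+1%:R in lK K2.
have KK : 4 <= K ^+ 2 by nra.
have Kt : K ^+ 2 * (l / L) <= 4^-1.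
  have : l * (4 * K ^+ 2) <= L by rewrite -ler_pdivlMr// mulr_gt0//; lra.
  by move=> h; rewrite mulrA ler_pdivrMr//; lra.
have t0 : 0 <= l / L by rewrite divr_ge0// ltW.
have t1 : 4 * (l / L) <= 4^-1 by apply: le_trans Kt; rewrite ler_wpM2r.
have t01 : 0 <= l / L <= 1 by rewrite t0 //; lra.
have lL : l <= L by case/andP: t01 => _; rewrite ler_pdivrMr// mul1r.
rewrite fgm_residual_sqrE//.
have h1 := bernoulli_onem k.+2 t01.
have h2 : 1 / 2 <= (1 - l / L) ^+ k.+2.
  apply: le_trans h1.
  have -> : k.+2%:R = K + 1 by rewrite natr1.
  have : (K + 1) * (l / L) <= K ^+ 2 * (l / L) by rewrite ler_wpM2r//; nra.
  lra.
set x := Num.sqrt (1 - l / L).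
have lL' : 0 <= l <= L by rewrite l0.
have /andP[x0 x1] := xP lL'.
have x2 : x ^+ 2 = 1 - l / L by rewrite sqr_sqrtr// subr_ge0; case/andP: t01.
have xh : 2^-1 <= x <= 1.
  by rewrite x1 andbT -(@ler_pXn2r _ 2) ?nnegrE// x2; lra.
have h3 := gegenbauer_ge (gegenbauer_equationP k0) xh.
have h4 : 1 / 2 <= (gegenbauer k).[x].
  apply: le_trans h3.
  have M : (k * (k + 3))%:R <= 2 * K ^+ 2 :> R.
    rewrite natrM natrD; have -> : k%:R = K - 1 by rewrite /K -natr1 addrK.
    nra.
  have : 1 - x <= l / L by nra.
  have : 0 <= (k * (k + 3))%:R :> R by [].
  nra.
have : (1 / 2) ^+ 2 <= (gegenbauer k).[x] ^+ 2.
  by apply: lerXn2r; rewrite ?nnegrE// (le_trans _ h4).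
have := @ler_pM R (1/2) ((1 - l / L) ^+ k.+2) ((1/2)^+2) ((gegenbauer k).[x] ^+ 2).
move=> h5 h6; have := h5 _ _ h2 h6; rewrite sqr_ge0; have -> : 0 <= 1/2 :> R by [].
move=> /(_ isT isT); lra.
Qed.
End residual_bounds.

(** * Integrals compared with primitives *)

Section integral_bounds.
Context {R : realType}.
Notation mu := (@lebesgue_measure R).

Lemma integral_primitive (f : R -> R) (a b : R) : a < b ->
    {within `[a, b], continuous f} ->
  exists F : R -> R, [/\ {within `[a, b], continuous F},
    forall x, a < x < b -> is_derive x 1 F (f x) &
    (\int[mu]_(x in `[a, b]) (f x)%:E = (F b - F a)%:E)%E].
Proof.
move=> ab cf.
have intf : mu.-integrable `[a, b] (EFin \o f).
  by apply: continuous_compact_integrable => //; exact: segment_compact.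
pose F x := (\int[mu]_(t in `[a, x]) f t)%R.
exists F; split.
- exact: parameterized_integral_continuous (ltW ab) intf.
- move=> x /andP[ax xb].
  have fx : {for x, continuous f}.
    have /(continuous_within_itvP _ ab)[+ _ _] := cf.
    by apply; rewrite in_itv/= ax.
  have [dF F'] := continuous_FTC1_closed xb intf ax fx.
  have {}F' : 'D_1 F x = f x by rewrite -derive1E; exact: F'.
  exact: (DeriveDef dF F').
- rewrite /F set_itv1 Rintegral_set1 subr0 /Rintegral fineK//.
  by apply: integrable_fin_num.
Qed.

Lemma integral_ge_primitive (f Phi Phi' : R -> R) (a b : R) : a < b ->
    {within `[a, b], continuous f} ->
    (forall x, a <= x <= b -> is_derive x 1 Phi (Phi' x)) ->
    (forall x, a <= x <= b -> Phi' x <= f x) ->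
  ((Phi b - Phi a)%:E <= \int[mu]_(x in `[a, b]) (f x)%:E)%E.
Proof.
move=> ab cf dPhi le; have [F [cF dF ->]] := integral_primitive ab cf.
rewrite lee_fin.
have [||c cab E] := @MVT_segment R (F \- Phi) (f \- Phi') a b (ltW ab).
- move=> x /[!in_itv]/= /andP[ax xb].
  by apply: is_deriveB; [apply: dF; rewrite ax|apply: dPhi; rewrite !ltW].
- apply: within_continuousB => //.
  apply: derivable_within_continuous => x /[!in_itv]/= xab.
  by have := dPhi x xab => -[].
rewrite /= in E; rewrite in_itv/= in cab.
have : 0 <= (f c - Phi' c) * (b - a).
  by rewrite mulr_ge0 ?subr_ge0 ?le// ltW.
by rewrite -E; lra.
Qed.

Lemma integral_le_primitive (f Phi Phi' : R -> R) (a b : R) : a < b ->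
    {within `[a, b], continuous f} ->
    (forall x, a <= x <= b -> is_derive x 1 Phi (Phi' x)) ->
    (forall x, a <= x <= b -> f x <= Phi' x) ->
  (\int[mu]_(x in `[a, b]) (f x)%:E <= (Phi b - Phi a)%:E)%E.
Proof.
move=> ab cf dPhi le; have [F [cF dF ->]] := integral_primitive ab cf.
rewrite lee_fin.
have [||c cab E] := @MVT_segment R (Phi \- F) (Phi' \- f) a b (ltW ab).
- move=> x /[!in_itv]/= /andP[ax xb].
  by apply: is_deriveB; [apply: dPhi; rewrite !ltW|apply: dF; rewrite ax].
- apply: within_continuousB => //.
  apply: derivable_within_continuous => x /[!in_itv]/= xab.
  by have := dPhi x xab => -[].
rewrite /= in E; rewrite in_itv/= in cab.
have : 0 <= (Phi' c - f c) * (b - a).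
  by rewrite mulr_ge0 ?subr_ge0 ?le// ltW.
by rewrite -E; lra.
Qed.
End integral_bounds.

(** * Integration against a density *)

Section density.
Context d (T : measurableType d) (R : realType).
Variables (mu nu : {measure set T -> \bar R}) (p : T -> R).
Hypotheses (mp : measurable_fun setT p) (p0 : forall x, 0 <= p x).
Local Open Scope ereal_scope.
Hypothesis nuE : forall A, measurable A -> nu A = \int[mu]_(x in A) (p x)%:E.
Import HBNNSimple.

(** Approximate f from below by simple functions: for these the formula is the
    definition of the density, and both sides pass to the limit by monotone
    convergence. *)
Lemma integral_density (f : T -> \bar R) (D : set T) :
    measurable D -> measurable_fun D f -> (forall x, D x -> 0 <= f x) ->
  \int[nu]_(x in D) f x = \int[mu]_(x in D) (f x * (p x)%:E).
Proof.
move=> mD mf f0.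
have mpE : measurable_fun D (EFin \o p).
  by apply: measurable_funTS; exact/measurable_EFinP.
pose h := nnsfun_approx mD mf.
have fE x : D x -> f x = lim ((EFin \o h n) x @[n --> \oo]).
  by move=> Dx; apply/esym/cvg_lim => //; exact: cvg_nnsfun_approx.
have -> : \int[nu]_(x in D) f x =
    lim (\int[nu]_(x in D) (EFin \o h n) x @[n --> \oo]).
  under eq_integral => x /[!inE] /fE -> //.
  apply: monotone_convergence => //.
  - move=> n; apply/measurable_EFinP.
    by apply: (measurable_funS measurableT) => //; exact/measurable_funP.
  - by move=> n x Dx //=; rewrite lee_fin.
  - by move=> x Dx a b ab; rewrite lee_fin; exact/lefP/nd_nnsfun_approx.
have -> : \int[mu]_(x in D) (f x * (p x)%:E) =
    lim (\int[mu]_(x in D) ((EFin \o h n) x * (p x)%:E) @[n --> \oo]).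
  have fpE x : D x -> f x * (p x)%:E =
      lim (((EFin \o h n) x * (p x)%:E) @[n --> \oo]).
    by move=> Dx; apply/esym/cvg_lim => //; apply: cvgeZr => //;
      exact: cvg_nnsfun_approx.
  under eq_integral => x /[!inE] /fpE -> //.
  apply: monotone_convergence => //.
  - move=> n; apply: emeasurable_funM => //.
    by apply: measurable_funTS; exact/measurable_EFinP.
  - by move=> n x Dx /=; rewrite -EFinM lee_fin mulr_ge0.
  - move=> x Dx a b ab /=; rewrite -!EFinM lee_fin ler_wpM2r//.
    exact/lefP/nd_nnsfun_approx.
congr (lim _); congr (_ @ \oo); apply/funext => n.
transitivity (\int[nu]_(x in D)
   (\sum_(y \in range (h n)) (y * \1_(h n @^-1` [set y]) x)%:E)).
  by apply: eq_integral => t tE; rewrite /= fimfunE -fsumEFin.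
have indic m r : measurable_fun D (fun x => (r * \1_(h m @^-1` [set r]) x)%:E).
  by apply: (measurable_comp measurableT) => //; exact: measurable_funM.
rewrite ge0_integral_fsum//; last by move=> m y Ey; exact: nnfun_muleindic_ge0.
transitivity (\int[mu]_(x in D) (\sum_(y \in range (h n))
    (y * \1_(h n @^-1` [set y]) x)%:E * (p x)%:E)); last first.
  under [RHS]eq_integral => x xE.
    rewrite [X in X * _](_ : _ = \sum_(y \in range (h n)) (y * \1_(h n @^-1` [set y]) x)%:E).
      rewrite ge0_mule_fsuml => [|y]; last exact: nnfun_muleindic_ge0.
      over.
    by rewrite /= fsumEFin // -(fimfunE _ x).
  by [].
rewrite ge0_integral_fsum//; last 2 first.
  - by move=> y; apply: emeasurable_funM.
  - by move=> m y Ey; rewrite mule_ge0 ?lee_fin ?p0// -lee_fin nnfun_muleindic_ge0.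
apply: eq_fsbigr => r rhn.
under eq_integral do rewrite EFinM.
rewrite integralZl_indic_nnsfun //.
under [RHS]eq_integral do rewrite EFinM -muleA.
rewrite [RHS]ge0_integralZl//.
- under [X in _ = _ * X]eq_integral do rewrite muleC.
  congr (_ * _).
  rewrite [RHS](eq_integral (((EFin \o p) \_ (h n @^-1` [set r])))); last first.
    by move=> x xE; rewrite epatch_indic.
  by rewrite -integral_mkcondr integral_indic// setIC nuE//; exact: measurableI.
- by apply: emeasurable_funM => //; exact/measurable_EFinP.
- by move=> t Et; rewrite mule_ge0 ?lee_fin ?p0.
- by move: rhn; rewrite inE => -[t _ <-]; rewrite lee_fin.
Qed.

End density.

(** * Integrals of powers *)

Section power_integrals.
Context {R : realType}.
Notation mu := (@lebesgue_measure R).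

Lemma within_continuous_powR (c x y : R) : 0 < x ->
  {within `[x, y], continuous (@powR R ^~ c)}.
Proof.
move=> x0; apply: derivable_within_continuous => z /[!in_itv]/= /andP[xz _].
by apply: derivable_powR; rewrite in_itv/= andbT (lt_le_trans x0).
Qed.

Lemma is_derive_powR_primitive (c x : R) : c + 1 != 0 -> 0 < x ->
  is_derive x 1 (fun z => z `^ (c + 1) / (c + 1)) (x `^ c).
Proof.
move=> c1 x0.
have D := is_derive1_powR (c + 1) x0.
have -> : (fun z : R => z `^ (c + 1) / (c + 1)) =
   (c + 1)^-1 \*: (@powR R ^~ (c + 1)).
  by apply/funext => z; rewrite mulrC.
apply: is_derive_eq.
by rewrite addrK /GRing.scale /= mulrA mulVf ?mul1r.
Qed.

Lemma integral_powR_le (c x y : R) : 0 < x -> x < y -> c + 1 < 0 ->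
  (\int[mu]_(z in `[x, y]) (z `^ c)%:E <= (x `^ (c + 1) / - (c + 1))%:E)%E.
Proof.
move=> x0 xy c1.
apply: (le_trans (@integral_le_primitive R _ (fun z => z `^ (c + 1) / (c + 1)) (@powR R ^~ c) _ _ xy _ _ _)).
- exact: within_continuous_powR.
- move=> z /andP[xz _]; apply: is_derive_powR_primitive; first by rewrite lt_eqF.
  exact: lt_le_trans xz.
- by [].
have h : y `^ (c + 1) / (c + 1) <= 0.
  by rewrite mulr_ge0_le0 ?powR_ge0// invr_le0 ltW.
by rewrite lee_fin invrN mulrN; lra.
Qed.

Lemma integral_powRN1_le (x y : R) : 0 < x -> x < y ->
  (\int[mu]_(z in `[x, y]) (z `^ (-1))%:E <= (ln y - ln x)%:E)%E.
Proof.
move=> x0 xy.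
apply: (@integral_le_primitive R _ _ (@powR R ^~ (-1)) _ _ xy) => //.
  exact: within_continuous_powR.
move=> z /andP[xz _]; have z0 := lt_le_trans x0 xz.
by have := is_derive1_ln z0; rewrite powR_inv1 // ltW.
Qed.

(** Monotone convergence along the intervals [y/(n+2), y], which exhaust ]0, y]. *)
Lemma integral_itv0_le (f : R -> R) (y C : R) : 0 < y ->
  measurable_fun setT f -> (forall x, 0 < x -> 0 <= f x) ->
  (forall x, 0 < x < y -> (\int[mu]_(z in `[x, y]) (f z)%:E <= C%:E)%E) ->
  (\int[mu]_(z in `]0%R, y]) (f z)%:E <= C%:E)%E.
Proof.
move=> y0 mf f0 fC.
pose F (n : nat) : set (measurableTypeR R) := `[y / n.+2%:R, y]%classic.
have mF n : measurable (F n) by exact: measurable_itv.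
have Fpos n x : F n x -> 0 < x.
  rewrite /F /= in_itv/= => /andP[h _]; apply: lt_le_trans h.
  by rewrite divr_gt0.
have -> : `]0, y]%classic = \bigcup_i F i.
  apply/seteqP; split=> x.
    rewrite /= in_itv/= => /andP[x0 xy].
    have [n nE] : exists n : nat, y / x <= n%:R.
      by exists (Num.bound (y / x)); rewrite ltW// archi_boundP// divr_ge0// ltW.
    exists n => //; rewrite /F /= in_itv/= xy andbT ler_pdivrMr//.
    rewrite mulrC -ler_pdivrMr// (le_trans nE)// ler_nat.
    by rewrite (leq_trans (leqnSn _)).
  by move=> [n _ Fn]; rewrite /= in_itv/= (Fpos n)//; move: Fn;
    rewrite /F /= in_itv/= => /andP[].
have ndF : nondecreasing_seq F.
  apply/nondecreasing_seqP => n; apply/subsetPset => x.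
  rewrite /F /= !in_itv/= => /andP[h ->]; rewrite andbT (le_trans _ h)//.
  by rewrite ler_pM2l// lef_pV2 ?posrE// ler_nat.
have mfE n : measurable_fun (F n) (EFin \o f : measurableTypeR R -> \bar R).
  by apply: measurable_funTS; exact/measurable_EFinP.
have := @ge0_nondecreasing_set_cvg_integral _ (measurableTypeR R) R F (EFin \o f) mu
   ndF mF mfE.
have F0 n x : F n x -> (0 <= (EFin \o f) x)%E.
  by move=> /Fpos x0; rewrite lee_fin f0.
move=> /(_ F0) h.
rewrite -(cvg_lim _ h)//; apply: lime_le; first by apply/cvg_ex; eexists; exact: h.
apply: nearW => n; apply: fC.
rewrite divr_gt0//= ltr_pdivrMr// ltr_pMr//.
by rewrite (_ : 1 = 1%:R)// ltr_nat.
Qed.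

Lemma integral_powR0_le (c y : R) : 0 < y -> 0 < c + 1 ->
  (\int[mu]_(z in `]0%R, y]) (z `^ c)%:E <= (y `^ (c + 1) / (c + 1))%:E)%E.
Proof.
move=> y0 c1; apply: (@integral_itv0_le (@powR R ^~ c)) => //.
- by move=> x _; exact: powR_ge0.
move=> x /andP[x0 xy].
apply: (le_trans (@integral_le_primitive R _ (fun z => z `^ (c + 1) / (c + 1)) (@powR R ^~ c) _ _ xy _ _ _)).
- exact: within_continuous_powR.
- move=> z /andP[xz _]; apply: is_derive_powR_primitive; first by rewrite gt_eqF.
  exact: lt_le_trans xz.
- by [].
by rewrite lee_fin lerBlDr lerDl mulr_ge0 ?powR_ge0// invr_ge0 ltW.
Qed.

Lemma integral_powR_ge (c y : R) : 0 < y -> 0 < c + 1 ->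
  ((y `^ (c + 1) * ((1 - 2^-1 `^ (c + 1)) / (c + 1)))%:E
     <= \int[mu]_(z in `[(y / 2)%R, y]) (z `^ c)%:E)%E.
Proof.
move=> y0 c1.
have y20 : 0 < y / 2 by rewrite divr_gt0.
apply: (le_trans _ (@integral_ge_primitive R _ (fun z => z `^ (c + 1) / (c + 1)) (@powR R ^~ c) _ _ _ _ _ _)).
- rewrite lee_fin powRM ?invr_ge0//; last exact: ltW.
  by rewrite mulrA mulrBr mulr1 mulrBl.
- by rewrite ltr_pdivrMr// ltr_pMr// (_ : 1 = 1%:R)// ltr_nat.
- exact: within_continuous_powR.
- move=> z /andP[xz _]; apply: is_derive_powR_primitive; first by rewrite gt_eqF.
  exact: lt_le_trans xz.
- by [].
Qed.

End power_integrals.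

(** * Measures with a power density near zero *)

Lemma ge0_integral_setU_le d (T : measurableType d) (R : realType)
    (mu : {measure set T -> \bar R}) (A B : set T) (f : T -> \bar R) :
    measurable A -> measurable B -> measurable_fun (A `|` B) f ->
    (forall x, (A `|` B) x -> (0 <= f x)%E) ->
  (\int[mu]_(x in A `|` B) f x <= \int[mu]_(x in A) f x + \int[mu]_(x in B) f x)%E.
Proof.
move=> mA mB mf f0.
have E : A `|` B = A `|` (B `\` A) by rewrite setUDr setDv setD0.
rewrite {1}E ge0_integral_setU//; last 4 first.
- exact: measurableD.
- by rewrite -E.
- by rewrite -E.
- by apply/disj_setPS => x [Ax [_ nAx]].
rewrite leeD2l//; apply: ge0_subset_integral => //.
- exact: measurableD.
- by apply: measurable_funS mf; [exact: measurableU|exact: subsetUr].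
- by move=> x Bx; apply: f0; right.
Qed.

Lemma gt0_powRD (R : realType) (x r s : R) : 0 < x -> x `^ (r + s) = x `^ r * x `^ s.
Proof. by move=> x0; apply: powRD; apply/implyP => _; rewrite gt_eqF. Qed.

(** The form in which the equivalent of p at 0 is used everywhere below. *)
Record power_density_near0 (R : realType) (delta c C a : R) (p : R -> R) : Prop := {
  pd_delta : 0 < delta;
  pd_c : 0 < c;
  pd_C : 0 < C;
  pd_le : forall x, 0 < x <= delta -> c * x `^ a <= p x <= C * x `^ a }.

Lemma density_near0 (R : realType) (D a p0 : R) (p : R -> R) : 0 < D -> 0 < p0 ->
  p x / (p0 * x `^ a) @[x --> 0^'+] --> (1 : R) ->
  exists2 delta, delta <= D & power_density_near0 delta (p0 / 2) (2 * p0) a p.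
Proof.
move=> D0 p00 /cvgrPdist_le/(_ 2^-1) []; first by rewrite invr_gt0.
move=> e /= e0 he.
exists (Num.min D (e / 2)); first by rewrite ge_min lexx.
split; [by rewrite lt_min D0 divr_gt0|by rewrite divr_gt0|by rewrite mulr_gt0|].
move=> x /andP[x0]; rewrite le_min => /andP[_ xe].
have xe' : x < e by rewrite (le_lt_trans xe)// ltr_pdivrMr// ltr_pMr// (_ : 1 = 1%:R)// ltr_nat.
have := he x; rewrite /= sub0r normrN gtr0_norm// => /(_ xe' x0).
have y0 : 0 < p0 * x `^ a by rewrite mulr_gt0// powR_gt0.
rewrite ler_norml => /andP[h1 h2].
have h3 : 2^-1 <= p x / (p0 * x `^ a) by lra.
have h4 : p x / (p0 * x `^ a) <= 2 by lra.
move: h3 h4; rewrite ler_pdivlMr// ler_pdivrMr// => h3 h4.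
by apply/andP; split; lra.
Qed.

Section nu_integrals.
Context {R : realType}.
Notation mu := (@lebesgue_measure R).
Variables (nu : probability (measurableTypeR R) R) (p : R -> R).
Variables (L a delta c C : R).
Hypothesis nu_density : has_density nu p.
Hypothesis near0 : power_density_near0 delta c C a p.
Hypothesis deltaL : delta <= L.
Local Notation mfun w := (measurable_fun [set: measurableTypeR R] (w : measurableTypeR R -> R)).

Lemma nu_integral (w : R -> R) (D : set (measurableTypeR R)) :
  mfun w -> measurable D -> (forall x, D x -> 0 <= w x) ->
  (\int[nu]_(x in D) (w x)%:E = \int[mu]_(x in D) (w x * p x)%:E)%E.
Proof.
move=> mw mD w0; have [mp p_ge0 nuE] := nu_density.
rewrite (integral_density mp p_ge0 nuE)//.
by apply: measurable_funTS; exact/measurable_EFinP.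
Qed.

Lemma mfun_powR (b : R) : mfun (@powR R ^~ b).
Proof. exact: (@measurable_powR R b). Qed.

Lemma mfunM (f g : R -> R) : mfun f -> mfun g -> mfun (fun x => f x * g x).
Proof. by move=> mf mg; apply: measurable_funM. Qed.

Lemma nu_integral_piece_le (w : R -> R) (A b I : R) (D : set (measurableTypeR R)) :
  mfun w -> measurable D -> (forall x, D x -> 0 < x <= delta) -> 0 <= A ->
  (forall x, D x -> 0 <= w x <= A * x `^ b) ->
  (\int[mu]_(x in D) (x `^ (a + b))%:E <= I%:E)%E ->
  (\int[nu]_(x in D) (w x)%:E <= (C * (A * I))%:E)%E.
Proof.
move=> mw mD Dd A0 wA DI; have [d0 c0 C0 pd] := near0.
have [mp p_ge0 nuE] := nu_density.
rewrite nu_integral//; last by move=> x /wA /andP[].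
apply: (@le_trans _ _ (\int[mu]_(x in D) ((C * A)%:E * (x `^ (a + b))%:E))%E).
  apply: ge0_le_integral => //.
  - by move=> x Dx; rewrite lee_fin mulr_ge0//; have /andP[] := wA _ Dx.
  - by apply: measurable_funTS; apply/measurable_EFinP; exact: mfunM.
  - apply: measurable_funTS; apply/measurable_EFinP.
    by apply: mfunM => //; exact: mfun_powR.
  - move=> x Dx; have /andP[x0 xd] := Dd _ Dx; have /andP[w0 wle] := wA _ Dx.
    have /andP[_ ple] := pd _ (Dd _ Dx).
    rewrite -EFinM lee_fin gt0_powRD//.
    rewrite (_ : C * A * _ = (A * x `^ b) * (C * x `^ a)); last by ring.
    by rewrite ler_pM.
rewrite ge0_integralZl//; last 3 first.
- by apply: measurable_funTS; apply/measurable_EFinP; exact: mfun_powR.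
- by move=> x _; rewrite lee_fin powR_ge0.
- by rewrite lee_fin mulr_ge0// ltW.
rewrite (_ : C * (A * I) = (C * A) * I); last by ring.
by rewrite [leRHS]EFinM lee_wpmul2l// lee_fin mulr_ge0// ltW.
Qed.

Lemma nu_integral_tail_le (w : R -> R) (E : R) : mfun w -> 0 <= E ->
  (forall x, delta <= x <= L -> 0 <= w x <= E) ->
  (\int[nu]_(x in `[delta, L]) (w x)%:E <= E%:E)%E.
Proof.
move=> mw E0 wE.
have wE' x : `[delta, L]%classic x -> 0 <= w x <= E.
  by rewrite /= in_itv/= => /wE.
apply: (@le_trans _ _ (\int[nu]_(x in `[delta, L]) (cst E%:E) x)%E).
  apply: ge0_le_integral => //.
  - by move=> x /wE' /andP[w0 _]; rewrite lee_fin.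
  - by apply: measurable_funTS; apply/measurable_EFinP.
  - by move=> x /wE' /andP[_]; rewrite lee_fin.
rewrite integral_cst//= -[leRHS]mule1 lee_wpmul2l ?lee_fin//.
exact: probability_le1.
Qed.

(** [0, L] is cut at e, where the bound on w changes from one power to another, and at
    delta, beyond which the density is not controlled and only the total mass 1
    counts.  The point 0 is null. *)
Lemma nu_integral_le (w : R -> R) (A B E b1 b2 I e : R) : mfun w ->
  0 < e < delta -> 0 < a + b1 + 1 -> 0 <= A -> 0 <= B -> 0 <= E ->
  (forall x, 0 <= x <= L -> 0 <= w x) ->
  (forall x, 0 < x <= e -> w x <= A * x `^ b1) ->
  (forall x, e <= x <= delta -> w x <= B * x `^ b2) ->
  (forall x, delta <= x <= L -> w x <= E) ->
  (\int[mu]_(x in `[e, delta]) (x `^ (a + b2))%:E <= I%:E)%E ->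
  (\int[nu]_(x in `[0%R, L]) (w x)%:E <=
     (C * (A * (e `^ (a + b1 + 1) / (a + b1 + 1))) + C * (B * I) + E)%:E)%E.
Proof.
move=> mw /andP[e0 ed] b10 A0 B0 E0 w0 wA wB wE hI.
have dL := deltaL.
have [d0 c0 C0 pd] := near0.
pose D0 : set (measurableTypeR R) := [set 0].
pose D1 : set (measurableTypeR R) := `]0, e]%classic.
pose D2 : set (measurableTypeR R) := `[e, delta]%classic.
pose D3 : set (measurableTypeR R) := `[delta, L]%classic.
have m0 : measurable D0 by exact: measurable_set1.
have m1 : measurable D1 by exact: measurable_itv.
have m2 : measurable D2 by exact: measurable_itv.
have m3 : measurable D3 by exact: measurable_itv.
have -> : `[0, L]%classic = D0 `|` (D1 `|` (D2 `|` D3)).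
  apply/seteqP; rewrite /D0/D1/D2/D3; split => x /=; rewrite !in_itv/=.
    move=> /andP[x0 xL].
    have [->|xn0] := eqVneq x 0; [by left|right].
    have {x0 xn0}x0 : 0 < x by rewrite lt_neqAle eq_sym xn0.
    have [xe|/ltW xe] := leP x e; first by left; rewrite x0.
    right; have [xd|/ltW xd] := leP x delta; first by left; rewrite xe.
    by right; rewrite xd.
  move=> [->|[/andP[h1 h2]|[/andP[h1 h2]|/andP[h1 h2]]]]; apply/andP; split; lra.
have wnn x : (D0 `|` (D1 `|` (D2 `|` D3))) x -> (0 <= (w x)%:E)%E.
  rewrite /D0/D1/D2/D3 /= !in_itv/= lee_fin => h; apply: w0.
  move: h => [->|[/andP[h1 h2]|[/andP[h1 h2]|/andP[h1 h2]]]]; apply/andP; split; lra.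
have mwE D : measurable_fun D (EFin \o w : measurableTypeR R -> \bar R).
  by apply: measurable_funTS; exact/measurable_EFinP.
apply: (le_trans (ge0_integral_setU_le _ _ _ _ _)) => //.
  by do 2 ?apply: measurableU.
have -> : (\int[nu]_(x in D0) (w x)%:E = 0)%E.
  rewrite nu_integral//; first by rewrite integral_set1.
  by move=> x Dx; rewrite -lee_fin wnn//; left.
rewrite add0e.
apply: (le_trans (ge0_integral_setU_le _ _ _ _ _)) => //.
- exact: measurableU.
- by move=> x Dx; apply: wnn; right.
rewrite -[X in (_ <= X%:E)%E]addrA [leRHS]EFinD; apply: leeD.
  apply: (@nu_integral_piece_le _ _ b1) => //.
  - by move=> x; rewrite /D1 /= in_itv/= => /andP[-> h]; rewrite (le_trans h)// ltW.
  - move=> x Dx; apply/andP; split; first by rewrite -lee_fin wnn//; right; left.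
    by apply: wA; move: Dx; rewrite /D1 /= in_itv.
  - by apply: integral_powR0_le.
apply: (le_trans (ge0_integral_setU_le _ _ _ _ _)) => //.
  by move=> x Dx; apply: wnn; right; right.
rewrite [leRHS]EFinD; apply: leeD.
  apply: (@nu_integral_piece_le _ _ b2) => //.
  - move=> x; rewrite /D2 /= in_itv/= => /andP[h ->]; rewrite andbT.
    exact: lt_le_trans h.
  - move=> x Dx; apply/andP; split.
      by rewrite -lee_fin wnn//; right; right; left.
    by apply: wB; move: Dx; rewrite /D2 /= in_itv.
apply: nu_integral_tail_le => // x xd; rewrite wE// andbT.
apply: w0; case/andP: xd => h ->; rewrite andbT (le_trans _ h)//; exact: ltW.
Qed.

Lemma nu_integral_ge (w u : R -> R) (x y : R) : mfun w -> mfun u ->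
  0 < x -> x < y -> y <= delta ->
  (forall z, 0 <= z <= L -> 0 <= w z) ->
  (forall z, x <= z <= y -> 0 <= u z <= z `^ a * w z) ->
  (c%:E * \int[mu]_(z in `[x, y]) (u z)%:E <=
   \int[nu]_(z in `[0%R, L]) (w z)%:E)%E.
Proof.
move=> mw mu_ x0 xy yd w0 uw; have [d0 c0 C0 pd] := near0.
have [mp p_ge0 nuE] := nu_density.
have xyL z : x <= z <= y -> [&& 0 < z, z <= delta & z <= L].
  by move=> /andP[xz zy]; rewrite (lt_le_trans x0 xz) (le_trans zy yd) (le_trans (le_trans zy yd)).
apply: (@le_trans _ _ (\int[nu]_(z in `[x, y]) (w z)%:E)%E); last first.
  apply: ge0_subset_integral => //.
  - by apply: measurable_funTS; apply/measurable_EFinP.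
  - move=> z; rewrite /= !in_itv/= => /xyL /and3P[h _ ->]; rewrite andbT; exact: ltW.
rewrite nu_integral//; last first.
  by move=> z; rewrite /= !in_itv/= => /xyL /and3P[h _ h2]; rewrite w0// h2 andbT ltW.
rewrite -ge0_integralZl//; last 3 first.
- by apply: measurable_funTS; apply/measurable_EFinP.
- by move=> z; rewrite /= !in_itv/= => /uw /andP[]; rewrite lee_fin.
- by rewrite lee_fin ltW.
apply: ge0_le_integral => //.
- move=> z; rewrite /= !in_itv/= => /uw /andP[h _].
  by rewrite -EFinM lee_fin mulr_ge0// ltW.
- by apply: emeasurable_funM => //; apply: measurable_funTS; apply/measurable_EFinP.
- by apply: measurable_funTS; apply/measurable_EFinP; apply: mfunM.
move=> z; rewrite /= !in_itv/= => zxy; have /andP[u0 ule] := uw _ zxy.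
have /and3P[z0 zd zL] := xyL _ zxy.
have /andP[ple _] := pd z (introT andP (conj z0 zd)).
rewrite -EFinM lee_fin.
apply: (@le_trans _ _ (c * (z `^ a * w z))); first by rewrite ler_pM2l.
rewrite mulrA mulrC ler_wpM2l// w0// zL andbT; exact: ltW.
Qed.
End nu_integrals.

(** * Upper rates for families of weights *)

Section exp_decay.
Context {R : realType}.

Lemma powRNnat (x : R) (j : nat) : 0 <= x -> x `^ (- j%:R) = (x ^+ j)^-1.
Proof. by move=> x0; rewrite powRN powR_mulrn. Qed.

(** (1 - t)^K <= exp(-K t), and exp(y) = exp(y/j)^j >= (y/j)^j. *)
Lemma onem_exp_le (j : nat) : (0 < j)%N -> exists2 D : R, 0 < D &
  forall (K : nat) (t : R), (0 < K)%N -> 0 < t <= 1 ->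
    (1 - t) ^+ K <= D * (K%:R `^ (- j%:R) * t `^ (- j%:R)).
Proof.
move=> j0; exists (j%:R ^+ j); first by rewrite exprn_gt0// ltr0n.
move=> K t K0 /andP[t0 t1].
have K0' : 0 < K%:R :> R by rewrite ltr0n.
have j0' : 0 < j%:R :> R by rewrite ltr0n.
rewrite !powRNnat ?ler0n ?(ltW t0)// -invfM -exprMn.
have y0 : 0 < K%:R * t by rewrite mulr_gt0.
apply: (@le_trans _ _ (expR (- (K%:R * t)))).
  rewrite mulrC -mulNr mulrC expRM_natl.
  apply: lerXn2r; rewrite ?nnegrE ?subr_ge0 ?expR_ge0//.
  exact: expR_ge1Dx.
rewrite expRN -[j%:R ^+ j]invrK -invfM lef_pV2 ?posrE; last 2 first.
- exact: expR_gt0.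
- by rewrite mulr_gt0// ?invr_gt0 exprn_gt0.
rewrite mulrC -exprVn -exprMn.
rewrite [in leRHS](_ : K%:R * t = j%:R * (K%:R * t / j%:R)); last by field; rewrite gt_eqF.
rewrite expRM_natl; apply: lerXn2r; rewrite ?nnegrE ?expR_ge0 ?divr_ge0 ?(ltW y0) ?(ltW j0')//.
by have := expR_ge1Dx (K%:R * t / j%:R); lra.
Qed.

Lemma natpow_lt1 (K : nat) (s : R) : (2 <= K)%N -> 0 < s -> K%:R `^ (- s) < 1.
Proof.
move=> K2 s0; rewrite powRN invf_lt1 ?powR_gt0 ?ltr0n ?(leq_trans _ K2)//.
have K1 : 1 < K%:R :> R by rewrite ltr1n.
have := gt0_ltr_powR s0 ler01 (ler0n R K) K1.
by rewrite powR1.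
Qed.
End exp_decay.

Section profiles.
Context {R : realType}.
Notation mu := (@lebesgue_measure R).
Variables (nu : probability (measurableTypeR R) R) (p : R -> R).
Variables (L a delta c C : R).
Hypothesis nu_density : has_density nu p.
Hypothesis near0 : power_density_near0 delta c C a p.
Hypothesis deltaL : delta <= L.
Hypothesis agtN1 : -1 < a.
Local Notation mfun w := (measurable_fun [set: measurableTypeR R] (w : measurableTypeR R -> R)).

(** A family of weights to integrate against nu, indexed by the iteration count. *)
Record profile (w : nat -> R -> R) : Prop := {
  pf_meas : forall K, mfun (w K);
  pf_ge0 : forall K x, 0 <= x <= L -> 0 <= w K x }.

Section two_regimes.
Variables (w : nat -> R -> R) (A kap sig b1 b2 : R).
Hypothesis pf : profile w.
Hypotheses (A0 : 0 <= A) (sig0 : 0 < sig).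
Hypothesis b10 : 0 < a + b1 + 1.
Hypothesis w1 : forall K x, (2 <= K)%N -> 0 < x <= L ->
  w K x <= A * K%:R `^ (- kap) * x `^ b1.
Hypothesis w2 : forall K x, (2 <= K)%N -> 0 < x <= L ->
  w K x <= A * K%:R `^ (- kap - sig * (b1 - b2)) * x `^ b2.

(** The two bounds on w_K agree at x = K^-sig: the first one is used below
    delta K^-sig, the second one above. *)
Lemma two_regimes_le K (I : R) : (2 <= K)%N -> a + b2 + 1 <= 0 ->
  (\int[mu]_(x in `[(delta * K%:R `^ (- sig))%R, delta]) (x `^ (a + b2))%:E <= I%:E)%E ->
  (\int[nu]_(x in `[0%R, L]) (w K x)%:E <=
     ((C * A * delta `^ (a + b1 + 1) / (a + b1 + 1) + A * delta `^ b2)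
        * K%:R `^ (- kap - sig * (a + b1 + 1))
      + C * A * I * K%:R `^ (- kap - sig * (b1 - b2)))%:E)%E.
Proof.
move=> K2 b20 hI.
have aN1 := agtN1; have s0 := sig0; have b10' := b10.
have [d0 c0 C0 pd] := near0.
have K0 : 0 < K%:R :> R by rewrite ltr0n (leq_trans _ K2).
have K1 : 1 <= K%:R :> R by rewrite ler1n (leq_trans _ K2).
pose e := delta * K%:R `^ (- sig).
have e0 : 0 < e by rewrite mulr_gt0// powR_gt0.
have ed : e < delta by rewrite gtr_pMr// natpow_lt1.
have dL := deltaL.
have L0 : 0 < L := lt_le_trans d0 dL.
pose A' := A * K%:R `^ (- kap).
pose B' := A * K%:R `^ (- kap - sig * (b1 - b2)).
have A'0 : 0 <= A' by rewrite mulr_ge0// powR_ge0.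
have B'0 : 0 <= B' by rewrite mulr_ge0// powR_ge0.
have E0 : 0 <= B' * delta `^ b2 by rewrite mulr_ge0// powR_ge0.
have edd : 0 < e < delta by rewrite e0.
have := @nu_integral_le R nu p L a delta c C nu_density near0 deltaL (w K) A' B'
  (B' * delta `^ b2) b1 b2 I e (pf_meas pf K) edd b10 A'0 B'0 E0.
move=> /(_ (pf_ge0 pf K)).
have H1 x : 0 < x <= e -> w K x <= A' * x `^ b1.
  by move=> /andP[x0 xe]; apply: w1 => //; rewrite x0 (le_trans xe)// (le_trans (ltW ed)).
have H2 x : e <= x <= delta -> w K x <= B' * x `^ b2.
  by move=> /andP[ex xd]; apply: w2 => //; rewrite (lt_le_trans e0 ex) (le_trans xd).
have H3 x : delta <= x <= L -> w K x <= B' * delta `^ b2.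
  move=> /andP[dx xL]; have x0 := lt_le_trans d0 dx.
  apply: (@le_trans _ _ (B' * x `^ b2)); first by apply: w2 => //; rewrite x0.
  apply: ler_wpM2l => //.
  rewrite -[b2]opprK !(powRN _ (- b2)) lef_pV2 ?posrE ?powR_gt0//.
  by apply: ge0_ler_powR => //; rewrite ?nnegrE ?(ltW x0) ?(ltW d0)//; lra.
move=> /(_ H1 H2 H3 hI); move/le_trans; apply.
rewrite lee_fin.
set s1 := a + b1 + 1 in b10' *.
have -> : C * (A' * (e `^ s1 / s1)) =
  C * A * delta `^ s1 / s1 * K%:R `^ (- kap - sig * s1).
  rewrite /A' /e powRM ?powR_ge0 ?(ltW d0)// -powRrM (gt0_powRD (- kap))// mulNr.
  by field; rewrite gt_eqF.
have -> : C * (B' * I) = C * A * I * K%:R `^ (- kap - sig * (b1 - b2)).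
  by rewrite /B'; ring.
have : B' * delta `^ b2 <= A * delta `^ b2 * K%:R `^ (- kap - sig * s1).
  rewrite /B' mulrAC ler_wpM2l ?mulr_ge0 ?powR_ge0//.
  apply: ler_powR => //; rewrite lerD2l lerN2 ler_pM2l// /s1; lra.
lra.
Qed.

Lemma two_regimes_power_le : a + b2 + 1 < 0 -> exists2 D : R, 0 < D &
  forall K, (2 <= K)%N -> (\int[nu]_(x in `[0%R, L]) (w K x)%:E <=
    (D * K%:R `^ (- kap - sig * (a + b1 + 1)))%:E)%E.
Proof.
move=> b20.
have aN1 := agtN1; have s0 := sig0; have b10' := b10; have A0' := A0.
have [d0 c0 C0 pd] := near0.
pose D := C * A * delta `^ (a + b1 + 1) / (a + b1 + 1) + A * delta `^ b2 +
  C * A * (delta `^ (a + b2 + 1) / - (a + b2 + 1)).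
have D0 : 0 <= D.
  rewrite !addr_ge0// ?mulr_ge0 ?powR_ge0 ?(ltW C0)// ?invr_ge0 ?(ltW b10)//.
  by rewrite oppr_ge0 ltW.
exists (D + 1); first by rewrite ltr_wpDl.
move=> K K2.
have K0 : 0 < K%:R :> R by rewrite ltr0n (leq_trans _ K2).
have e0 : 0 < delta * K%:R `^ (- sig) by rewrite mulr_gt0// powR_gt0.
have ed : delta * K%:R `^ (- sig) < delta by rewrite gtr_pMr// natpow_lt1.
have hI := integral_powR_le e0 ed b20.
apply: (le_trans (two_regimes_le K2 (ltW b20) hI)).
rewrite lee_fin.
set X := K%:R `^ (- kap - sig * (a + b1 + 1)).
have X0 : 0 <= X by exact: powR_ge0.
have -> : C * A * ((delta * K%:R `^ (- sig)) `^ (a + b2 + 1) / - (a + b2 + 1)) *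
    K%:R `^ (- kap - sig * (b1 - b2)) =
   C * A * (delta `^ (a + b2 + 1) / - (a + b2 + 1)) * X.
  rewrite powRM ?powR_ge0 ?(ltW d0)// -powRrM.
  have -> : X = K%:R `^ (- sig * (a + b2 + 1)) * K%:R `^ (- kap - sig * (b1 - b2)).
    by rewrite -gt0_powRD//; congr (_ `^ _); ring.
  by field; rewrite lt_eqF.
rewrite -mulrDl -/D ler_wpM2r//; lra.
Qed.

(** At the critical exponent the integral over the second regime is that of 1/x from
    delta K^-sig to delta, namely sig ln K. *)
Lemma two_regimes_log_le : a + b2 + 1 = 0 -> exists2 D : R, 0 < D &
  forall K, (2 <= K)%N -> (\int[nu]_(x in `[0%R, L]) (w K x)%:E <=
    (D * (K%:R `^ (- kap - sig * (a + b1 + 1)) * ln K%:R))%:E)%E.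
Proof.
move=> b20.
have aN1 := agtN1; have s0 := sig0; have b10' := b10; have A0' := A0.
have [d0 c0 C0 pd] := near0.
have ln2 : 0 < ln 2%:R :> R by rewrite ln_gt0// ltr1n.
pose D1 := C * A * delta `^ (a + b1 + 1) / (a + b1 + 1) + A * delta `^ b2.
have D10 : 0 <= D1.
  rewrite !addr_ge0// ?mulr_ge0 ?powR_ge0 ?(ltW C0)// invr_ge0; exact: ltW.
exists (D1 / ln 2%:R + C * A * sig + 1).
  have h1 : 0 <= D1 / ln 2%:R by rewrite divr_ge0// ltW.
  have h2 : 0 <= C * A * sig by rewrite !mulr_ge0// ltW.
  lra.
move=> K K2.
have K0 : 0 < K%:R :> R by rewrite ltr0n (leq_trans _ K2).
have e0 : 0 < delta * K%:R `^ (- sig) by rewrite mulr_gt0// powR_gt0.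
have ed : delta * K%:R `^ (- sig) < delta by rewrite gtr_pMr// natpow_lt1.
have hI := integral_powRN1_le e0 ed.
have ab : a + b2 = -1 by lra.
rewrite -ab in hI.
have b20' : a + b2 + 1 <= 0 by rewrite b20.
apply: (le_trans (two_regimes_le K2 b20' hI)).
rewrite lee_fin lnM ?posrE ?powR_gt0// ln_powR -/D1.
have -> : b1 - b2 = a + b1 + 1 by lra.
set X := K%:R `^ (- kap - sig * (a + b1 + 1)).
have X0 : 0 <= X by exact: powR_ge0.
have lnK : ln 2%:R <= ln K%:R :> R by rewrite ler_ln ?posrE// ler_nat.
have h1 : D1 * X <= D1 / ln 2%:R * (X * ln K%:R).
  have -> : D1 * X = D1 / ln 2%:R * (X * ln 2%:R) by field; rewrite gt_eqF.
  by rewrite ler_wpM2l ?divr_ge0 ?(ltW ln2)// ler_wpM2l.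
have h2 : 0 <= X * ln K%:R by rewrite mulr_ge0// (le_trans _ lnK)// ltW.
lra.
Qed.
End two_regimes.

(** The damping factor is at most 1 and at most a multiple of (K x)^-j with j as large as
    desired: two regimes that meet at x = 1/K, the second one integrable at
    infinity. *)
Lemma damped_profile_le (w : nat -> R -> R) (A kap b : R) : profile w -> 0 <= A ->
  0 < a + b + 1 ->
  (forall K x, (2 <= K)%N -> 0 < x <= L ->
     w K x <= A * K%:R `^ (- kap) * x `^ b * (1 - x / L) ^+ K) ->
  exists2 D : R, 0 < D & forall K, (2 <= K)%N ->
    (\int[nu]_(x in `[0%R, L]) (w K x)%:E <=
      (D * K%:R `^ (- kap - (a + b + 1)))%:E)%E.
Proof.
move=> pfw A0 b0 wle; have aN1 := agtN1.
have [d0 c0 C0 pd] := near0.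
have L0 : 0 < L := lt_le_trans d0 deltaL.
pose j := (Num.bound (a + b + 1)).+1.
have jb : a + b + 1 < j%:R.
  by rewrite (lt_le_trans (archi_boundP (ltW b0)))// ler_nat.
have [D1 D10 hD] := @onem_exp_le R j isT.
pose A' := A * (1 + D1 * L `^ j%:R).
have B0 : 0 <= D1 * L `^ j%:R by rewrite mulr_ge0 ?powR_ge0// ltW.
have A'0 : 0 <= A' by rewrite mulr_ge0// addr_ge0.
have [|||D D0 hDD] := @two_regimes_power_le w A' kap 1 b (b - j%:R) pfw A'0 ltr01 b0.
- move=> K x K2 xL; apply: (le_trans (wle K x K2 xL)).
  have /andP[x0 xL'] := xL.
  have XY : 0 <= K%:R `^ (- kap) * x `^ b by rewrite mulr_ge0 ?powR_ge0.
  have Z1 : (1 - x / L) ^+ K <= 1.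
    rewrite exprn_ile1// ?subr_ge0 ?ler_pdivrMr ?mul1r// gerBl.
    by rewrite divr_ge0 ?(ltW x0) ?(ltW L0).
  apply: (@le_trans _ _ (A * K%:R `^ (- kap) * x `^ b)).
    by rewrite ler_piMr// -mulrA mulr_ge0.
  by rewrite -2!mulrA ler_wpM2r// /A' ler_peMr// lerDl.
- move=> K x K2 xL; apply: (le_trans (wle K x K2 xL)).
  have /andP[x0 xL'] := xL.
  have XY : 0 <= A * K%:R `^ (- kap) * x `^ b by rewrite !mulr_ge0 ?powR_ge0.
  have K0 : (0 < K)%N by rewrite (leq_trans _ K2).
  have K0' : 0 < K%:R :> R by rewrite ltr0n.
  have t01 : 0 < x / L <= 1 by rewrite divr_gt0//= ler_pdivrMr ?mul1r.
  apply: (le_trans (ler_wpM2l XY (hD K _ K0 t01))).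
  have -> : (x / L) `^ (- j%:R) = x `^ (- j%:R) * L `^ j%:R.
    by rewrite powRM ?(ltW x0) ?invr_ge0 ?(ltW L0)// -powR_inv1 ?(ltW L0)// -powRrM mulN1r opprK.
  have -> : - kap - 1 * (b - (b - j%:R)) = - kap - j%:R by ring.
  rewrite (gt0_powRD (- kap))// (gt0_powRD b)//.
  have h : 0 <= K%:R `^ (- kap) * x `^ b * K%:R `^ (- j%:R) * x `^ (- j%:R).
    by rewrite !mulr_ge0 ?powR_ge0.
  have : 0 <= A * (K%:R `^ (- kap) * x `^ b * K%:R `^ (- j%:R) * x `^ (- j%:R)).
    by rewrite mulr_ge0.
  rewrite /A'; move: (K%:R `^ (- kap)) (x `^ b) (K%:R `^ (- j%:R)) (x `^ (- j%:R)).
  by move: (L `^ j%:R) => u X Y V W; lra.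
- lra.
exists D => // K K2; apply: (le_trans (hDD K K2)); rewrite mul1r //.
Qed.

End profiles.

(** * The mass of the oscillating weight *)

Section asymptotic_tools.
Context {R : realType}.

Lemma natpow_small (s e : R) : 0 < s -> 0 < e ->
  exists K0 : nat, forall K, (K0 <= K)%N -> K%:R `^ (- s) <= e.
Proof.
move=> s0 e0; pose b := e `^ (- s^-1).
have b0 : 0 < b by exact: powR_gt0.
exists (Num.bound b).+1 => K hK.
have bK : b <= K%:R.
  by rewrite (le_trans (ltW (archi_boundP (ltW b0))))// ler_nat (leq_trans _ hK).
have K0 : 0 < K%:R :> R by rewrite ltr0n (leq_trans _ hK).
rewrite powRN -[e]invrK lef_pV2 ?posrE ?powR_gt0 ?invr_gt0//.
have -> : e^-1 = b `^ s.
  by rewrite /b -powRrM mulNr mulVf ?gt_eqF// powR_inv1// ltW.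
by apply: (ge0_ler_powR (ltW s0)) => //; rewrite nnegrE ltW.
Qed.

Lemma ln_nat_large (c : R) : exists K0 : nat, forall K, (K0 <= K)%N -> c <= ln (K%:R : R).
Proof.
exists (Num.bound (expR c)).+1 => K hK.
have bK : expR c <= K%:R.
  by rewrite (le_trans (ltW (archi_boundP (expR_ge0 c))))// ler_nat (leq_trans _ hK).
rewrite -(expRK c) ler_ln// ?posrE ?expR_gt0//.
by rewrite (lt_le_trans (expR_gt0 c)).
Qed.
End asymptotic_tools.

Section oscillating_mass.
Context {R : realType}.
Notation mu := (@lebesgue_measure R).
Variables (nu : probability (measurableTypeR R) R) (p : R -> R).
Variables (L a delta c C : R).
Hypothesis L0 : 0 < L.
Hypothesis nu_density : has_density nu p.
Hypothesis near0 : power_density_near0 delta c C a p.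
Hypothesis deltaL : delta <= L.

Definition weight (m : method) (K : nat) (l : R) : R :=
  l * (residual m L^-1 K).[l] ^+ 2.

Lemma measurable_weight m K :
  measurable_fun [set: measurableTypeR R] (weight m K : measurableTypeR R -> R).
Proof.
have -> : weight m K = horner ('X * residual m L^-1 K ^+ 2).
  by apply/funext => l; rewrite hornerM hornerX horner_exp.
by apply: continuous_measurable_fun; exact: continuous_horner.
Qed.

Lemma weight_ge0 m K l : 0 <= l -> 0 <= weight m K l.
Proof. by move=> l0; rewrite mulr_ge0 ?sqr_ge0. Qed.

Let A : R := oscA a.
Let beta0 : R := Num.min (1 / 8) (delta / L).

(** Integrate [oscillation_ge] over t between A^2/N^2, where the oscillation sets in, and
    beta0/N, below which the factor (1 - t)^(k+2) stays above 1/2.  S is any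
    primitive of t^(a-1/2): a power, or the logarithm when a = -1/2. *)
Lemma fgm_oscillation_mass (S : R -> R) (k : nat) :
  let N := k%:R + 3 / 2 in let al := A ^+ 2 / N ^+ 2 in let be := beta0 / N in
  (0 < k)%N -> al < be ->
  (forall t : R, 0 < t -> is_derive t 1 S (t `^ (a - 2^-1))) ->
  ((c * (L `^ (a + 2) / (4 * N ^+ 2) *
     ((S be - S al) / (32 * N) - 34 / N ^+ 2 * (be `^ a + al `^ a))))%:E <=
   \int[nu]_(x in `[0%R, L]) (weight FGM k.+1 x)%:E)%E.
Proof.
move=> N al be k0 albe dS.
have L0' := L0; have [d0 c0 C0 pd] := near0.
have geq := gegenbauer_equationP (R := R) k0.
set g : {poly R} := gegenbauer k in geq.
have N0 : 0 < N by case: geq.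
have k1 : 1 <= k%:R :> R by rewrite ler1n.
have A1 : 1 <= A by rewrite /A /oscA; have := normr_ge0 a; lra.
have al0 : 0 < al by rewrite divr_gt0// exprn_gt0// (lt_le_trans _ A1).
have be0 : 0 < be by exact: lt_trans albe.
have b8 : beta0 <= 1 / 8 by rewrite ge_min lexx.
have bd : beta0 <= delta / L by rewrite ge_min lexx orbT.
have be8 : be <= 1 / 8.
  apply: le_trans b8; rewrite ler_pdivrMr// ler_peMr//; last by rewrite /N; lra.
  by rewrite -(@pmulr_lge0 _ N^-1) ?invr_gt0// ltW.
have beN : be * N <= 1 / 8 by rewrite divfK ?gt_eqF.
have xy : L * al < L * be by rewrite ltr_pM2l.
have x0 : 0 < L * al by rewrite mulr_gt0.
have yd : L * be <= delta.
  have beb0 : be <= beta0.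
    rewrite ler_pdivrMr// ler_peMr//; last by rewrite /N; lra.
    by rewrite -(@pmulr_lge0 _ N^-1) ?invr_gt0// ltW.
  by rewrite mulrC -ler_pdivlMr//; apply: le_trans bd.
pose u (l : R) := l `^ a * weight FGM k.+1 l.
have mu_u : measurable_fun [set: measurableTypeR R] (u : measurableTypeR R -> R).
  by apply: measurable_funM; [exact: (@measurable_powR R a)|exact: measurable_weight].
have := @nu_integral_ge R nu p L a delta c C nu_density near0 deltaL (weight FGM k.+1) u
  (L * al) (L * be) (measurable_weight _ _) mu_u x0 xy yd.
have H1 z : 0 <= z <= L -> 0 <= weight FGM k.+1 z.
  by move=> /andP[z0 _]; exact: weight_ge0.
have H2 z : L * al <= z <= L * be -> 0 <= u z <= z `^ a * weight FGM k.+1 z.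
  move=> /andP[zl _]; rewrite lexx andbT mulr_ge0 ?powR_ge0// weight_ge0//.
  exact: le_trans (ltW x0) zl.
move=> /(_ H1 H2); apply: le_trans.
rewrite EFinM; apply: lee_wpmul2l; first by rewrite lee_fin ltW.
pose cst := L `^ (a + 2) / (4 * N ^+ 2).
have cst0 : 0 <= cst by rewrite divr_ge0 ?powR_ge0// mulr_ge0// sqr_ge0.
pose W' (t : R) := t `^ a * (2 * a / t * Num.sqrt (1 - t) * (soninV g).[Num.sqrt (1 - t)]
     - (soninV g).[Num.sqrt (1 - t)] / Num.sqrt (1 - t) - (soninV g)^`().[Num.sqrt (1 - t)]).
pose Phi0 t := (32 * N)^-1 * S t - soninW g a t.
pose Phi l := cst * Phi0 (L^-1 * l).
pose Phi' l := cst * (((32 * N)^-1 * (L^-1 * l) `^ (a - 2^-1) - W' (L^-1 * l)) * L^-1).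
have tP l : L * al <= l <= L * be -> al <= L^-1 * l <= be.
  move=> /andP[h1 h2]; rewrite [L^-1 * l]mulrC ler_pdivlMr// ler_pdivrMr//.
  by rewrite mulrC h1 mulrC.
apply: (@le_trans _ _ (Phi (L * be) - Phi (L * al))%:E).
  rewrite lee_fin /Phi !mulKf ?gt_eqF// -mulrBr ler_wpM2l//.
  have W1 t : al <= t <= be -> `|soninW g a t| <= 34 / N ^+ 2 * t `^ a.
    move=> /andP[alt tbe]; have t0 := lt_le_trans al0 alt.
    apply: (soninW_le geq); last by rewrite t0/=; lra.
    have : A / N <= Num.sqrt t.
      rewrite -(@ler_pXn2r _ 2) ?nnegrE ?sqrtr_ge0 ?divr_ge0 ?(ltW N0)//; last by lra.
      by rewrite sqr_sqrtr ?(ltW t0)// expr_div_n.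
    rewrite ler_pdivrMr// mulrC; exact: le_trans.
  have h1 := ler_norm (soninW g a be).
  have h2 := ler_norm (- soninW g a al); rewrite normrN in h2.
  have h3 := W1 be; rewrite lexx (ltW albe) in h3.
  have h4 := W1 al; rewrite lexx (ltW albe) in h4.
  have {}h3 := h3 isT; have {}h4 := h4 isT.
  rewrite /Phi0; lra.
apply: (@integral_ge_primitive R u Phi Phi' _ _ xy).
- have wE : weight FGM k.+1 = horner ('X * residual FGM L^-1 k.+1 ^+ 2).
    by apply/funext => l; rewrite hornerM hornerX horner_exp.
  rewrite /u wE; apply: derivable_within_continuous => l /[!in_itv]/= /andP[h _].
  apply: derivableM; last by have [] := is_derive_poly ('X * residual FGM L^-1 k.+1 ^+ 2) l.
  by apply: derivable_powR; rewrite in_itv/= andbT (lt_le_trans x0).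
- move=> l lxy; have /andP[alt tbe] := tP l lxy; set t := L^-1 * l in alt tbe.
  have t0 := lt_le_trans al0 alt.
  have t01 : 0 < t < 1 by rewrite t0/=; lra.
  have D1 := dS t t0.
  have D2 := soninW_is_derive g a t01.
  have Dl : is_derive l 1 (fun l : R => L^-1 * l) L^-1.
    have := @is_deriveZ R _ _ id L^-1 l 1 _ (is_derive_id l 1).
    by rewrite /GRing.scale /= mulr1.
  have D3 := @is_deriveB R _ _ _ _ t 1 _ _ (@is_deriveZ R _ _ S (32 * N)^-1 t 1 _ D1) D2.
  have D4 := @is_derive1_comp R Phi0 (fun l => L^-1 * l) l _ _ D3 Dl.
  exact: (@is_deriveZ R _ _ _ cst l 1 _ D4).
- move=> l lxy; have /andP[alt tbe] := tP l lxy; set t := L^-1 * l in alt tbe.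
  have t0 := lt_le_trans al0 alt.
  have l0 : 0 < l by move: lxy => /andP[h _]; exact: lt_le_trans h.
  have th : 0 < t <= 2^-1 by rewrite t0/=; lra.
  have AN : oscA a <= N * Num.sqrt t.
    have : A / N <= Num.sqrt t.
      rewrite -(@ler_pXn2r _ 2) ?nnegrE ?sqrtr_ge0 ?divr_ge0 ?(ltW N0)//; last by lra.
      by rewrite sqr_sqrtr ?(ltW t0)// expr_div_n.
    by rewrite ler_pdivrMr// mulrC.
  have osc := oscillation_ge geq AN th.
  rewrite -[X in _ - X]/(W' t) in osc.
  have lL : l <= L.
    have t1' : t <= 1 by lra.
    by move: t1'; rewrite /t mulrC ler_pdivrMr// mul1r.
  have tE : l / L = t by rewrite mulrC.
  rewrite /u /weight fgm_residual_sqrE// tE.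
  set G := (gegenbauer k).[_] ^+ 2; rewrite -/G in osc.
  have G0 : 0 <= G by exact: sqr_ge0.
  have t1 : 0 <= t <= 1 by rewrite ltW//=; lra.
  have h1 := bernoulli_onem k.+2 t1.
  have h2 : 1 / 2 <= (1 - t) ^+ k.+2.
    apply: le_trans h1.
    have : (k.+2%:R : R) <= 2 * N by rewrite (_ : k.+2%:R = k%:R + 2) -?natrD ?addn2// /N; lra.
    move=> kN; have : k.+2%:R * t <= 2 * N * be by apply: ler_pM => //; exact: ltW.
    lra.
  have lE : l = L * t by rewrite /t mulrA mulfV ?gt_eqF// mul1r.
  have E1 : l `^ a * (l * ((1 - t) ^+ k.+2 * G)) =
      L `^ (a + 1) * (t `^ (a + 1) * G) * (1 - t) ^+ k.+2.
    transitivity ((L * t) `^ a * ((L * t) * ((1 - t) ^+ k.+2 * G))); first by rewrite -lE.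
    rewrite powRM ?(ltW L0) ?(ltW t0)//.
    rewrite !gt0_powRD// !powRr1 ?(ltW L0) ?(ltW t0)//; ring.
  rewrite E1.
  have Lp : 0 < L `^ (a + 1) by exact: powR_gt0.
  have tp : 0 <= t `^ (a + 1) * G by rewrite mulr_ge0 ?powR_ge0.
  apply: (@le_trans _ _ (L `^ (a + 1) * (t `^ (a + 1) * G) * (1 / 2))); last first.
    by rewrite ler_wpM2l// mulr_ge0// ltW.
  have E2 : Phi' l = L `^ (a + 1) / (4 * N ^+ 2) * (t `^ (a - 2^-1) / (32 * N) - W' t).
    rewrite /Phi' -/t /cst (_ : a + 2 = a + 1 + 1); last by ring.
    rewrite (gt0_powRD (a + 1))// powRr1 ?(ltW L0)//.
    by field; rewrite !gt_eqF.
  rewrite E2.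
  have -> : L `^ (a + 1) * (t `^ (a + 1) * G) * (1 / 2) =
    L `^ (a + 1) / (4 * N ^+ 2) * (2 * N ^+ 2 * (t `^ (a + 1) * G)).
    by field; rewrite gt_eqF.
  by rewrite ler_wpM2l// divr_ge0 ?(ltW Lp)// mulr_ge0 ?sqr_ge0.
Qed.
End oscillating_mass.

(** * Upper rates for the two methods *)

Section weight_rates.
Context {R : realType}.
Notation mu := (@lebesgue_measure R).
Variables (nu : probability (measurableTypeR R) R) (p : R -> R).
Variables (L a delta c C : R).
Hypothesis L0 : 0 < L.
Hypothesis nu_density : has_density nu p.
Hypothesis near0 : power_density_near0 delta c C a p.
Hypothesis deltaL : delta <= L.
Hypothesis agtN1 : -1 < a.

Lemma profile_weight m : profile L (weight L m).
Proof.
split=> [K|K x /andP[x0 _]]; first exact: measurable_weight.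
exact: weight_ge0.
Qed.

Lemma profile_weight_sqr m : profile L (fun K x => weight L m K x ^+ 2).
Proof.
split=> [K|K x _]; last exact: sqr_ge0.
by apply: measurable_funX; exact: measurable_weight.
Qed.

Lemma weight_le_damped m K x : 0 <= x <= L -> weight L m K x <= x * (1 - x / L) ^+ K.
Proof.
move=> xL; apply: ler_wpM2l; first by case/andP: xL.
exact: residual_sqr_le.
Qed.

Lemma onem_le1 (x : R) K : 0 <= x <= L -> 0 <= (1 - x / L) ^+ K <= 1.
Proof.
move=> /andP[x0 xL].
have t0 : 0 <= x / L by rewrite divr_ge0// ltW.
have t1 : x / L <= 1 by rewrite ler_pdivrMr// mul1r.
by rewrite exprn_ge0 ?subr_ge0// exprn_ile1 ?subr_ge0// gerBl.
Qed.

Let A : R := 68 * L `^ (3 / 2).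

Lemma fgm_weight_le K x : (2 <= K)%N -> 0 < x <= L ->
  weight L FGM K x <= A * K%:R `^ (- 3%:R) * x `^ (- 2^-1) * (1 - x / L) ^+ K.
Proof.
move=> K2 xL; have /andP[x0 xL'] := xL.
have h := fgm_residual_decay L0 K2 xL.
apply: (le_trans (ler_wpM2l (ltW x0) h)).
have -> : (x / L) `^ (- (3 / 2)) = x `^ (- (3 / 2)) * L `^ (3 / 2).
  rewrite powRM ?(ltW x0) ?invr_ge0 ?(ltW L0)// -(powR_inv1 (ltW L0)) -powRrM.
  by rewrite mulN1r opprK.
have -> : x `^ (- 2^-1) = x * x `^ (- (3 / 2)).
  rewrite (_ : - 2^-1 = 1 + - (3 / 2)); last by field.
  by rewrite gt0_powRD// powRr1// ltW.
rewrite /A le_eqVlt; apply/orP; left; apply/eqP; ring.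
Qed.

Lemma fgm_weight_le1 K x : (2 <= K)%N -> 0 < x <= L ->
  weight L FGM K x <= A * K%:R `^ (- 3%:R) * x `^ (- 2^-1).
Proof.
move=> K2 xL; have /andP[x0 xL'] := xL.
apply: (le_trans (fgm_weight_le K2 xL)).
have xL0 : 0 <= x <= L by rewrite ltW.
have /andP[h0 h1] := onem_le1 K xL0.
by rewrite ler_piMr// !mulr_ge0 ?powR_ge0.
Qed.

(** For FGM the weight is at most l and at most a multiple of K^-3 l^(-1/2); the two
    bounds cross at l = K^-2.  If a < -1/2 the second one is integrable at infinity
    against l^a, if a = -1/2 it is critical, and if a > -1/2 the integral would
    diverge without the damping at l = 1/K. *)
Lemma mean_upper m : exists2 D : R, 0 < D & forall K, (2 <= K)%N ->
  (\int[nu]_(x in `[0%R, L]) (weight L m K x)%:E <= (D * mean_rate m a K)%:E)%E.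
Proof.
have aN1 := agtN1.
have A0 : 0 <= A by rewrite mulr_ge0 ?powR_ge0.
have pf := profile_weight.
case: m.
  have [||D D0 h] := damped_profile_le nu_density near0 deltaL agtN1 (A := 1) (kap := 0) (b := 1) (pf GD) ler01.
  - lra.
  - move=> K x K2 xL; rewrite oppr0 powRr0 !mul1r powRr1; last by case/andP: xL => /ltW.
    by apply: weight_le_damped; case/andP: xL => /ltW ->.
  exists D => // K K2; apply: (le_trans (h K K2)).
  rewrite lee_fin /mean_rate /mean_exponent /mean_log mulr1.
  by rewrite (_ : - 0 - (a + 1 + 1) = - (a + 2)); last by ring.
rewrite /mean_rate /mean_exponent /mean_log.
have h1 K x : (2 <= K)%N -> 0 < x <= L -> weight L FGM K x <=
    (1 + A) * K%:R `^ (- 0) * x `^ 1.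
  move=> K2 xL; have /andP[x0 xL'] := xL.
  rewrite oppr0 powRr0 mulr1 powRr1 ?(ltW x0)//.
  have xL0 : 0 <= x <= L by rewrite ltW.
  apply: (le_trans (weight_le_damped _ _ xL0)).
  have /andP[g0 g1] := onem_le1 K xL0.
  rewrite [leLHS]mulrC ler_wpM2r ?(ltW x0)//; lra.
have h2 K x : (2 <= K)%N -> 0 < x <= L -> weight L FGM K x <=
    (1 + A) * K%:R `^ (- 0 - 2 * (1 - (- 2^-1))) * x `^ (- 2^-1).
  move=> K2 xL; apply: (le_trans (fgm_weight_le1 K2 xL)).
  rewrite (_ : - 0 - 2 * (1 - (- 2^-1)) = - 3%:R); last by field.
  rewrite -2!mulrA; apply: ler_wpM2r; last lra.
  by rewrite mulr_ge0 ?powR_ge0.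
have A10 : 0 <= 1 + A by lra.
have b10 : 0 < a + 1 + 1 by lra.
have [a12|a12|a12] := ltgtP a (- 2^-1).
- have [|D D0 h] := two_regimes_power_le nu_density near0 deltaL agtN1 (pf FGM) A10 (ltr0n R 2) b10 h1 h2.
    lra.
  exists D => // K K2; apply: (le_trans (h K K2)).
  rewrite lee_fin mulr1.
  by rewrite (_ : - 0 - 2 * (a + 1 + 1) = - (2 * (a + 2))); last by ring.
- have [||D D0 h] := damped_profile_le nu_density near0 deltaL agtN1 (A := A) (kap := 3%:R) (b := - 2^-1) (pf FGM) A0.
  - lra.
  - by move=> K x; exact: fgm_weight_le.
  exists D => // K K2; apply: (le_trans (h K K2)).
  rewrite lee_fin mulr1.
  by rewrite (_ : - 3%:R - (a - 2^-1 + 1) = - (a + 7 / 2)); last by field.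
- have [|D D0 h] := two_regimes_log_le nu_density near0 deltaL agtN1 (pf FGM) A10 (ltr0n R 2) b10 h1 h2.
    lra.
  exists D => // K K2; apply: (le_trans (h K K2)).
  rewrite lee_fin.
  by rewrite (_ : - 0 - 2 * (a + 1 + 1) = - (2 * (a + 2))); last by ring.
Qed.

(** As for the mean, with the squares l^2 and K^-6 / l of the two bounds, so that
    the critical exponent is now a = 0. *)
Lemma rms_upper m : exists2 D : R, 0 < D & forall K, (2 <= K)%N ->
  (\int[nu]_(x in `[0%R, L]) (weight L m K x ^+ 2)%:E <=
     (D * rms_rate m a K ^+ 2)%:E)%E.
Proof.
have aN1 := agtN1.
have A0 : 0 <= A by rewrite mulr_ge0 ?powR_ge0.
have pf := profile_weight_sqr.
have sq_le K x (m' : method) : 0 < x <= L ->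
    weight L m' K x ^+ 2 <= x ^+ 2 * (1 - x / L) ^+ K.
  move=> /andP[x0 xL]; have xL0 : 0 <= x <= L by rewrite ltW.
  have /andP[g0 g1] := onem_le1 K xL0.
  have := weight_le_damped m' K xL0 => h.
  apply: (@le_trans _ _ ((x * (1 - x / L) ^+ K) ^+ 2)).
    by apply: lerXn2r; rewrite ?nnegrE ?weight_ge0 ?mulr_ge0 ?(ltW x0).
  rewrite exprMn ler_wpM2l ?sqr_ge0// expr2 ler_piMr//.
case: m.
  have [||D D0 h] := damped_profile_le nu_density near0 deltaL agtN1 (A := 1) (kap := 0) (b := 2%:R) (pf GD) ler01.
  - lra.
  - move=> K x K2 xL; rewrite oppr0 powRr0 !mul1r powR_mulrn; last by case/andP: xL => /ltW.
    exact: sq_le.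
  exists D => // K K2; apply: (le_trans (h K K2)).
  rewrite lee_fin /rms_rate /rms_exponent /rms_log mulr1 -powR_mulrn ?powR_ge0//.
  rewrite -powRrM.
  by rewrite (_ : - 0 - (a + 2 + 1) = - ((a + 3) / 2) * 2%:R); last by field.
rewrite /rms_rate /rms_exponent /rms_log.
have h1 K x : (2 <= K)%N -> 0 < x <= L -> weight L FGM K x ^+ 2 <=
    (1 + A ^+ 2) * K%:R `^ (- 0) * x `^ 2%:R.
  move=> K2 xL; have /andP[x0 xL'] := xL.
  rewrite oppr0 powRr0 mulr1 powR_mulrn ?(ltW x0)//.
  have xL0 : 0 <= x <= L by rewrite ltW.
  apply: (le_trans (sq_le K x FGM xL)).
  have /andP[g0 g1] := onem_le1 K xL0.
  rewrite [leLHS]mulrC ler_wpM2r ?sqr_ge0//; have := sqr_ge0 A; lra.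
have sqK K : (K%:R `^ (- 3%:R)) ^+ 2 = K%:R `^ (- 6%:R) :> R.
  rewrite -powR_mulrn ?powR_ge0// -powRrM; congr (_ `^ _); ring.
have sqx (y : R) : 0 < y -> (y `^ (- 2^-1)) ^+ 2 = y `^ (-1).
  by move=> y0; rewrite -powR_mulrn ?powR_ge0// -powRrM (_ : - 2^-1 * 2%:R = -1)//; field.
have sqd K x : (2 <= K)%N -> 0 < x <= L -> weight L FGM K x ^+ 2 <=
    A ^+ 2 * K%:R `^ (- 6%:R) * x `^ (-1) * (1 - x / L) ^+ K.
  move=> K2 xL; have /andP[x0 xL'] := xL.
  have xL0 : 0 <= x <= L by rewrite ltW.
  have /andP[g0 g1] := onem_le1 K xL0.
  apply: (@le_trans _ _ ((A * K%:R `^ (- 3%:R) * x `^ (- 2^-1) * (1 - x / L) ^+ K) ^+ 2)).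
    apply: lerXn2r; rewrite ?nnegrE ?weight_ge0 ?(ltW x0)//.
      by rewrite !mulr_ge0 ?powR_ge0.
    exact: fgm_weight_le.
  rewrite !exprMn sqK sqx// ler_wpM2l ?mulr_ge0 ?powR_ge0 ?sqr_ge0//.
  by rewrite expr2 ler_piMr.
have h2 K x : (2 <= K)%N -> 0 < x <= L -> weight L FGM K x ^+ 2 <=
    (1 + A ^+ 2) * K%:R `^ (- 0 - 2 * (2%:R - (- 1))) * x `^ (- 1).
  move=> K2 xL; apply: (le_trans (sqd K x K2 xL)).
  rewrite (_ : - 0 - 2 * (2%:R - (- 1)) = - 6%:R); last by ring.
  have xL0 : 0 <= x <= L by case/andP: xL => /ltW ->.
  have /andP[g0 g1] := onem_le1 K xL0.
  apply: (@le_trans _ _ (A ^+ 2 * K%:R `^ (- 6%:R) * x `^ (-1))).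
    by rewrite ler_piMr// !mulr_ge0 ?powR_ge0 ?sqr_ge0.
  rewrite -2!mulrA; apply: ler_wpM2r; last lra.
  by rewrite mulr_ge0 ?powR_ge0.
have A20 := sqr_ge0 A.
have A10 : 0 <= 1 + A ^+ 2 by lra.
have b10 : 0 < a + 2%:R + 1 by lra.
have [a12|a12|a12] := ltgtP a 0.
- have [|D D0 h] := two_regimes_power_le nu_density near0 deltaL agtN1 (pf FGM) A10 (ltr0n R 2) b10 h1 h2.
    lra.
  exists D => // K K2; apply: (le_trans (h K K2)).
  rewrite lee_fin mulr1 -powR_mulrn ?powR_ge0// -powRrM.
  by rewrite (_ : - 0 - 2 * (a + 2%:R + 1) = - (a + 3) * 2%:R); last by ring.
- have [||D D0 h] := damped_profile_le nu_density near0 deltaL agtN1 (A := A ^+ 2) (kap := 6%:R) (b := - 1) (pf FGM) A20.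
  - lra.
  - by move=> K x; exact: sqd.
  exists D => // K K2; apply: (le_trans (h K K2)).
  rewrite lee_fin mulr1 -powR_mulrn ?powR_ge0// -powRrM.
  by rewrite (_ : - 6%:R - (a - 1 + 1) = - (a / 2 + 3) * 2%:R); last by field.
- have [|D D0 h] := two_regimes_log_le nu_density near0 deltaL agtN1 (pf FGM) A10 (ltr0n R 2) b10 h1 h2.
    lra.
  exists D => // K K2; apply: (le_trans (h K K2)).
  rewrite lee_fin exprMn sqr_sqrtr; last by rewrite ln_ge0// ler1n (leq_trans _ K2).
  rewrite -[in leRHS]powR_mulrn ?powR_ge0// -powRrM.
  by rewrite (_ : - 0 - 2 * (a + 2%:R + 1) = - (a + 3) * 2%:R); last by ring.
Qed.
End weight_rates.

(** * Lower rates for the two methods *)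

Section weight_lower.
Context {R : realType}.
Notation mu := (@lebesgue_measure R).
Variables (nu : probability (measurableTypeR R) R) (p : R -> R).
Variables (L a delta c C : R).
Hypothesis L0 : 0 < L.
Hypothesis nu_density : has_density nu p.
Hypothesis near0 : power_density_near0 delta c C a p.
Hypothesis deltaL : delta <= L.
Hypothesis agtN1 : -1 < a.

(** Only the interval [y/2, y] with y of order K^-sig is used, where the weight is at least
    a multiple of x. *)
Lemma linear_profile_ge m (sig y0 : R) : 0 < sig -> 0 < y0 ->
  (forall K x, (2 <= K)%N -> 0 <= x <= y0 * K%:R `^ (- sig) ->
     1 / 8 * x <= weight L m K x) ->
  exists2 D : R, 0 < D & forall K, (2 <= K)%N ->
    ((D * K%:R `^ (- sig * (a + 2)))%:E <=
     \int[nu]_(x in `[0%R, L]) (weight L m K x)%:E)%E.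
Proof.
move=> sig0 y00 wge; have aN1 := agtN1; have [d0 c0 C0 pd] := near0.
have s1 : 0 < a + 1 + 1 by lra.
pose y1 := Num.min y0 delta.
have y10 : 0 < y1 by rewrite lt_min y00.
pose D := c * (1 / 8 * (y1 `^ (a + 1 + 1) * ((1 - 2^-1 `^ (a + 1 + 1)) / (a + 1 + 1)))).
have D0 : 0 < D.
  have : 2^-1 `^ (a + 1 + 1) < 1 :> R.
    rewrite -powR_inv1// -powRrM mulN1r.
    exact: (natpow_lt1 (K := 2)).
  by move=> h; rewrite !mulr_gt0// ?powR_gt0// ?invr_gt0 ?subr_gt0.
exists D => // K K2.
have K0 : 0 < K%:R :> R by rewrite ltr0n (leq_trans _ K2).
have KN := powR_gt0 (- sig) K0.
pose y := y1 * K%:R `^ (- sig).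
have yy : 0 < y by rewrite mulr_gt0.
have yd : y <= delta.
  have h : K%:R `^ (- sig) <= 1 by rewrite ltW// natpow_lt1.
  have : y <= y1 by rewrite ger_pMr.
  by move/le_trans; apply; rewrite ge_min lexx orbT.
have yy0 : y <= y0 * K%:R `^ (- sig) by rewrite ler_pM2r// ge_min lexx.
pose u (z : R) := 1 / 8 * z `^ (a + 1).
have mu_u : measurable_fun [set: measurableTypeR R] (u : measurableTypeR R -> R).
  by apply: measurable_funM => //; exact: (@measurable_powR R (a + 1)).
have x0 : 0 < y / 2 by rewrite divr_gt0.
have xy : y / 2 < y by rewrite ltr_pdivrMr// ltr_pMr// ltr1n.
have := nu_integral_ge nu_density near0 deltaL (measurable_weight L m K) mu_u x0 xy yd.
have H1 z : 0 <= z <= L -> 0 <= weight L m K z.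
  by move=> /andP[z0 _]; exact: weight_ge0.
have H2 z : y / 2 <= z <= y -> 0 <= u z <= z `^ a * weight L m K z.
  move=> /andP[z1 z2]; have z0 := lt_le_trans x0 z1.
  rewrite mulr_ge0 ?powR_ge0//=.
  have -> : u z = z `^ a * (1 / 8 * z) by rewrite /u gt0_powRD// powRr1 ?(ltW z0)//; ring.
  by rewrite ler_wpM2l ?powR_ge0// wge// (ltW z0) (le_trans z2).
move=> /(_ H1 H2); apply: le_trans.
have h := integral_powR_ge yy s1.
have -> : D * K%:R `^ (- sig * (a + 2)) =
   c * (1 / 8 * (y `^ (a + 1 + 1) * ((1 - 2^-1 `^ (a + 1 + 1)) / (a + 1 + 1)))).
  rewrite /D /y powRM ?(ltW y10) ?(ltW KN)// -powRrM.
  by rewrite (_ : a + 1 + 1 = a + 2); [ring|ring].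
rewrite EFinM; apply: lee_wpmul2l; first by rewrite lee_fin ltW.
under eq_integral do rewrite EFinM.
rewrite ge0_integralZl//; last 2 first.
- by apply: measurable_funTS; apply/measurable_EFinP; exact: (@measurable_powR R (a + 1)).
- by move=> z _; rewrite lee_fin powR_ge0.
rewrite EFinM; apply: lee_wpmul2l => //.
Qed.

Let A : R := oscA a.
Let beta0 : R := Num.min (1 / 8) (delta / L).

(** GD and FGM with a < -1/2 get their mass from the region where the residual is still
    of order 1.  For larger a, the mass of FGM comes from the oscillating region: in
    [fgm_oscillation_mass] the difference S(be) - S(al) is of order N^-(a+1/2), or
    ln N when a = -1/2, and dominates the boundary terms for K large. *)
Lemma mean_lower m : exists2 D : R, 0 < D & exists K0, forall K, (K0 <= K)%N ->
  ((D * mean_rate m a K)%:E <= \int[nu]_(x in `[0%R, L]) (weight L m K x)%:E)%E.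
Proof.
have aN1 := agtN1; have [d0 c0 C0 pd] := near0; have L0' := L0.
have L4 : 0 < L / 4 by rewrite divr_gt0.
case: m.
  have [|D D0 h] := @linear_profile_ge GD 1 (L / 4) ltr01 L4.
    move=> K x K2; rewrite powR_inv1// => /andP[x0 xK]; rewrite mulrC ler_wpM2l//.
    apply: gd_residual_ge => //; first exact: leq_trans K2.
    by rewrite x0 invfM mulrA.
  exists D => //; exists 2 => K K2; apply: le_trans (h K K2).
  by rewrite lee_fin /mean_rate mulr1 mulN1r.
rewrite /mean_rate /mean_exponent /mean_log.
have [a12|a12] := ltP a (- 2^-1).
  have [|D D0 h] := @linear_profile_ge FGM 2%:R (L / 4) (ltr0n R 2) L4.
    move=> K x K2; rewrite powRN powR_mulrn// => /andP[x0 xK]; rewrite mulrC ler_wpM2l//.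
    apply: fgm_residual_ge => //.
    by rewrite x0 invfM mulrA.
  exists D => //; exists 2 => K K2; apply: le_trans (h K K2).
  by rewrite lee_fin (ltW a12) lt_eqF// mulr1 mulNr.
have A1 : 1 <= A by rewrite /A /oscA; have := normr_ge0 a; lra.
have Ap : 0 < A by exact: lt_le_trans A1.
have b0 : 0 < beta0 by rewrite lt_min !divr_gt0.
pose N k : R := k%:R + 3 / 2.
have N1 k : (0 < k)%N -> k.+1%:R <= N k <= 2 * k.+1%:R.
  by move=> k0; rewrite /N -natr1; have : 0 <= k%:R :> R by []; move=> ?; apply/andP; split; lra.
have N0 k : 0 < N k by rewrite ltr_wpDl.
have NK k s : (0 < k)%N -> 0 <= s -> N k `^ (- s) <= k.+1%:R `^ (- s).
  move=> k0 s0; rewrite !powRN lef_pV2 ?posrE ?powR_gt0//.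
  have /andP[h _] := N1 k k0.
  by apply: ge0_ler_powR; rewrite ?nnegrE// ltW.
have albe_near : exists K0, forall k, (K0 <= k)%N -> A ^+ 2 / N k ^+ 2 < beta0 / N k.
  exists (Num.bound (A ^+ 2 / beta0)).+1 => k hk.
  rewrite -subr_gt0 (_ : _ - _ = (beta0 * N k - A ^+ 2) / N k ^+ 2); last first.
    by field; rewrite gt_eqF.
  rewrite divr_gt0 ?exprn_gt0// subr_gt0 mulrC -ltr_pdivrMr//.
  have h : A ^+ 2 / beta0 < (Num.bound (A ^+ 2 / beta0))%:R.
    by apply: archi_boundP; rewrite divr_ge0 ?sqr_ge0// ltW.
  apply: (lt_le_trans h); apply: (@le_trans _ _ k%:R); last by rewrite /N lerDl.
  by rewrite ler_nat ltnW.
have [K1 hK1] := albe_near.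
have A20 : 0 < A ^+ 2 by rewrite exprn_gt0// (lt_le_trans _ A1).
have beE k s : (beta0 / N k) `^ s = beta0 `^ s * N k `^ (- s).
  rewrite powRM ?invr_ge0 ?(ltW b0) ?(ltW (N0 k))// -(powR_inv1 (ltW (N0 k))) -powRrM.
  by rewrite mulN1r.
have alE k s : (A ^+ 2 / N k ^+ 2) `^ s = (A ^+ 2) `^ s * N k `^ (- (2 * s)).
  rewrite powRM ?invr_ge0 ?(ltW A20) ?exprn_ge0 ?(ltW (N0 k))//.
  rewrite -(powR_invn 2 (ltW (N0 k))) -powRrM.
  by rewrite mulNr.
have N2E k : (N k ^+ 2)^-1 = N k `^ (- 2%:R).
  by rewrite powR_invn// ltW.
have [a12'|a12'] := eqVneq a (- 2^-1).
  have dS (t : R) : 0 < t -> is_derive t 1 (@ln R) (t `^ (a - 2^-1)).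
    move=> t0; have -> : a - 2^-1 = -1 by rewrite a12'; field.
    by rewrite powR_inv1 ?(ltW t0)//; exact: is_derive1_ln.
  pose M := (`|ln beta0| + `|ln (A ^+ 2)|) / 32 + 34 * beta0 `^ a + 34 * (A ^+ 2) `^ a.
  have [K2 hK2] := ln_nat_large (64 * M).
  exists (c * L `^ (a + 2) / (4 * 8 * 64)).
    by rewrite divr_gt0// mulr_gt0// powR_gt0.
  exists (maxn 2 (maxn K1.+1 K2)) => K; rewrite !geq_max => /andP[K2' /andP[]].
  case: K K2' => [//|k]; rewrite ltnS => k0; rewrite ltnS => kK1 kK2.
  apply: le_trans (fgm_oscillation_mass L0 nu_density near0 deltaL k0 (hK1 _ kK1) dS).
  have ale : a <= - 2^-1 by rewrite a12'.
  rewrite lee_fin -/A -/beta0 -/(N k) ale.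
  have n0 := N0 k; have /andP[n1 n2] := N1 k k0.
  have kp : 1 <= k.+1%:R :> R by rewrite ler1n.
  have lnK := hK2 _ kK2.
  have lnN : ln k.+1%:R <= ln (N k) by rewrite ler_ln ?posrE// (lt_le_trans _ kp).
  have -> : k.+1%:R `^ (- (2 * (a + 2))) = k.+1%:R ^- 3.
    by rewrite (_ : 2 * (a + 2) = 3%:R) ?powR_invn// a12'; field.
  have X0 : ln k.+1%:R / 64 / N k <=
    (ln (beta0 / N k) - ln (A ^+ 2 / N k ^+ 2)) / (32 * N k) -
     34 / N k ^+ 2 * ((beta0 / N k) `^ a + (A ^+ 2 / N k ^+ 2) `^ a).
    rewrite beE alE ln_div ?posrE// ln_div ?posrE ?exprn_gt0//.
    rewrite [ln (N k ^+ 2)]lnXn//.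
    have -> : - a = 2^-1 by rewrite a12' opprK.
    have -> : - (2 * a) = 1 by rewrite a12'; field.
    rewrite powRr1 ?(ltW n0)//.
    have -> : N k ^+ 2 = N k * N k by [].
    rewrite -(@ler_pM2r _ (N k))// divfK ?gt_eqF//.
    have nh : N k `^ 2^-1 <= N k.
      rewrite -[leRHS]powRr1 ?(ltW n0)//; apply: ler_powR; first exact: le_trans n1.
      by rewrite invf_le1// ler1n.
    have h1 := ler_norm (- ln beta0); rewrite normrN in h1.
    have h2 := ler_norm (ln (A ^+ 2)).
    have h3 : beta0 `^ a * (N k `^ 2^-1 / N k) <= beta0 `^ a * 1.
      by rewrite ler_wpM2l ?powR_ge0// ler_pdivrMr// mul1r.
    have -> : ((ln beta0 - ln (N k) - (ln (A ^+ 2) - ln (N k) *+ 2)) / (32 * N k) -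
      34 / (N k * N k) * (beta0 `^ a * N k `^ 2^-1 + (A ^+ 2) `^ a * N k)) * N k =
      (ln beta0 + ln (N k) - ln (A ^+ 2)) / 32 - 34 * (beta0 `^ a * (N k `^ 2^-1 / N k)) -
      34 * (A ^+ 2) `^ a.
      by rewrite mulr2n; field; rewrite gt_eqF.
    move: lnK; rewrite /M; lra.
  have LL : 0 < L `^ (a + 2) by exact: powR_gt0.
  have lnK0 : 0 <= ln k.+1%:R :> R by exact: ln_ge0.
  apply: (@le_trans _ _ (c * (L `^ (a + 2) / (4 * N k ^+ 2) * (ln k.+1%:R / 64 / N k)))); last first.
    by rewrite ler_pM2l// ler_wpM2l// divr_ge0 ?(ltW LL)// mulr_ge0// sqr_ge0.
  have N3 : (8 * k.+1%:R ^+ 3)^-1 <= N k ^- 3.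
    rewrite lef_pV2 ?posrE ?mulr_gt0 ?exprn_gt0 ?(lt_le_trans _ kp)//.
    have -> : 8 * k.+1%:R ^+ 3 = (2 * k.+1%:R) ^+ 3 :> R by ring.
    by apply: lerXn2r; rewrite ?nnegrE ?mulr_ge0 ?(ltW n0)//.
  have -> : c * L `^ (a + 2) / (4 * 8 * 64) * (k.+1%:R ^- 3 * ln k.+1%:R) =
     (c * L `^ (a + 2) * ln k.+1%:R / (4 * 64)) * (8 * k.+1%:R ^+ 3)^-1.
    by field; rewrite gt_eqF// (lt_le_trans _ kp).
  have -> : c * (L `^ (a + 2) / (4 * N k ^+ 2) * (ln k.+1%:R / 64 / N k)) =
     (c * L `^ (a + 2) * ln k.+1%:R / (4 * 64)) * N k ^- 3.
    by field; rewrite gt_eqF.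
  by rewrite ler_wpM2l// divr_ge0// !mulr_ge0// ltW.
have b1 : 0 < a + 2^-1.
  have : - 2^-1 < a by rewrite lt_neqAle eq_sym a12'.
  lra.
pose b := a + 2^-1.
have bn : (a - 2^-1) + 1 != 0 by rewrite gt_eqF//; lra.
have bE : (a - 2^-1) + 1 = b by rewrite /b; field.
have dS (t : R) : 0 < t -> is_derive t 1 (fun z : R => z `^ (a - 2^-1 + 1) / (a - 2^-1 + 1)) (t `^ (a - 2^-1)).
  by move=> t0; exact: is_derive_powR_primitive.
rewrite bE in dS.
pose c1 := beta0 `^ b / (32 * b).
have c10 : 0 < c1 by rewrite divr_gt0 ?powR_gt0 ?mulr_gt0.
pose c2 := (A ^+ 2) `^ b / (32 * b) + 34 * beta0 `^ a + 34 * (A ^+ 2) `^ a.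
have c20 : 0 <= c2.
  by rewrite !addr_ge0 ?mulr_ge0 ?powR_ge0// invr_ge0 mulr_ge0// ltW.
pose e := c1 / (2 * (c2 + 1)).
have e0 : 0 < e by rewrite divr_gt0// mulr_gt0// ltr_wpDl.
have [K2 hK2] := natpow_small b1 e0.
have h20 : 0 < 2^-1 :> R by [].
have [K3 hK3] := natpow_small h20 e0.
exists (c * L `^ (a + 2) * c1 / 8 * 2 `^ (- (a + 7 / 2))).
  by rewrite mulr_gt0 ?powR_gt0// divr_gt0// mulr_gt0// mulr_gt0// powR_gt0.
exists (maxn 2 (maxn K1.+1 (maxn K2 K3))) => K; rewrite !geq_max => /andP[K2' /andP[]].
case: K K2' => [//|k]; rewrite ltnS => k0; rewrite ltnS => kK1 /andP[kK2 kK3].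
apply: le_trans (fgm_oscillation_mass L0 nu_density near0 deltaL k0 (hK1 _ kK1) dS).
have ale : (a <= - 2^-1) = false by apply/negbTE; rewrite -ltNge; lra.
rewrite lee_fin -/A -/beta0 -/(N k) ale mulr1.
have n0 := N0 k; have /andP[n1 n2] := N1 k k0.
have kp : 1 <= k.+1%:R :> R by rewrite ler1n.
have LL : 0 < L `^ (a + 2) by exact: powR_gt0.
have Nb : N k `^ (- b) <= e by apply: le_trans (NK _ _ k0 (ltW b1)) (hK2 _ kK2).
have Nh : N k `^ (- 2^-1) <= e by apply: le_trans (NK _ _ k0 (ltW h20)) (hK3 _ kK3).
have X0 : c1 / 2 * N k `^ (- (1 + b)) <=
    ((beta0 / N k) `^ b / b - (A ^+ 2 / N k ^+ 2) `^ b / b) / (32 * N k) -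
     34 / N k ^+ 2 * ((beta0 / N k) `^ a + (A ^+ 2 / N k ^+ 2) `^ a).
  have Nn : (N k)^-1 = N k `^ (- 1) by rewrite powR_inv1// ltW.
  rewrite !beE !alE.
  have E1 : N k `^ (- (2 * b)) = N k `^ (- b) * N k `^ (- b).
    by rewrite -gt0_powRD//; congr (_ `^ _); ring.
  have E2 : N k `^ (- (1 + b)) = (N k)^-1 * N k `^ (- b).
    by rewrite Nn -gt0_powRD//; congr (_ `^ _); ring.
  have E3 : N k ^- 2 * N k `^ (- a) = (N k)^-1 * N k `^ (- b) * N k `^ (- 2^-1).
    by rewrite Nn N2E -!gt0_powRD//; congr (_ `^ _); rewrite /b; field.
  have E4 : N k ^- 2 * N k `^ (- (2 * a)) = (N k)^-1 * N k `^ (- b) * N k `^ (- b).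
    by rewrite Nn N2E -!gt0_powRD//; congr (_ `^ _); rewrite /b; field.
  set Y := (N k)^-1 * N k `^ (- b) in E2 E3 E4.
  have Y0 : 0 <= Y by rewrite mulr_ge0 ?powR_ge0// invr_ge0 ltW.
  have -> : (beta0 `^ b * N k `^ (- b) / b - (A ^+ 2) `^ b * N k `^ (- (2 * b)) / b) / (32 * N k) -
     34 / N k ^+ 2 * (beta0 `^ a * N k `^ (- a) + (A ^+ 2) `^ a * N k `^ (- (2 * a))) =
     Y * (c1 - (A ^+ 2) `^ b / (32 * b) * N k `^ (- b)) -
     34 * beta0 `^ a * (N k ^- 2 * N k `^ (- a)) - 34 * (A ^+ 2) `^ a * (N k ^- 2 * N k `^ (- (2 * a))).
    rewrite E1 /c1 /Y; move: (beta0 `^ b) (beta0 `^ a) ((A ^+ 2) `^ a) ((A ^+ 2) `^ b)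
      (N k `^ (- b)) (N k `^ (- a)) (N k `^ (- (2 * a))) => x1 x2 x3 x4 x5 x6 x7.
    by field; rewrite !gt_eqF.
  rewrite E2 E3 E4.
  have -> : Y * (c1 - (A ^+ 2) `^ b / (32 * b) * N k `^ (- b)) -
     34 * beta0 `^ a * (Y * N k `^ (- 2^-1)) - 34 * (A ^+ 2) `^ a * (Y * N k `^ (- b)) =
     (c1 - ((A ^+ 2) `^ b / (32 * b) * N k `^ (- b) + 34 * beta0 `^ a * N k `^ (- 2^-1) +
       34 * (A ^+ 2) `^ a * N k `^ (- b))) * Y by ring.
  rewrite ler_wpM2r//.
  have m1 : (A ^+ 2) `^ b / (32 * b) * N k `^ (- b) <= (A ^+ 2) `^ b / (32 * b) * e.
    by rewrite ler_wpM2l// divr_ge0 ?powR_ge0// mulr_ge0// ltW.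
  have m2 : 34 * beta0 `^ a * N k `^ (- 2^-1) <= 34 * beta0 `^ a * e.
    by rewrite ler_wpM2l// mulr_ge0 ?powR_ge0.
  have m3 : 34 * (A ^+ 2) `^ a * N k `^ (- b) <= 34 * (A ^+ 2) `^ a * e.
    by rewrite ler_wpM2l// mulr_ge0 ?powR_ge0.
  have m4 : c2 * e <= c1 / 2.
    rewrite /e mulrA ler_pdivrMr ?mulr_gt0 ?ltr_wpDl//.
    have -> : c1 / 2 * (2 * (c2 + 1)) = c2 * c1 + c1 by field.
    by rewrite lerDl ltW.
  move: m1 m2 m3 m4; rewrite /c2; lra.
apply: (@le_trans _ _ (c * (L `^ (a + 2) / (4 * N k ^+ 2) * (c1 / 2 * N k `^ (- (1 + b)))))); last first.
  by rewrite ler_pM2l// ler_wpM2l// divr_ge0 ?(ltW LL)// mulr_ge0// sqr_ge0.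
have -> : c * (L `^ (a + 2) / (4 * N k ^+ 2) * (c1 / 2 * N k `^ (- (1 + b)))) =
    c * L `^ (a + 2) * c1 / 8 * N k `^ (- (a + 7 / 2)).
  have -> : N k `^ (- (a + 7 / 2)) = N k ^- 2 * N k `^ (- (1 + b)).
    by rewrite N2E -gt0_powRD//; congr (_ `^ _); rewrite /b; field.
  by field; rewrite gt_eqF.
rewrite -[leLHS]mulrA; apply: ler_wpM2l.
  by rewrite divr_ge0// mulr_ge0 ?(ltW c10)// mulr_ge0 ?(ltW LL) ?(ltW c0).
rewrite -powRM// !powRN lef_pV2 ?posrE ?powR_gt0 ?mulr_gt0 ?(lt_le_trans _ kp)//.
have p0 : 0 <= a + 7 / 2 by lra.
by apply: (ge0_ler_powR p0) => //; rewrite nnegrE ?mulr_ge0// ltW.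
Qed.
End weight_lower.

(** * Laws and independence of real random variables *)

Section laws.
Context {d : measure_display} {T : measurableType d} {R : realType} (P : probability T R).

Local Notation rv X := (measurable_fun [set: T] (X : T -> measurableTypeR R)).
Local Notation integ X := (P.-integrable [set: T] (EFin \o X)).
Local Notation E X := (\int[P]_w X w)%R.

(** The law of (U, V) agrees with the product of the laws on rectangles, hence
    everywhere, and Fubini applies. *)
Lemma independent_integral (U V : T -> R) : rv U -> rv V ->
  (forall A B : set (measurableTypeR R), measurable A -> measurable B ->
    P (U @^-1` A `&` V @^-1` B) = (P (U @^-1` A) * P (V @^-1` B))%E) ->
  integ U -> integ V ->
  integ (fun w => U w * V w) /\ E (fun w => U w * V w) = E U * E V.
Proof.
move=> mU mV ind iU iV.
pose U' : {mfun T >-> measurableTypeR R} := HB.pack U (isMeasurableFun.Build _ _ _ _ _ mU).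
pose V' : {mfun T >-> measurableTypeR R} := HB.pack V (isMeasurableFun.Build _ _ _ _ _ mV).
have mW : measurable_fun setT (fun w => (U w, V w) : (measurableTypeR R * measurableTypeR R)%type).
  exact: measurable_fun_pair.
pose W : {mfun T >-> (measurableTypeR R * measurableTypeR R)%type} :=
  HB.pack (fun w => (U w, V w)) (isMeasurableFun.Build _ _ _ _ _ mW).
pose m1 := distribution P U'; pose m2 := distribution P V'; pose m12 := distribution P W.
have m12E X : measurable X -> (m1 \x m2)%E X = m12 X.
  apply: product_measure_unique => A B mA mB.
  exact: ind.
have mf1 : measurable_fun [set: measurableTypeR R * measurableTypeR R]
   (fun z : measurableTypeR R * measurableTypeR R => (z.1 * z.2)%:E).
  by apply/measurable_EFinP; apply: measurable_funM; [exact: measurable_fst|exact: measurable_snd].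
have mabs : measurable_fun [set: measurableTypeR R] (fun x : measurableTypeR R => `|x|%:E).
  by apply/measurable_EFinP; apply: measurableT_comp => //; exact: normr_measurable.
have mid : measurable_fun [set: measurableTypeR R] (fun x : measurableTypeR R => x%:E).
  by apply/measurable_EFinP.
have absfin (Z : T -> R) (Z' : {mfun T >-> measurableTypeR R}) : integ Z -> Z' = Z :> (T -> R) ->
    (\int[distribution P Z']_x `|x|%:E < +oo)%E.
  move=> /integrableP[_ iZ] ZE.
  rewrite ge0_integral_distribution//.
  by move: iZ; congr (_ < _)%E; apply: eq_integral => w _ /=; rewrite ZE.
have idist (Z : T -> R) (Z' : {mfun T >-> measurableTypeR R}) : integ Z -> Z' = Z :> (T -> R) ->
    (\int[distribution P Z']_x x%:E = (E Z)%:E)%E.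
  move=> iZ ZE; rewrite integral_distribution//; last by rewrite -ZE in iZ.
  rewrite /Rintegral fineK; last exact: integrable_fin_num.
  by apply: eq_integral => w _ /=; rewrite ZE.
have h : (m1 \x m2)%E.-integrable setT (fun z : measurableTypeR R * measurableTypeR R => (z.1 * z.2)%:E).
  apply/integrable12ltyP => //.
  have e1 : (\int[m1]_x \int[m2]_y `|(x * y)%:E| = \int[m1]_x (`|x|%:E * \int[m2]_y `|y|%:E))%E.
    apply: eq_integral => x _; rewrite -ge0_integralZl//.
    by apply: eq_integral => y _; rewrite abse_EFin normrM EFinM.
  rewrite [ltLHS]e1.
  have f2 := absfin V V' iV erefl; have f1 := absfin U U' iU erefl.
  rewrite ge0_integralZr//; last by apply: integral_ge0 => y _; rewrite lee_fin.
  apply: lte_mul_pinfty => //.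
    by apply: integral_ge0 => y _; rewrite lee_fin.
  by rewrite ge0_fin_numE// integral_ge0.
have e12 : (\int[m1 \x m2]_z (z.1 * z.2)%:E = \int[m12]_z (z.1 * z.2)%:E)%E.
  by apply: eq_measure_integral => /= X mX _; exact: m12E.
have h12 : m12.-integrable setT (fun z : measurableTypeR R * measurableTypeR R => (z.1 * z.2)%:E).
  apply/integrableP; split=> //.
  move/integrableP : h => [_]; congr (_ < _)%E.
  by apply: eq_measure_integral => /= X mX _; exact: m12E.
have iUV : integ (fun w => U w * V w).
  apply/integrableP; split.
    by apply/measurable_EFinP; exact: measurable_funM.
  move/integrableP : h12 => [_].
  rewrite ge0_integral_distribution//.
  by apply: measurableT_comp.
split=> //.
apply: EFin_inj.
rewrite EFinM /Rintegral fineK; last exact: integrable_fin_num.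
transitivity (\int[m12]_z (z.1 * z.2)%:E)%E.
  by rewrite integral_distribution.
rewrite -e12 -integral12_prod_meas1//.
transitivity (\int[m1]_x (x%:E * (E V)%:E))%E.
  apply: eq_integral => x _; rewrite -(idist V V')// /=.
  transitivity (\int[m2]_y (x%:E * y%:E))%E; first by apply: eq_integral => y _; rewrite -EFinM.
  rewrite integralZl//.
  apply/integrableP; split=> //; exact: (absfin V V').
rewrite integralZr//; last by apply/integrableP; split=> //; exact: (absfin U U').
by rewrite (idist U U').
Qed.

Lemma law_integral (X : T -> R) (nu : probability (measurableTypeR R) R)
    (f : measurableTypeR R -> \bar R) : rv X -> has_law P X nu ->
  measurable_fun setT f -> (forall x, 0 <= f x)%E ->
  (\int[P]_w f (X w) = \int[nu]_x f x)%E.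
Proof.
move=> mX XE mf f0.
pose X' : {mfun T >-> measurableTypeR R} := HB.pack X (isMeasurableFun.Build _ _ _ _ _ mX).
rewrite -(ge0_integral_distribution (P := P) X' mf f0).
by apply: eq_measure_integral => A mA _; exact: XE.
Qed.

Lemma same_law_integral (X Y : T -> R) : rv X -> rv Y ->
  (forall A : set (measurableTypeR R), measurable A -> P (X @^-1` A) = P (Y @^-1` A)) ->
  integ X -> integ Y /\ E Y = E X.
Proof.
move=> mX mY XY iX.
pose X' : {mfun T >-> measurableTypeR R} := HB.pack X (isMeasurableFun.Build _ _ _ _ _ mX).
pose Y' : {mfun T >-> measurableTypeR R} := HB.pack Y (isMeasurableFun.Build _ _ _ _ _ mY).
have mabs : measurable_fun [set: measurableTypeR R] (fun x : measurableTypeR R => `|x|%:E).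
  by apply/measurable_EFinP; apply: measurableT_comp => //; exact: normr_measurable.
have mid : measurable_fun [set: measurableTypeR R] (fun x : measurableTypeR R => x%:E).
  by apply/measurable_EFinP.
have dE (f : measurableTypeR R -> \bar R) : (\int[distribution P X']_x f x = \int[distribution P Y']_x f x)%E.
  by apply: eq_measure_integral => A mA _; exact: XY.
have iY : integ Y.
  apply/integrableP; split; first exact/measurable_EFinP.
  move/integrableP: iX => [_].
  have := dE (fun x => `|x|%:E); rewrite !ge0_integral_distribution// => XYE.
  by congr (_ < _)%E; exact: XYE.
split=> //; congr fine.
by have := dE (fun x => x%:E); rewrite !integral_distribution.
Qed.
End laws.

(** * Statistics of random matrices *)

Section matrix_space.
Context {R : realType}.

Definition mx_generator (p q : nat) : set (set 'M[R]_(p, q)) :=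
  [set A | exists i j (B : set (measurableTypeR R)),
     measurable B /\ A = [set M : 'M[R]_(p, q) | B (M i j)]].

(** Matrices with the Borel sigma-algebra, so that statistics of random matrices are
    measurable functions in the usual sense. *)
Definition mxspace (p q : nat) := g_sigma_algebraType (@mx_generator p q).

Local Notation mxfun p q f :=
  (measurable_fun [set: mxspace p q] (f : mxspace p q -> measurableTypeR R)).

Lemma measurable_mxE p q (A : set 'M[R]_(p, q)) :
  measurable_mx A = measurable (A : set (mxspace p q)).
Proof. by []. Qed.

Lemma mxfun_coord p q i j : mxfun p q (fun M : 'M[R]_(p, q) => M i j).
Proof.
move=> _ B mB; rewrite setTI; apply: sub_sigma_algebra.
by exists i, j, B.
Qed.

Lemma mxfun_sum p q (I : finType) (f : I -> 'M[R]_(p, q) -> R) :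
  (forall i, mxfun p q (f i)) -> mxfun p q (fun M => \sum_i f i M).
Proof. by move=> mf; apply: measurable_sum. Qed.

Lemma mxfun_mul p q (f g : 'M[R]_(p, q) -> R) :
  mxfun p q f -> mxfun p q g -> mxfun p q (fun M => f M * g M).
Proof. by move=> mf mg; apply: measurable_funM. Qed.

Lemma mxfun_horner n (r : {poly R}) i j :
  mxfun n.+1 n.+1 (fun M : 'M[R]_n.+1 => horner_mx M r i j).
Proof.
elim/poly_ind: r i j => [|r c IH] i j.
  rewrite (_ : (fun _ => _) = cst 0); first exact: measurable_cst.
  by apply/funext => M; rewrite rmorph0 mxE.
rewrite (_ : (fun _ => _) = (fun M : 'M[R]_n.+1 =>
   \sum_k horner_mx M r i k * M k j + c *+ (i == j))); last first.
  apply/funext => M; rewrite (rmorphD (horner_mx M)) (rmorphM (horner_mx M)) /=.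
  by rewrite horner_mx_X horner_mx_C !mxE.
apply: measurable_funD; last exact: measurable_cst.
apply: mxfun_sum => k; apply: mxfun_mul; first exact: IH.
exact: mxfun_coord.
Qed.

Section random.
Context {d : measure_display} {T : measurableType d} (P : probability T R).
Local Notation rv X := (measurable_fun [set: T] (X : T -> measurableTypeR R)).

Lemma random_mx_measurable p q (X : T -> 'M[R]_(p, q)) : random_mx X ->
  measurable_fun [set: T] (X : T -> mxspace p q).
Proof.
move=> mX; apply: (@measurability _ _ _ (mxspace p q) _ _ (@mx_generator p q)) => //.
move=> _ [_ [i [j [B [mB ->]]]] <-].
rewrite setTI.
by have := mX i j measurableT B mB; rewrite setTI.
Qed.

Lemma random_mx_comp p q (X : T -> 'M[R]_(p, q)) (f : 'M[R]_(p, q) -> R) :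
  random_mx X -> mxfun p q f -> rv (fun w => f (X w)).
Proof.
move=> mX mf; apply: (@measurableT_comp _ _ _ _ (mxspace p q) _ f) => //.
exact: random_mx_measurable.
Qed.

Lemma same_law_comp p q (X Y : T -> 'M[R]_(p, q)) (f : 'M[R]_(p, q) -> R) :
  same_law P X Y -> mxfun p q f ->
  forall A : set (measurableTypeR R), measurable A ->
    P ((fun w => f (X w)) @^-1` A) = P ((fun w => f (Y w)) @^-1` A).
Proof.
move=> XY mf A mA.
have := XY (f @^-1` A); apply; rewrite measurable_mxE.
by have := mf measurableT A mA; rewrite setTI.
Qed.

Lemma independent_mx_comp p q p' q' (X : T -> 'M[R]_(p, q)) (Y : T -> 'M[R]_(p', q'))
    (f : 'M[R]_(p, q) -> R) (g : 'M[R]_(p', q') -> R) :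
  independent_mx P X Y -> mxfun p q f -> mxfun p' q' g ->
  forall A B : set (measurableTypeR R), measurable A -> measurable B ->
    P ((fun w => f (X w)) @^-1` A `&` (fun w => g (Y w)) @^-1` B) =
    (P ((fun w => f (X w)) @^-1` A) * P ((fun w => g (Y w)) @^-1` B))%E.
Proof.
move=> XY mf mg A B mA mB; apply: (XY (f @^-1` A) (g @^-1` B)); rewrite measurable_mxE.
  by have := mf measurableT A mA; rewrite setTI.
by have := mg measurableT B mB; rewrite setTI.
Qed.
End random.
End matrix_space.

(** * Second moments of a random instance *)

Section integrable_tools.
Context {d : measure_display} {T : measurableType d} {R : realType} (P : probability T R).
Local Notation rv X := (measurable_fun [set: T] (X : T -> measurableTypeR R)).
Local Notation integ X := (P.-integrable [set: T] (EFin \o X)).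
Local Notation E X := (\int[P]_w X w)%R.

Lemma integ_le (X Y : T -> R) : rv X -> (forall w, `|X w| <= Y w) -> integ Y -> integ X.
Proof.
move=> mX XY iY; apply: le_integrable iY => //; first exact/measurable_EFinP.
move=> w _ /=; rewrite lee_fin (le_trans (XY w))//; exact: ler_norm.
Qed.

Lemma integ_bounded (X : T -> R) (c : R) : rv X -> (forall w, `|X w| <= c) -> integ X.
Proof.
move=> mX Xc; apply: (integ_le mX Xc).
exact: finite_measure_integrable_cst.
Qed.

Lemma integ_sum (I : finType) (X : I -> T -> R) : (forall i, integ (X i)) ->
  integ (fun w => \sum_i X i w) /\ E (fun w => \sum_i X i w) = \sum_i E (X i).
Proof.
move=> iX; elim: (index_enum I) => [|i s [IH1 IH2]].
  split.
    rewrite (_ : _ \o _ = cst 0%:E); last by apply/funext => w /=; rewrite big_nil.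
    exact: finite_measure_integrable_cst.
  under eq_Rintegral do rewrite big_nil.
  by rewrite big_nil Rintegral_cst// mul0r.
split.
  rewrite (_ : _ \o _ = ((EFin \o X i) \+ (EFin \o (fun w => (\sum_(j <- s) X j w)%R)))%E).
    exact: integrableD.
  by apply/funext => w /=; rewrite big_cons EFinD.
under eq_Rintegral do rewrite big_cons.
by rewrite big_cons RintegralD// IH2.
Qed.

Lemma expectationE (X : T -> R) : integ X -> ('E_P[X] = (E X)%:E)%E.
Proof.
by move=> iX; rewrite unlock /Rintegral fineK//; exact: integrable_fin_num.
Qed.

Lemma integZ (X : T -> R) c : integ X -> integ (fun w => c * X w) /\ E (fun w => c * X w) = c * E X.
Proof.
move=> iX; split; last by rewrite RintegralZl.
by rewrite (_ : _ \o _ = (fun w => c%:E * (EFin \o X) w)%E) //; exact: integrableZl.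
Qed.
End integrable_tools.

Section instance.
Context {d : measure_display} {T : measurableType d} {R : realType} (P : probability T R).
Variables (L r : R) (nu : probability (measurableTypeR R) R) (n : nat).
Variables (Q : T -> 'M[R]_n.+1) (xs x0 : T -> 'cV[R]_n.+1) (lam : T -> 'rV[R]_n.+1).
Hypothesis L0 : 0 < L.
Hypothesis H : random_instance P L r nu Q xs x0 lam.
Local Notation rv X := (measurable_fun [set: T] (X : T -> measurableTypeR R)).
Local Notation integ X := (P.-integrable [set: T] (EFin \o X)).
Local Notation E X := (\int[P]_w X w)%R.
Local Notation mxfun p q f :=
  (measurable_fun [set: @mxspace R p q] (f : @mxspace R p q -> measurableTypeR R)).
Local Notation e := (fun w => x0 w - xs w).

Lemma random_error : random_mx e.
Proof.
move=> i j; have [_ m1 m2 _ _ _ _ _ _ _ _ _] := H.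
have -> : (fun w => (x0 w - xs w) i j) = (fun w => x0 w i j - xs w i j).
  by apply/funext => w; rewrite !mxE.
by apply: measurable_funB; [exact: m2|exact: m1].
Qed.

Lemma rv_error i : rv (fun w => e w i 0).
Proof. exact: random_error. Qed.

Lemma integ_error_sqr i : integ (fun w => e w i 0 ^+ 2).
Proof.
apply: (@integ_le _ _ _ _ _ (fun w => \sum_(i < n.+1) e w i 0 ^+ 2)).
- by apply: measurable_funX; exact: rv_error.
- move=> w; rewrite ger0_norm ?sqr_ge0// (bigD1 i)//= lerDl sumr_ge0// => j _.
  exact: sqr_ge0.
apply/integrableP; split.
  apply/measurable_EFinP; apply: measurable_sum => j; apply: measurable_funX.
  exact: rv_error.
have := ri_second_moment H; rewrite unlock => h.
under eq_integral => w _.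
  rewrite /= ger0_norm; last by apply: sumr_ge0 => j _; exact: sqr_ge0.
  over.
by rewrite h ltry.
Qed.

Lemma mxfun_coord2 p q i j k l :
  mxfun p q (fun M : 'M[R]_(p, q) => M i j * M k l).
Proof. by apply: mxfun_mul; exact: mxfun_coord. Qed.

Lemma integ_error2 i j : integ (fun w => e w i 0 * e w j 0).
Proof.
apply: (@integ_le _ _ _ _ _ (fun w => e w i 0 ^+ 2 + e w j 0 ^+ 2)).
- by apply: measurable_funM; exact: rv_error.
- move=> w; rewrite ler_norml.
  have := sqr_ge0 (e w i 0 + e w j 0); have := sqr_ge0 (e w i 0 - e w j 0).
  by have := sqr_ge0 (e w i 0); have := sqr_ge0 (e w j 0); move=> *; apply/andP; split; lra.
exact: (integrableD measurableT (integ_error_sqr i) (integ_error_sqr j)).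
Qed.

Lemma rotation_integral (U : 'M[R]_n.+1) (f : 'cV[R]_n.+1 -> R) :
  U *m U^T = 1%:M -> mxfun n.+1 1 f -> integ (fun w => f (e w)) ->
  E (fun w => f (U *m e w)) = E (fun w => f (e w)).
Proof.
move=> UU mf intf.
have mUe : random_mx (fun w => U *m e w).
  move=> i j; rewrite (_ : (fun w => _) = (fun w => \sum_k U i k * e w k j)).
    apply: measurable_sum => k; apply: measurable_funM => //.
    exact: random_error.
  by apply/funext => w; rewrite mxE.
have mfe : rv (fun w => f (e w)) by exact: random_mx_comp random_error mf.
have mfUe : rv (fun w => f (U *m e w)) by exact: random_mx_comp mUe mf.
apply: (same_law_integral mfe mfUe _ intf).2 => A mA; symmetry.
exact: (same_law_comp (ri_rotation H UU) mf mA).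
Qed.

(** The reflection in a coordinate hyperplane. *)
Definition flip (i : 'I_n.+1) : 'M[R]_n.+1 :=
  diag_mx (\row_j (if j == i then -1 else 1)).

Lemma flip_orth i : flip i *m (flip i)^T = 1%:M.
Proof.
rewrite tr_diag_mx mulmx_diag -diag_const_mx; congr diag_mx.
by apply/rowP => j; rewrite !mxE; case: ifP => _; rewrite ?mulrNN mulr1.
Qed.

Lemma flipE i (v : 'cV[R]_n.+1) j : (flip i *m v) j 0 = (if j == i then - v j 0 else v j 0).
Proof.
rewrite mul_diag_mx !mxE; case: ifP => _; by rewrite ?mulN1r ?mul1r.
Qed.

Lemma perm_orth (s : 'S_n.+1) : (perm_mx s : 'M[R]_n.+1) *m (perm_mx s)^T = 1%:M.
Proof. by rewrite tr_perm_mx -perm_mxM mulgV perm_mx1. Qed.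

Lemma row_perm_entry (s : 'S_n.+1) (v : 'cV[R]_n.+1) j : (perm_mx s *m v) j 0 = v (s j) 0.
Proof. by rewrite -row_permE mxE. Qed.

(** Reflecting the i-th coordinate changes the sign of e_i e_j. *)
Lemma error_cov i j : i != j -> E (fun w => e w i 0 * e w j 0) = 0.
Proof.
move=> ij; have mf := mxfun_coord2 (p := n.+1) (q := 1) i 0 j 0.
have := rotation_integral (flip_orth i) mf (integ_error2 i j).
under [LHS]eq_Rintegral do rewrite !flipE eqxx eq_sym (negbTE ij) mulNr -mulN1r.
rewrite RintegralZl//; last exact: integ_error2.
lra.
Qed.

(** Exchanging coordinates shows that all of them have the same second moment, and these
    moments add up to r^2. *)
Lemma error_var i : E (fun w => e w i 0 * e w i 0) = r ^+ 2 / n.+1%:R.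
Proof.
have same k : E (fun w => e w k 0 * e w k 0) = E (fun w => e w i 0 * e w i 0).
  have mf := mxfun_coord2 (p := n.+1) (q := 1) i 0 i 0.
  have := rotation_integral (perm_orth (tperm i k)) mf (integ_error2 i i) => <-.
  by apply: eq_Rintegral => w _; rewrite !row_perm_entry tpermL.
have := ri_second_moment H.
have iE k : integ (fun w => e w k 0 ^+ 2) := integ_error_sqr k.
have [iS sE] := integ_sum iE.
rewrite (expectationE iS) sE => -[].
under eq_bigr do under eq_Rintegral do rewrite expr2.
under eq_bigr do rewrite same.
rewrite sumr_const card_ord => <-.
by rewrite -[X in _ = X / _]mulr_natr mulfK// pnatr_eq0.
Qed.

Variables (m : method) (K : nat).
Definition gram (w : T) : 'M[R]_n.+1 :=
  horner_mx (Q w) ('X * residual m L^-1 K ^+ 2).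

Lemma gram_psd w : symmetric_psd (gram w).
Proof. by apply: psd_horner; exact: (ri_psd H). Qed.

Lemma gram_trace w : \tr (gram w) = \sum_i weight L m K (lam w 0 i).
Proof.
have [QT _] := ri_psd H w.
rewrite (trace_horner_symmetric _ QT (ri_eigenvalues H w)).
by apply: eq_bigr => i _; rewrite hornerM hornerX horner_exp.
Qed.

Lemma weight_le_L x : 0 <= x <= L -> 0 <= weight L m K x <= L.
Proof.
move=> xL; have /andP[x0' xL'] := xL; rewrite weight_ge0//=.
apply: (le_trans (weight_le_damped L0 m K xL)).
have /andP[h0 h1] := onem_le1 L0 K xL.
by rewrite -[leRHS]mulr1 ler_pM.
Qed.

Lemma gram_trace_le w : 0 <= \tr (gram w) <= n.+1%:R * L.
Proof.
rewrite gram_trace sumr_ge0 /=; last first.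
  by move=> i _; have /weight_le_L/andP[] := ri_range H w i.
rewrite mulr_natl -[X in _ *+ X]card_ord -sumr_const; apply: ler_sum => i _.
by have /weight_le_L/andP[] := ri_range H w i.
Qed.

Lemma rv_gram i j : rv (fun w => gram w i j).
Proof.
have mQ := ri_measurable_Q H.
exact: (random_mx_comp mQ (mxfun_horner _ i j)).
Qed.

Lemma gram_entry_le w i j : `|gram w i j| <= n.+1%:R * L.
Proof.
apply: (le_trans (psd_entry_le (gram_psd w) i j)).
by have /andP[] := gram_trace_le w.
Qed.

Lemma integ_gram i j : integ (fun w => gram w i j).
Proof. by apply: integ_bounded (rv_gram i j) _ => w; exact: gram_entry_le. Qed.

Definition mean_weight : R := fine (\int[nu]_(x in `[0%R, L]) (weight L m K x)%:E)%E.

Lemma law_lam (f : R -> R) i : measurable_fun [set: measurableTypeR R] (f : measurableTypeR R -> R) ->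
  (forall x, 0 <= x <= L -> 0 <= f x) ->
  (\int[P]_w (f (lam w 0 i))%:E = \int[nu]_(x in `[0%R, L]) (f x)%:E)%E.
Proof.
move=> mf f0; rewrite [RHS]integral_mkcond.
have mlam : rv (fun w => lam w 0 i) by exact: (ri_measurable_lam H).
have mI : measurable (`[0, L]%classic : set (measurableTypeR R)) by exact: measurable_itv.
rewrite -(law_integral mlam (ri_marginal H i)).
- apply: eq_integral => w _; rewrite patchE ifT// inE /= in_itv/=.
  exact: (ri_range H).
- apply: (measurable_restrictT _ mI).1; apply: measurable_funTS; exact/measurable_EFinP.
- move=> x; rewrite patchE; case: ifP => //; rewrite inE /= in_itv/= lee_fin; exact: f0.
Qed.

Lemma integ_weight i : integ (fun w => weight L m K (lam w 0 i)).
Proof.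
apply: (@integ_bounded _ _ _ _ _ L).
  apply: (@measurableT_comp _ _ _ _ _ _ (weight L m K)); first exact: measurable_weight.
  exact: (ri_measurable_lam H).
move=> w; have /weight_le_L/andP[h1 h2] := ri_range H w i.
by rewrite ger0_norm.
Qed.

Lemma mean_weightE i : E (fun w => weight L m K (lam w 0 i)) = mean_weight.
Proof.
rewrite /Rintegral law_lam//; first exact: measurable_weight.
by move=> x /weight_le_L/andP[].
Qed.

Lemma mean_weight_fin :
  (\int[nu]_(x in `[0%R, L]) (weight L m K x)%:E = mean_weight%:E)%E.
Proof.
rewrite /mean_weight fineK// -(@law_lam _ ord0).
- exact: (integrable_fin_num _ (integ_weight ord0)).
- exact: measurable_weight.
- by move=> x /weight_le_L/andP[].
Qed.

Lemma mean_gram_trace : E (fun w => \tr (gram w)) = n.+1%:R * mean_weight.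
Proof.
under eq_Rintegral do rewrite gram_trace.
have [_ ->] := integ_sum integ_weight.
under eq_bigr do rewrite mean_weightE.
by rewrite sumr_const card_ord mulr_natl.
Qed.

Lemma independent_stat (f : 'cV[R]_n.+1 -> R) (g : 'M[R]_n.+1 -> R) :
  mxfun n.+1 1 f -> mxfun n.+1 n.+1 g ->
  integ (fun w => f (e w)) -> integ (fun w => g (Q w)) ->
  integ (fun w => f (e w) * g (Q w)) /\
  E (fun w => f (e w) * g (Q w)) = E (fun w => f (e w)) * E (fun w => g (Q w)).
Proof.
move=> mf mg i1 i2; apply: independent_integral => //.
- exact: random_mx_comp random_error mf.
- exact: random_mx_comp (ri_measurable_Q H) mg.
- exact: (independent_mx_comp (ri_independent H) mf mg).
Qed.

Local Notation phi := (suboptimality m L Q xs x0 K).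

Lemma phiE w : phi w = 2^-1 * \sum_i \sum_j e w i 0 * e w j 0 * gram w i j.
Proof. by rewrite suboptimalityE ?quadE//; exact: (ri_psd H). Qed.

Lemma phi_quad w : phi w = 2^-1 * quad (gram w) (e w).
Proof. by rewrite suboptimalityE//; exact: (ri_psd H). Qed.

Lemma phi_ge0 w : 0 <= phi w.
Proof. by rewrite phi_quad mulr_ge0//; apply: quad_ge0; exact: gram_psd. Qed.

(** By independence E phi = 1/2 sum_ij E(e_i e_j) E M_ij, and the covariance of e is
    (r^2/d) I, so only the trace of M remains. *)
Lemma mean_phi : integ phi /\ E phi = r ^+ 2 / 2 * mean_weight.
Proof.
have T1 i j := independent_stat (mxfun_coord2 (p := n.+1) (q := 1) i 0 j 0)
  (mxfun_horner ('X * residual m L^-1 K ^+ 2) i j) (integ_error2 i j) (integ_gram i j).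
have T2 i := integ_sum (fun j => (T1 i j).1).
have [T31 T32] := integ_sum (fun i => (T2 i).1).
have [T41 T42] := integZ 2^-1 T31.
have phiE' : phi = (fun w => 2^-1 * \sum_i \sum_j e w i 0 * e w j 0 * gram w i j).
  by apply/funext => w; exact: phiE.
rewrite phiE'; split=> //.
rewrite [LHS]T42 T32.
have -> : \sum_i E (fun w => \sum_j e w i 0 * e w j 0 * gram w i j) =
   \sum_i (r ^+ 2 / n.+1%:R) * E (fun w => gram w i i).
  apply: eq_bigr => i _; rewrite (T2 i).2 (bigD1 i)//= (T1 i i).2 error_var.
  rewrite big1 ?addr0// => j ji; rewrite (T1 i j).2 error_cov ?mul0r//.
  by rewrite eq_sym.
rewrite -mulr_sumr.
have [_ <-] := integ_sum (fun i => integ_gram i i).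
rewrite [X in _ * (_ * X)]mean_gram_trace.
by field; rewrite addrC natr1 pnatr_eq0.
Qed.
End instance.

(** * Conditional value at risk *)

Section cvar.
Context {d : measure_display} {T : measurableType d} {R : realType} (P : probability T R).
Local Notation rv X := (measurable_fun [set: T] (X : T -> measurableTypeR R)).
Local Notation integ X := (P.-integrable [set: T] (EFin \o X)).
Local Notation E X := (\int[P]_w X w)%R.

Lemma integrable_rv (X : T -> R) : integ X -> rv X.
Proof. by case/integrableP => /measurable_EFinP. Qed.

Lemma CVaR_le (alpha : R) (X : T -> R) (t : R) :
  (CVaR P alpha X <= t%:E + (alpha^-1)%:E * 'E_P[fun w => Num.max (X w - t)%R 0%R])%E.
Proof. by apply: ereal_inf_lbound; exists t. Qed.

Lemma CVaR_le_mean (alpha : R) (X : T -> R) : integ X -> (forall w, 0 <= X w) ->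
  (CVaR P alpha X <= (alpha^-1 * E X)%:E)%E.
Proof.
move=> iX X0; apply: (le_trans (CVaR_le alpha X 0)); rewrite add0e.
rewrite (_ : (fun w => _) = X); first by rewrite expectationE// EFinM.
by apply/funext => w; rewrite subr0 max_l.
Qed.

Lemma integ_excess (X : T -> R) (t : R) : integ X -> integ (fun w => Num.max (X w - t) 0).
Proof.
move=> iX; apply: (@integ_le _ _ _ _ _ (fun w => `|X w| + `|t|)).
- apply: measurable_maxr => //; apply: measurable_funB => //; exact: integrable_rv.
- move=> w; rewrite ger0_norm ?le_max ?lexx ?orbT// ge_max addr_ge0 // andbT.
  by apply: (le_trans (ler_norm _)); exact: ler_normB.
have := integrableD measurableT (integrable_norm iX)
  (finite_measure_integrable_cst P `|t| measurableT).
by apply: eq_integrable.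
Qed.

Lemma integ_indic (X : T -> R) (A : set T) : measurable A -> integ X ->
  integ (fun w => X w * \1_A w).
Proof.
move=> mA iX; apply: (@integ_le _ _ _ _ _ (fun w => `|X w|)).
- apply: measurable_funM; first exact: integrable_rv.
  exact: measurable_indic.
- move=> w; rewrite normrM ler_piMr// ger0_norm ?indicE //; by case: (_ \in _).
by have := integrable_norm iX; apply: eq_integrable.
Qed.

Lemma mean_indic (A : set T) : measurable A -> integ (\1_A : T -> R) /\ (E (\1_A : T -> R))%:E = P A.
Proof.
move=> mA; have i1 : integ (\1_A : T -> R).
  apply: (@integ_bounded _ _ _ _ _ 1); first exact: measurable_indic.
  by move=> w; rewrite ger0_norm indicE //; case: (_ \in _).
split=> //; rewrite /Rintegral fineK; last exact: integrable_fin_num.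
by rewrite integral_indic// setIT.
Qed.

(** For t >= 0, (X - t)_+ >= (X - t) 1_A and P(A) <= alpha; for t < 0,
    (X - t)_+ >= X 1_A - t and alpha <= 1.  Both cases are treated at once by
    splitting t into its positive and negative parts. *)
Lemma CVaR_ge (alpha : R) (X : T -> R) (A : set T) : 0 < alpha <= 1 -> integ X ->
  (forall w, 0 <= X w) -> measurable A -> (P A <= alpha%:E)%E ->
  ((alpha^-1 * E (fun w => X w * \1_A w))%:E <= CVaR P alpha X)%E.
Proof.
move=> /andP[al0 al1] iX X0 mA PA; apply: le_ereal_inf_tmp => _ [t _ <-].
have iM := integ_excess t iX.
have iXA := integ_indic mA iX.
have [iA EA] := mean_indic mA.
rewrite expectationE// -EFinM -EFinD lee_fin.
rewrite -EA lee_fin in PA.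
have Ema : alpha * - Num.max t 0 + E (fun w => X w * \1_A w) - Num.min t 0 <=
     E (fun w => Num.max (X w - t) 0).
  set t1 := Num.max t 0; set t2 := Num.min t 0.
  have t12 : t1 + t2 = t.
    by rewrite /t1 /t2 maxEle minEle; case: ifP => _; rewrite ?addr0 ?add0r.
  have t10 : 0 <= t1 by rewrite le_max lexx orbT.
  have t20 : t2 <= 0 by rewrite ge_min lexx orbT.
  have [i1 E1] := integZ (- t1) iA.
  have iD := integrableD measurableT i1 iXA.
  have ED := RintegralD measurableT i1 iXA.
  have ic : integ (cst (- t2)) by exact: finite_measure_integrable_cst.
  have iD2 := integrableD measurableT iD ic.
  have ED2 : E (fun w => - t1 * \1_A w + X w * \1_A w + - t2) =
      - t1 * E (\1_A : T -> R) + E (fun w => X w * \1_A w) - t2.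
    rewrite (RintegralD measurableT iD ic) ED E1 Rintegral_cst//.
    by rewrite (_ : fine _ = 1) ?mulr1//; rewrite [X in fine X]probability_setT.
  apply: (@le_trans _ _ (E (fun w => - t1 * \1_A w + X w * \1_A w + - t2))).
    rewrite ED2 lerD2r lerD2r mulrC !mulNr lerN2 ler_wpM2l//.
  apply: le_Rintegral => // w _; rewrite indicE.
  case: (_ \in _); rewrite ?mulr1 ?mulr0 ?addr0 ?add0r.
    by rewrite le_max; apply/orP; left; lra.
  rewrite le_max; have := X0 w => Xw.
  have [t0|t0] := leP t2 t; last first.
    by apply/orP; left; lra.
  have [->|] := eqVneq t2 0; first by apply/orP; right; rewrite oppr0.
  rewrite /t2 minEle; case: ifP => [|_ /eqP//] tle _.
  by apply/orP; left; lra.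
have ai0 : 0 < alpha^-1 by rewrite invr_gt0.
have ai1 : 1 <= alpha^-1 by rewrite invf_ge1.
have := ler_wpM2l (ltW ai0) Ema.
rewrite !mulrDr mulrA mulVf ?gt_eqF// mul1r => h.
set t1 := Num.max t 0 in h; set t2 := Num.min t 0 in h.
have t12 : t1 + t2 = t.
  by rewrite /t1 /t2 maxEle minEle; case: ifP => _; rewrite ?addr0 ?add0r.
have t20 : t2 <= 0 by rewrite ge_min lexx orbT.
have : t2 * alpha^-1 <= t2 by nra.
nra.
Qed.

(** (X - t)_+ <= X^2/(4t), and t = s/2 with s^2 = E X^2 / alpha is optimal; adding
    eps to t avoids dividing by zero when X vanishes. *)
Lemma CVaR_le_L2 (alpha : R) (X : T -> R) : 0 < alpha -> rv X ->
  (CVaR P alpha X <= L2_bound P alpha X)%E.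
Proof.
move=> al0 mX; rewrite /L2_bound.
have mX2 : rv (fun w => X w ^+ 2) by exact: measurable_funX.
have [iX2|niX2] := pselect (integ (fun w => X w ^+ 2)); last first.
  have -> : ('E_P[fun w => (X w ^+ 2)%R] = +oo)%E.
    apply/eqP; rewrite -leye_eq leNgt; apply/negP => h; apply: niX2.
    apply/integrableP; split; first exact/measurable_EFinP.
    move: h; rewrite unlock; congr (_ < _)%E; apply: eq_integral => w _ /=.
    by rewrite ger0_norm ?sqr_ge0.
  by rewrite gt0_muley ?lte_fin ?invr_gt0//= leey.
rewrite (expectationE iX2) -EFinM /=.
set S := E (fun w => X w ^+ 2).
have S0 : 0 <= S by apply: Rintegral_ge0 => w _; exact: sqr_ge0.
set s := Num.sqrt (alpha^-1 * S).
have s2 : s ^+ 2 = alpha^-1 * S by rewrite sqr_sqrtr// mulr_ge0// invr_ge0 ltW.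
have s0 : 0 <= s by exact: sqrtr_ge0.
apply/lee_addgt0Pr => eps eps0.
pose t := s / 2 + eps.
have t0 : 0 < t by rewrite /t; lra.
apply: (le_trans (CVaR_le alpha X t)).
have [i1 E1] := integZ ((4 * t)^-1) iX2.
have t4 : 0 < 4 * t by rewrite mulr_gt0.
have pw w : Num.max (X w - t) 0 <= (4 * t)^-1 * X w ^+ 2.
  rewrite ge_max; apply/andP; split; last by rewrite mulr_ge0 ?sqr_ge0// invr_ge0 ltW.
  rewrite mulrC ler_pdivlMr//; have := sqr_ge0 (X w - 2 * t); nra.
have iM : integ (fun w => Num.max (X w - t) 0).
  apply: integ_le i1 => [|w].
    by apply: measurable_maxr => //; apply: measurable_funB.
  by rewrite ger0_norm ?pw// le_max lexx orbT.
rewrite expectationE// -EFinM -!EFinD lee_fin.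
have h : E (fun w => Num.max (X w - t) 0) <= (4 * t)^-1 * S.
  by rewrite -E1; apply: le_Rintegral.
apply: (@le_trans _ _ (t + s ^+ 2 / (4 * t))).
  rewrite lerD2l s2 -mulrA [S / _]mulrC; apply: ler_wpM2l => //.
  by rewrite invr_ge0 ltW.
suff : s ^+ 2 / (4 * t) <= s / 2 by rewrite /t; lra.
rewrite ler_pdivrMr// /t; nra.
Qed.
End cvar.

(** * Asymptotics of the risk and of the mean *)

Lemma Boole_finite d (T : measurableType d) (R : realType) (P : probability T R)
    (n : nat) (A : 'I_n.+1 -> set T) (b : R) :
  (forall i, measurable (A i)) -> (forall i, (P (A i) <= b%:E)%E) ->
  measurable [set w | exists i, A i w] /\
  (P [set w | exists i, A i w] <= (n.+1%:R * b)%:E)%E.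
Proof.
move=> mA PA.
have -> : [set w | exists i, A i w] = \big[setU/set0]_(i < n.+1) A (inord i).
  rewrite -(bigcup_mkord n.+1 (fun k => A (inord k))); apply/seteqP; split=> [w [i Ai]|w [k /= kn Ak]].
    by exists (val i) => //=; rewrite inord_val.
  by exists (inord k).
split; first exact: bigsetU_measurable.
apply: (le_trans (Boole_inequality P (A := fun i => A (inord i)) _)) => //.
apply: (@le_trans _ _ (\sum_(i < n.+1) b%:E)%E); first by apply: lee_sum => i _; exact: PA.
by rewrite sumEFin sumr_const card_ord mulr_natl.
Qed.

Section rates.
Context {R : realType}.

Lemma mean_log_ge0 m (a : R) K : 0 <= mean_log m a K.
Proof. by case: m => //=; case: ifP => // _; case: K => [|K]; [rewrite ln0|rewrite ln_ge0// ler1n]. Qed.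

Lemma mean_rate_ge0 m (a : R) K : 0 <= mean_rate m a K.
Proof. by rewrite mulr_ge0 ?powR_ge0 ?mean_log_ge0. Qed.

Lemma mean_rate_gt0 m (a : R) K : (2 <= K)%N -> 0 < mean_rate m a K.
Proof.
move=> K2; rewrite mulr_gt0 ?powR_gt0 ?ltr0n ?(leq_trans _ K2)//.
by case: m => //=; case: ifP => // _; rewrite ln_gt0// ltr1n.
Qed.

Lemma mean_rate_ge m (a : R) : exists K0, forall K, (K0 <= K)%N ->
  K%:R `^ (- mean_exponent m a) <= mean_rate m a K.
Proof.
have [K0 hK] := ln_nat_large (1 : R); exists K0 => K /hK l1.
rewrite /mean_rate ler_peMr ?powR_ge0//; case: m => //=.
by case: ifP.
Qed.

Lemma geometric_small m (a t eps : R) : 0 < t <= 1 -> 0 < eps ->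
  exists K0, forall K, (K0 <= K)%N -> (1 - t) ^+ K <= eps * mean_rate m a K.
Proof.
move=> t01 eps0; have /andP[t0 t1] := t01.
pose j := (Num.bound (mean_exponent m a)).+1.
have [D D0 hD] := @onem_exp_le R j isT.
have [K1 h1] := mean_rate_ge m a.
have c0 : 0 < eps / (D * t `^ (- j%:R)) by rewrite divr_gt0// mulr_gt0// powR_gt0.
have [K2 h2] := @natpow_small R 1 (eps / (D * t `^ (- j%:R))) ltr01 c0.
exists (maxn 1 (maxn K1 K2)) => K; rewrite !geq_max => /and3P[K0 /h1 {}h1 /h2 {}h2].
have Kge1 : 1 <= K%:R :> R by rewrite ler1n.
apply: (le_trans (hD K t K0 t01)).
apply: (@le_trans _ _ (eps * K%:R `^ (- mean_exponent m a))); last first.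
  by rewrite ler_wpM2l// ltW.
have je : mean_exponent m a + 1 <= j%:R.
  rewrite /j -natr1 lerD2r; have [h|h] := leP 0 (mean_exponent m a).
    exact/ltW/archi_boundP.
  by rewrite (le_trans (ltW h)).
have : K%:R `^ (- j%:R) <= K%:R `^ (- 1) * K%:R `^ (- mean_exponent m a).
  rewrite -gt0_powRD ?ltr0n//; apply: ler_powR => //; lra.
move: h2; set x := K%:R `^ (- 1); set y := K%:R `^ (- mean_exponent m a).
set z := K%:R `^ (- j%:R); set s := t `^ _ => h2 h3.
have s0 : 0 < s by exact: powR_gt0.
have y0 : 0 <= y by exact: powR_ge0.
rewrite ler_pdivlMr in h2; last by rewrite mulr_gt0.
apply: (@le_trans _ _ ((x * (D * s)) * y)); last by rewrite ler_wpM2r.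
rewrite (_ : x * _ * y = D * ((x * y) * s)); last by ring.
by rewrite ler_wpM2l ?(ltW D0)// ler_wpM2r// ltW.
Qed.
End rates.

Section part_one.
Context {d : measure_display} {T : measurableType d} {R : realType} (P : probability T R).
Variables (L r a delta c C : R) (nu : probability (measurableTypeR R) R) (p : R -> R) (n : nat).
Variables (Q : T -> 'M[R]_n.+1) (xs x0 : T -> 'cV[R]_n.+1) (lam : T -> 'rV[R]_n.+1).
Hypothesis L0 : 0 < L.
Hypothesis r0 : 0 < r.
Hypothesis nu_density : has_density nu p.
Hypothesis near0 : power_density_near0 delta c C a p.
Hypothesis deltaL : delta <= L.
Hypothesis agtN1 : -1 < a.
Hypothesis H : random_instance P L r nu Q xs x0 lam.
Variable m : method.
Local Notation rv X := (measurable_fun [set: T] (X : T -> measurableTypeR R)).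
Local Notation integ X := (P.-integrable [set: T] (EFin \o X)).
Local Notation E X := (\int[P]_w X w)%R.
Local Notation e := (fun w => x0 w - xs w).
Local Notation phi := (suboptimality m L Q xs x0).

(** nu has a density, of order x^a with a > -1, so the mass of ]0, z] is of order
    z^(a+1). *)
Lemma small_mass (eps : R) : 0 < eps -> exists2 z : R, 0 < z <= L & (nu `]0%R, z]%classic <= eps%:E)%E.
Proof.
move=> eps0; have [d0 c0 C0 pd] := near0; have aN1 := agtN1.
have a1 : 0 < a + 1 by lra.
pose y := (eps * (a + 1) / C) `^ (a + 1)^-1.
have y0 : 0 < y by rewrite powR_gt0// divr_gt0// mulr_gt0.
pose z := Num.min delta y.
have z0 : 0 < z by rewrite lt_min d0.
have zd : z <= delta by rewrite ge_min lexx.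
exists z; first by rewrite z0 (le_trans zd).
have mD : measurable (`]0%R, z]%classic : set (measurableTypeR R)) by exact: measurable_itv.
have := @nu_integral_piece_le R nu p a delta c C nu_density near0 (cst 1) 1 0 (z `^ (a + 1) / (a + 1)) _
   (measurable_cst _) mD.
have -> : (\int[nu]_(x in `]0%R, z]) ((cst 1 : R -> R) x)%:E = nu `]0%R, z]%classic)%E.
  by rewrite (integral_cst nu mD 1%E) mul1e.
move=> h; apply: (le_trans (h _ _ _ _)) => //.
- by move=> x; rewrite /= in_itv/= => /andP[-> xz]; rewrite (le_trans xz).
- by move=> x _; rewrite powRr0 mul1r ler01 lexx.
- by under eq_integral do rewrite addr0; exact: integral_powR0_le.
rewrite lee_fin mul1r.
have : z `^ (a + 1) <= eps * (a + 1) / C.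
  apply: (@le_trans _ _ (y `^ (a + 1))).
    by apply: ge0_ler_powR; rewrite ?nnegrE ?(ltW z0) ?(ltW y0) ?(ltW a1)// ge_min lexx orbT.
  rewrite -powRrM mulVf ?gt_eqF// powRr1// divr_ge0 ?(ltW C0)//.
  by rewrite mulr_ge0 ?ltW.
rewrite ler_pdivlMr// => h2.
by rewrite mulrA ler_pdivrMr// mulrC.
Qed.

(** An eigenvalue equal to 0 contributes nothing, and one larger than z is damped by
    (1 - z/L)^K. *)
Lemma phi_le_away K z w : 0 < z <= L -> ~ (exists i, 0 < lam w 0 i <= z) ->
  phi K w <= 2^-1 * (n.+1%:R * (L * (1 - z / L) ^+ K)) * \sum_i e w i 0 ^+ 2.
Proof.
move=> /andP[z0 zL] away; rewrite (phi_quad H) -mulrA ler_wpM2l//.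
apply: (le_trans (quad_le_trace (gram_psd H m K w) _)).
apply: ler_wpM2r; first by apply: sumr_ge0 => i _; exact: sqr_ge0.
rewrite (gram_trace H).
rewrite mulr_natl -[X in _ *+ X]card_ord -sumr_const; apply: ler_sum => i _.
have q0 : 0 <= (1 - z / L) ^+ K.
  by apply: exprn_ge0; rewrite subr_ge0 ler_pdivrMr// mul1r.
have li := ri_range H w i; have /andP[l0 lL] := li.
have [lz|lz] := leP (lam w 0 i) z.
  have l00 : lam w 0 i = 0.
    apply/eqP; rewrite eq_le l0 andbT leNgt; apply/negP => lp.
    by apply: away; exists i; rewrite lp.
  by rewrite l00 /weight mul0r mulr_ge0// ltW.
apply: (le_trans (weight_le_damped L0 m K li)).
apply: ler_pM => //.
  by apply: exprn_ge0; rewrite subr_ge0 ler_pdivrMr// mul1r.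
apply: lerXn2r; rewrite ?nnegrE ?subr_ge0 ?ler_pdivrMr ?mul1r//.
by rewrite lerD2l lerN2; apply: ler_wpM2r; [rewrite invr_ge0|]; exact: ltW.
Qed.

Lemma mean_phi_rate : exists2 D : R * R, 0 < D.1 /\ 0 < D.2 & exists K0, forall K, (K0 <= K)%N ->
  D.1 * mean_rate m a K <= E (phi K) <= D.2 * mean_rate m a K.
Proof.
have [D1 D10 h1] := mean_upper L0 nu_density near0 deltaL agtN1 m.
have [D2 D20 [K0 h2]] := mean_lower L0 nu_density near0 deltaL agtN1 m.
have r2 : 0 < r ^+ 2 / 2 by rewrite divr_gt0// exprn_gt0.
exists (r ^+ 2 / 2 * D2, r ^+ 2 / 2 * D1); first by rewrite /= !mulr_gt0.
exists (maxn 2 K0) => K; rewrite geq_max => /andP[K2 K0K] /=.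
have [_ ->] := mean_phi L0 H m K.
rewrite -!(mulrA (r ^+ 2 / 2)); apply/andP; split; apply: ler_wpM2l; rewrite ?(ltW r2)//.
  by have := h2 K K0K; rewrite (mean_weight_fin L0 H) lee_fin.
by have := h1 K K2; rewrite (mean_weight_fin L0 H) lee_fin.
Qed.

(** [CVaR_ge] for the event that some eigenvalue lies in ]0, z], with z so small that
    the union bound gives it probability at most alpha. *)
Lemma CVaR_gap alpha : 0 < alpha <= 1 -> exists2 z : R, 0 < z <= 1 & forall K,
  [/\ (CVaR P alpha (phi K) <= (alpha^-1 * E (phi K))%:E)%E &
  ((alpha^-1 * (E (phi K) - 2^-1 * (n.+1%:R * (L * (1 - z) ^+ K)) * r ^+ 2))%:E
     <= CVaR P alpha (phi K))%E].
Proof.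
move=> al01; have /andP[al0 al1] := al01.
have [|z zL nuz] := @small_mass (alpha / n.+1%:R); first by rewrite divr_gt0// ltr0n.
have /andP[z0 zL'] := zL.
pose A := [set w | exists i, (fun i => [set w | 0 < lam w 0 i <= z]) i w].
have mlam i : rv (fun w => lam w 0 i) by exact: (ri_measurable_lam H).
have AiE i : [set w | 0 < lam w 0 i <= z] = (fun w => lam w 0 i) @^-1` `]0, z]%classic.
  by apply/seteqP; split=> w /=; rewrite in_itv.
have mI : measurable (`]0%R, z]%classic : set (measurableTypeR R)) by exact: measurable_itv.
have [mA PA] : measurable A /\ (P A <= (n.+1%:R * (alpha / n.+1%:R))%:E)%E.
  apply: Boole_finite => i.
    by rewrite AiE -[X in measurable X]setTI; exact: mlam.
  by rewrite AiE (ri_marginal H i mI).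
rewrite mulrC divfK ?pnatr_eq0// in PA.
exists (z / L); first by rewrite divr_gt0//= ler_pdivrMr// mul1r.
move=> K; have [iphi _] := mean_phi L0 H m K.
have phi0 := phi_ge0 H m K.
split; first exact: CVaR_le_mean.
apply: le_trans (CVaR_ge al01 iphi phi0 mA PA).
rewrite lee_fin ler_wpM2l ?invr_ge0 ?(ltW al0)//.
have [iS ES] := integ_sum (fun i => integ_error_sqr H i).
have [iS2 ES2] := integZ (2^-1 * (n.+1%:R * (L * (1 - z / L) ^+ K))) iS.
have iA := integ_indic mA iphi.
have Sr : E (fun w => \sum_i e w i 0 ^+ 2) = r ^+ 2.
  by have := ri_second_moment H; rewrite (expectationE iS) => -[].
rewrite lerBlDr -Sr -ES2 -RintegralD//.
apply: le_Rintegral => //.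
  by have := integrableD measurableT iA iS2; apply: eq_integrable.
move=> w _; rewrite indicE; case: (boolP (w \in A)) => wA.
  rewrite mulr1 lerDl; apply: mulr_ge0; last by apply: sumr_ge0 => i _; exact: sqr_ge0.
  rewrite !mulr_ge0 ?(ltW L0)// exprn_ge0// subr_ge0 ler_pdivrMr// mul1r//.
rewrite mulr0 add0r; apply: phi_le_away => // wA'.
by move/negP: wA; apply; rewrite inE.
Qed.

Lemma CVaR_equivalent alpha : 0 < alpha <= 1 ->
  (fun K : nat => fine (CVaR P alpha (phi K)) / (alpha^-1 * fine 'E_P[phi K])%R) @ \oo --> (1 : R).
Proof.
move=> al01; have /andP[al0 al1] := al01.
have [z z01 gap] := CVaR_gap al01.
have [[D1 D2] [/= D10 D20] [K1 hD]] := mean_phi_rate.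
apply/cvgrPdist_le => eps eps0.
pose B := 2^-1 * (n.+1%:R * L) * r ^+ 2.
have B0 : 0 < B.
  by rewrite !mulr_gt0 ?exprn_gt0 ?ltr0n ?invr_gt0.
have [K2 hK2] := @geometric_small R m a z (eps * D1 / B) z01 (divr_gt0 (mulr_gt0 eps0 D10) B0).
exists (maxn 2 (maxn K1 K2)) => //= K; rewrite /= !geq_max => /and3P[K22 /hD/andP[D1K D2K] /hK2 qK].
have [g1 g2] := gap K.
have [iphi _] := mean_phi L0 H m K.
have mr := mean_rate_gt0 m a K22.
have Ephi : 0 < E (phi K) by apply: lt_le_trans D1K; exact: mulr_gt0.
rewrite expectationE//=.
have fC : CVaR P alpha (phi K) \is a fin_num.
  rewrite fin_numE; apply/andP; split; apply/eqP => CE; first by rewrite CE in g2.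
  by rewrite CE in g1.
rewrite -(fineK fC) !lee_fin in g1 g2.
have ai0 : 0 < alpha^-1 by rewrite invr_gt0.
have den : 0 < alpha^-1 * E (phi K) by rewrite mulr_gt0.
have u1 : fine (CVaR P alpha (phi K)) / (alpha^-1 * E (phi K)) <= 1.
  by rewrite ler_pdivrMr// mul1r.
rewrite ger0_norm ?subr_ge0// lerBlDr -lerBlDl.
rewrite ler_pdivlMr//; apply: le_trans g2.
rewrite mulrCA ler_wpM2l ?(ltW ai0)// mulrBl mul1r lerD2l lerN2.
rewrite (_ : _ * r ^+ 2 = B * (1 - z) ^+ K); last by rewrite /B; ring.
apply: (@le_trans _ _ (B * (eps * D1 / B * mean_rate m a K))).
  by rewrite ler_wpM2l// ltW.
rewrite (_ : B * _ = eps * (D1 * mean_rate m a K)); last by field; rewrite gt_eqF.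
by rewrite ler_wpM2l// ltW.
Qed.

Lemma mean_phi_Theta : (fun K : nat => fine 'E_P[phi K]) =Theta_\oo mean_rate m a.
Proof.
have [[D1 D2] [/= D10 D20] [K1 hD]] := mean_phi_rate.
rewrite eqThetaE; apply/asboolP; exists (D1, D2); first by rewrite /= D10.
exists K1 => //= K /= /hD/andP[h1 h2].
have [iphi _] := mean_phi L0 H m K.
rewrite expectationE//= (ger0_norm (mean_rate_ge0 _ _ _)).
by rewrite ger0_norm// (le_trans _ h1)// mulr_ge0 ?mean_rate_ge0// ltW.
Qed.
End part_one.

(** * Fourth moments of Gaussian variables *)

Section normal_moments.
Context {R : realType}.
Implicit Types m s x : R.
Notation mu := (@lebesgue_measure R).

(** Tilting by exp((x-m)^2/(4 s^2)) turns a normal density of variance s^2 into a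
    multiple of the one of variance 2 s^2.  As the exponential dominates every
    power, central moments are then bounded by the total mass of the second density,
    with no moment to compute. *)
Lemma normal_pdf_expR m s x : s != 0 ->
  expR ((x - m) ^+ 2 / (4 * s ^+ 2)) * normal_pdf m s x =
  Num.sqrt 2 * normal_pdf m (Num.sqrt 2 * s) x.
Proof.
move=> s0; have s20 : Num.sqrt 2 != 0 :> R by rewrite gt_eqF// sqrtr_gt0.
have q2 : Num.sqrt 2 ^+ 2 = 2 :> R by rewrite sqr_sqrtr.
rewrite !normal_pdfE ?mulf_neq0//.
have -> : normal_peak (Num.sqrt 2 * s) = (Num.sqrt 2)^-1 * normal_peak s.
  rewrite /normal_peak -invfM -sqrtrM//; congr (Num.sqrt _)^-1.
  by rewrite exprMn q2; ring.
rewrite !mulrA mulfV// mul1r [expR _ * _]mulrC -!mulrA; congr (_ * _).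
rewrite /normal_fun -expRD exprMn q2; congr expR.
by field; rewrite ?expf_neq0.
Qed.

Lemma normal_moment_le m s (f : measurableTypeR R -> R) (B : R) : s != 0 -> 0 <= B ->
  measurable_fun [set: measurableTypeR R] f ->
  (forall x, 0 <= f x <= B * expR ((x - m) ^+ 2 / (4 * s ^+ 2))) ->
  (\int[normal_prob m s]_x (f x)%:E <= (2 * B)%:E)%E.
Proof.
move=> s0 B0 mf fB.
have mpdf s' : measurable_fun [set: measurableTypeR R] (normal_pdf m s' : measurableTypeR R -> R).
  exact: measurable_normal_pdf.
rewrite (@integral_density _ (measurableTypeR R) R mu (normal_prob m s) (normal_pdf m s)) //; last 3 first.
- by move=> x; exact: normal_pdf_ge0.
- exact/measurable_EFinP.
- by move=> x _; rewrite lee_fin; case/andP: (fB x).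
apply: (@le_trans _ _ (\int[mu]_x ((B * Num.sqrt 2)%:E * (normal_pdf m (Num.sqrt 2 * s) x)%:E))%E).
  apply: ge0_le_integral => //.
  - by move=> x _; rewrite -EFinM lee_fin mulr_ge0 ?normal_pdf_ge0//; case/andP: (fB x).
  - apply: emeasurable_funM; apply/measurable_EFinP => //.
  - by apply: emeasurable_funM => //; apply/measurable_EFinP.
  - move=> x _; rewrite -!EFinM lee_fin -mulrA -normal_pdf_expR// mulrA.
    by apply: ler_wpM2r; [exact: normal_pdf_ge0|case/andP: (fB x)].
rewrite ge0_integralZl//; first last.
- by rewrite lee_fin mulr_ge0.
- by move=> x _; rewrite lee_fin normal_pdf_ge0.
- exact/measurable_EFinP.
rewrite integral_normal_pdf mule1 lee_fin mulrC ler_wpM2r//.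
rewrite -[leRHS](ger0_norm (ler0n R 2)) -sqrtr_sqr ler_wsqrtr// expr2; lra.
Qed.

Lemma expR_ge_sqr (z : R) : 0 <= z -> z ^+ 2 / 2 <= expR z.
Proof.
move=> z0; have := expR_ge1Dxn 1 z0; rewrite /= => h.
by apply: le_trans h; rewrite lerDr.
Qed.

Lemma normal_central2 m s : s != 0 ->
  (\int[normal_prob m s]_x ((x - m) ^+ 2)%:E <= (8 * s ^+ 2)%:E)%E.
Proof.
move=> s0; have s2 : 0 < s ^+ 2 by rewrite lt_def expf_neq0//= sqr_ge0.
rewrite (_ : 8 * _ = 2 * (4 * s ^+ 2)); last by ring.
apply: normal_moment_le => //; first by rewrite mulr_ge0// ltW.
  by apply: measurable_funX; exact: measurable_funB.
move=> x; rewrite sqr_ge0/=; set z := (x - m) ^+ 2 / _.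
rewrite (_ : (x - m) ^+ 2 = 4 * s ^+ 2 * z); last by rewrite /z; field.
rewrite ler_wpM2l//; first by rewrite mulr_ge0// ltW.
by apply: le_trans (expR_ge1Dx z); rewrite lerDr.
Qed.

Lemma normal_central4 m s : s != 0 ->
  (\int[normal_prob m s]_x ((x - m) ^+ 4)%:E <= (64 * s ^+ 4)%:E)%E.
Proof.
move=> s0; have s2 : 0 < s ^+ 2 by rewrite lt_def expf_neq0//= sqr_ge0.
rewrite (_ : 64 * _ = 2 * (32 * (s ^+ 2) ^+ 2)); last by rewrite -exprM; ring.
apply: normal_moment_le => //; first by rewrite mulr_ge0// sqr_ge0.
  by apply: measurable_funX; exact: measurable_funB.
move=> x; rewrite (exprM _ 2 2) sqr_ge0/=; set z := (x - m) ^+ 2 / _.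
have z0 : 0 <= z by rewrite divr_ge0 ?sqr_ge0// mulr_ge0// ltW.
have -> : ((x - m) ^+ 2) ^+ 2 = 32 * (s ^+ 2) ^+ 2 * (z ^+ 2 / 2).
  by rewrite /z; field.
by rewrite ler_wpM2l ?expR_ge_sqr// mulr_ge0// sqr_ge0.
Qed.

(** The density is at most its peak 1/(|s| sqrt(2 pi)), and the interval has length
    |s|. *)
Lemma normal_central_mass m s : s != 0 ->
  (normal_prob m s `[(- (`|s| / 2))%R, (`|s| / 2)%R]%classic <= (2^-1)%:E)%E.
Proof.
move=> s0; have ns : 0 < `|s| by rewrite normr_gt0.
rewrite /normal_prob.
apply: (@le_trans _ _ (\int[mu]_(x in `[(- (`|s| / 2))%R, (`|s| / 2)%R]) (normal_peak s)%:E)%E).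
  apply: ge0_le_integral => //.
  - by move=> x _; rewrite lee_fin normal_pdf_ge0.
  - by apply/measurable_EFinP; apply: measurable_funTS; exact: measurable_normal_pdf.
  - by move=> x _; rewrite lee_fin normal_pdf_ub.
rewrite integral_cst//= lebesgue_measure_itv/= lte_fin ifT; last lra.
rewrite -EFinB -EFinM lee_fin (_ : _ - _ = `|s|); last by field.
rewrite /normal_peak ler_pdivrMl; last first.
  by rewrite sqrtr_gt0 pmulrn_lgt0// mulr_gt0 ?pi_gt0// lt_def expf_neq0//= sqr_ge0.
rewrite ler_pdivlMr// -[leLHS]ger0_norm ?mulr_ge0// -sqrtr_sqr ler_wsqrtr//.
rewrite exprMn real_normK ?num_real// -mulrnAr ler_wpM2l ?sqr_ge0//.
have := @pi_ge2 R; rewrite mulr2n expr2; lra.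
Qed.
End normal_moments.

Section gaussian.
Context {d : measure_display} {T : measurableType d} {R : realType} (P : probability T R).
Local Notation rv X := (measurable_fun [set: T] (X : T -> measurableTypeR R)).
Local Notation integ X := (P.-integrable [set: T] (EFin \o X)).
Local Notation E X := (\int[P]_w X w)%R.

(** From E X^4 <= 8 m^4 + 512 s^4, m^2 <= 130 E X^2 and s^2 <= 8 E X^2.
    The sharp value is 3. *)
Definition kurtosis_bound : R := 8 * 130 ^+ 2 + 512 * 8 ^+ 2.

Lemma law_mean_le (X : T -> R) (nu : probability (measurableTypeR R) R)
    (f : measurableTypeR R -> R) (b : R) : rv X -> has_law P X nu ->
  measurable_fun [set: measurableTypeR R] f -> (forall x, 0 <= f x) ->
  (\int[nu]_x (f x)%:E <= b%:E)%E ->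
  integ (fun w => f (X w)) /\ E (fun w => f (X w)) <= b.
Proof.
move=> mX Xnu mf f0 fb.
have fE : (\int[P]_w (f (X w))%:E = \int[nu]_x (f x)%:E)%E.
  by apply: (law_integral mX Xnu) => //; exact/measurable_EFinP.
have iX : integ (fun w => f (X w)).
  apply/integrableP; split.
    by apply/measurable_EFinP; exact: measurableT_comp.
  under eq_integral => w _ do rewrite /= ger0_norm//.
  by rewrite fE (le_lt_trans fb)// ltry.
split=> //; rewrite -lee_fin /Rintegral fineK; last exact: integrable_fin_num.
by rewrite fE.
Qed.

(** Write X = m + s G.  The fourth moment is at most a multiple of m^4 + s^4, while
    E X^2 is at least a multiple of m^2 + s^2: G is not concentrated near any point. *)
Lemma gaussian_kurtosis (X : T -> R) m s : rv X -> integ (fun w => X w ^+ 2) ->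
  has_law P X (gaussian_law m s) ->
  integ (fun w => X w ^+ 4) /\
  E (fun w => X w ^+ 4) <= kurtosis_bound * E (fun w => X w ^+ 2) ^+ 2.
Proof.
move=> mX iX2; have mX4 : rv (fun w => X w ^+ 4) by exact: measurable_funX.
rewrite /gaussian_law; case: ifP => [/eqP _|/negbT s0] Xlaw.
  have mc k : measurable_fun [set: measurableTypeR R] (fun x : measurableTypeR R => (x ^+ k)%:E).
    by apply/measurable_EFinP; exact: measurable_funX.
  have mom k : ~~ odd k -> (\int[P]_w (X w ^+ k)%:E = (m ^+ k)%:E)%E.
    move=> k2.
    rewrite (law_integral (nu := @dirac _ (measurableTypeR R) m R) (f := fun x => (x ^+ k)%:E) mX Xlaw (mc k)).
      by rewrite integral_dirac// diracT mul1e.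
    by move=> x; rewrite lee_fin exprn_even_ge0.
  have e2 : E (fun w => X w ^+ 2) = m ^+ 2 by rewrite /Rintegral mom.
  have e4 : E (fun w => X w ^+ 4) = m ^+ 4 by rewrite /Rintegral mom.
  split.
    apply/integrableP; split; first exact/measurable_EFinP.
    under eq_integral => w _ do rewrite /= ger0_norm ?exprn_even_ge0//.
    by rewrite mom// ltry.
  rewrite e2 e4 -exprM ler_peMl ?exprn_even_ge0// /kurtosis_bound !expr2; lra.
have mB k : measurable_fun [set: measurableTypeR R] (fun x : measurableTypeR R => (x - m) ^+ k).
  by apply: measurable_funX; exact: measurable_funB.
have [i2 c2] := law_mean_le mX Xlaw (mB 2) (fun x => sqr_ge0 _) (normal_central2 m s0).
have [i4 c4] := law_mean_le mX Xlaw (mB 4) (fun x => @exprn_even_ge0 R 4 _ isT) (normal_central4 m s0).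
set V := E (fun w => X w ^+ 2).
have V0 : 0 <= V by apply: Rintegral_ge0 => w _; exact: sqr_ge0.
(* X^2 exceeds s^2/4 with probability at least 1/2. *)
have sV : s ^+ 2 <= 8 * V.
  pose I : set (measurableTypeR R) := `[(- (`|s| / 2))%R, (`|s| / 2)%R]%classic.
  have mI : measurable I by exact: measurable_itv.
  have mXI : measurable (X @^-1` I) by rewrite -[X in measurable X]setTI; exact: mX.
  have [iI EI] := mean_indic P mXI.
  have PI : E (\1_(X @^-1` I) : T -> R) <= 2^-1.
    by rewrite -lee_fin EI (Xlaw I mI); exact: normal_central_mass.
  have [iI' EI'] := integZ (s ^+ 2 / 4) iI.
  have : s ^+ 2 / 4 <= V + s ^+ 2 / 4 * E (\1_(X @^-1` I) : T -> R).
    rewrite -EI' -RintegralD//.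
    rewrite [leLHS](_ : _ = E (cst (s ^+ 2 / 4))); last first.
      by rewrite Rintegral_cst// (_ : fine _ = 1) ?mulr1//; rewrite [X in fine X]probability_setT.
    apply: le_Rintegral => //.
    - exact: finite_measure_integrable_cst.
    - have := integrableD measurableT iX2 iI'; apply: eq_integrable => //.
    move=> w _; rewrite indicE /=; case: (boolP (w \in _)) => wI.
      by rewrite mulr1 lerDr sqr_ge0.
    rewrite mulr0 addr0.
    have : `|s| / 2 <= `|X w|.
      rewrite leNgt; apply/negP => Xs; move/negP: wI; apply.
      by apply: mem_set; rewrite /I /= in_itv/= -ler_norml; exact: ltW.
    move=> h; have : (`|s| / 2) ^+ 2 <= `|X w| ^+ 2 by apply: lerXn2r; rewrite ?nnegrE ?divr_ge0.
    rewrite exprMn !real_normK ?num_real// exprVn; lra.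
  have := sqr_ge0 s; nra.
have mV : m ^+ 2 <= 130 * V.
  have [i1 E1] := integZ 2 iX2; have [i1' E1'] := integZ 2 i2.
  have : m ^+ 2 <= 2 * V + 2 * E (fun w => (X w - m) ^+ 2).
    rewrite -E1 -E1' -RintegralD//.
    have -> : m ^+ 2 = E (cst (m ^+ 2)).
      by rewrite Rintegral_cst// (_ : fine _ = 1) ?mulr1//; rewrite [X in fine X]probability_setT.
    apply: le_Rintegral => //.
    - exact: finite_measure_integrable_cst.
    - have := integrableD measurableT i1 i1'; apply: eq_integrable => //.
    by move=> w _ /=; have := sqr_ge0 (2 * X w - m); lra.
  lra.
have [j4 F4] := integZ 8 i4.
have pw w : X w ^+ 4 <= 8 * m ^+ 4 + 8 * (X w - m) ^+ 4.
  rewrite !(exprM _ 2 2).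
  have := sqr_ge0 (X w - 2 * m); set x := X w.
  have h : x ^+ 2 <= 2 * m ^+ 2 + 2 * (x - m) ^+ 2 by have := sqr_ge0 (x - 2 * m); lra.
  have := sqr_ge0 (m ^+ 2 - (x - m) ^+ 2); have := sqr_ge0 x.
  move: h; set A := x ^+ 2; set B := m ^+ 2; set C := (x - m) ^+ 2; nra.
have ic : integ (cst (8 * m ^+ 4)) by exact: finite_measure_integrable_cst.
have iD := integrableD measurableT ic j4.
have iX4 : integ (fun w => X w ^+ 4).
  apply: (@integ_le _ _ _ _ _ (fun w => 8 * m ^+ 4 + 8 * (X w - m) ^+ 4)) => //.
  by move=> w; rewrite ger0_norm ?exprn_even_ge0.
split=> //.
apply: (@le_trans _ _ (8 * m ^+ 4 + 512 * s ^+ 4)).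
  apply: (@le_trans _ _ (E (fun w => cst (8 * m ^+ 4) w + 8 * (X w - m) ^+ 4))).
    exact: le_Rintegral.
  rewrite RintegralD// Rintegral_cst// (_ : fine _ = 1) ?mulr1; last first.
    by rewrite [X in fine X]probability_setT.
  rewrite F4; lra.
have mV2 : m ^+ 4 <= (130 * V) ^+ 2.
  by rewrite (exprM m 2 2) lerXn2r// nnegrE ?sqr_ge0// mulr_ge0.
have sV2 : s ^+ 4 <= (8 * V) ^+ 2.
  by rewrite (exprM s 2 2) lerXn2r// nnegrE ?sqr_ge0// mulr_ge0.
rewrite /kurtosis_bound (_ : _ * V ^+ 2 = 8 * (130 * V) ^+ 2 + 512 * (8 * V) ^+ 2); last by ring.
move: mV2 sV2; move: (m ^+ 4) (s ^+ 4) (_ ^+ 2) (_ ^+ 2) => A B C D; lra.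
Qed.
End gaussian.

(** * The second moment of the suboptimality *)

Section pairings.
Variables (R : realType) (n : nat).
Notation I := 'I_n.
Implicit Types p q : I * I.

(** The number of ways to group the four indices into equal pairs. *)
Definition pairings p q : R :=
  ((p.1 == p.2) && (q.1 == q.2))%:R + (p == q)%:R + (q == (p.2, p.1))%:R.

Lemma pairings_ge1 p q :
  [|| (p.1 == p.2) && (q.1 == q.2), p == q | q == (p.2, p.1)] -> 1 <= pairings p q.
Proof.
rewrite /pairings; case: (_ && _); case: (p == q); case: (q == _) => //= _;
  by rewrite ?addr0 ?add0r ?lerDl ?lerDr ?addr_ge0.
Qed.

Lemma pairings_ge0 p q : 0 <= pairings p q.
Proof. by rewrite !addr_ge0. Qed.

(** If the four indices do not pair up, one of them occurs an odd number of times, and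
    reflecting that coordinate changes the sign of their product. *)
Lemma odd_index p q :
  ~~ [|| (p.1 == p.2) && (q.1 == q.2), p == q | q == (p.2, p.1)] ->
  exists h, (p.1 == h) (+) (p.2 == h) (+) (q.1 == h) (+) (q.2 == h).
Proof.
case: p q => [i j] [k l] /=; rewrite -!pair_eqE /pair_eq /= !negb_or.
have [<-|ij] := eqVneq i j => /=.
  case/and3P => kl _ _; exists k; rewrite eqxx addbb /=.
  by rewrite eq_sym (negbTE kl).
have [ik|ik] := eqVneq i k; have [jl|jl] := eqVneq j l => //=.
- rewrite -ik => h; have [il|il] := eqVneq i l.
    by exists i; rewrite !eqxx -il eq_sym (negbTE ij) eqxx.
  by exists j; rewrite (negbTE ij) eqxx [l == j]eq_sym (negbTE jl).
- have [li|li] := eqVneq l i => /=; last first.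
    move=> _; exists i; rewrite eqxx [j == i]eq_sym (negbTE ij) [k == i]eq_sym (negbTE ik).
    by rewrite (negbTE li).
  by rewrite -li -jl eqxx in ij.
have [li|li] := eqVneq l i => /=.
  have [kj|kj] := eqVneq k j => //= _.
  exists j; rewrite (negbTE ij) eqxx (negbTE kj) li (negbTE ij); by [].
move=> _; exists i; rewrite eqxx [j == i]eq_sym (negbTE ij) [k == i]eq_sym (negbTE ik).
by rewrite (negbTE li).
Qed.

Lemma sum_delta (J : finType) (j : J) (f : J -> R) : \sum_i (i == j)%:R * f i = f j.
Proof.
rewrite (bigD1 j)//= eqxx mul1r big1 ?addr0// => i ij.
by rewrite (negbTE ij) mul0r.
Qed.

(** The pairing within p and q gives (tr M)^2; the two crossed pairings give the sum of
    the M_ij^2, at most that of M_ii M_jj, which is (tr M)^2 again. *)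
Lemma psd_pairings (M : 'M[R]_n) : symmetric_psd M ->
  \sum_p \sum_q pairings p q * `|M p.1 p.2 * M q.1 q.2| <= 3 * \tr M ^+ 2.
Proof.
move=> psdM; have MT := psd_sym psdM.
have dM i : 0 <= M i i := psd_diag_ge0 psdM i.
have tr2 : \sum_p M p.1 p.1 * M p.2 p.2 = \tr M ^+ 2.
  by rewrite expr2 /mxtrace big_distrlr /= pair_bigA.
have diagS : \sum_p (p.1 == p.2)%:R * `|M p.1 p.2| = \tr M.
  rewrite -(pair_bigA _ (fun i j => (i == j)%:R * `|M i j|)) /=.
  apply: eq_bigr => i _; under eq_bigr do rewrite eq_sym.
  by rewrite sum_delta ger0_norm.
have E1 : \sum_p \sum_q ((p.1 == p.2) && (q.1 == q.2))%:R * `|M p.1 p.2 * M q.1 q.2| = \tr M ^+ 2.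
  rewrite expr2 -{1 2}diagS big_distrlr /=; apply: eq_bigr => p _; apply: eq_bigr => q _.
  by rewrite normrM -mulnb natrM; ring.
have E2 : \sum_p \sum_q (p == q)%:R * `|M p.1 p.2 * M q.1 q.2| <= \tr M ^+ 2.
  rewrite -tr2; apply: ler_sum => p _; under eq_bigr do rewrite eq_sym.
  by rewrite sum_delta -expr2 ger0_norm ?sqr_ge0//; exact: psd_minor.
have E3 : \sum_p \sum_q (q == (p.2, p.1))%:R * `|M p.1 p.2 * M q.1 q.2| <= \tr M ^+ 2.
  rewrite -tr2; apply: ler_sum => p _.
  rewrite sum_delta /= (MT p.2 p.1) -expr2 ger0_norm ?sqr_ge0//; exact: psd_minor.
have -> : \sum_p \sum_q pairings p q * `|M p.1 p.2 * M q.1 q.2| =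
   \sum_p \sum_q ((p.1 == p.2) && (q.1 == q.2))%:R * `|M p.1 p.2 * M q.1 q.2| +
   \sum_p \sum_q (p == q)%:R * `|M p.1 p.2 * M q.1 q.2| +
   \sum_p \sum_q (q == (p.2, p.1))%:R * `|M p.1 p.2 * M q.1 q.2|.
  rewrite -!big_split /=; apply: eq_bigr => p _; rewrite -!big_split /=; apply: eq_bigr => q _.
  by rewrite !mulrDl.
lra.
Qed.
End pairings.

Section fourth_moment.
Context {d : measure_display} {T : measurableType d} {R : realType} (P : probability T R).
Variables (L r : R) (nu : probability (measurableTypeR R) R) (n : nat).
Variables (Q : T -> 'M[R]_n.+1) (xs x0 : T -> 'cV[R]_n.+1) (lam : T -> 'rV[R]_n.+1).
Hypothesis L0 : 0 < L.
Hypothesis H : random_instance P L r nu Q xs x0 lam.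
Local Notation e := (fun w => x0 w - xs w).
Hypothesis gauss : gaussian_vector P e.
Local Notation rv X := (measurable_fun [set: T] (X : T -> measurableTypeR R)).
Local Notation integ X := (P.-integrable [set: T] (EFin \o X)).
Local Notation E X := (\int[P]_w X w)%R.
Local Notation mxfun p q f :=
  (measurable_fun [set: @mxspace R p q] (f : @mxspace R p q -> measurableTypeR R)).
Notation I := 'I_n.+1.
Implicit Types p q : I * I.

Definition error_kurtosis : R := kurtosis_bound * (r ^+ 2 / n.+1%:R) ^+ 2.

Lemma error_kurtosis_ge0 : 0 <= error_kurtosis.
Proof. by rewrite mulr_ge0 ?sqr_ge0// /kurtosis_bound !expr2; lra. Qed.

Lemma error_fourth i : integ (fun w => e w i 0 ^+ 4) /\
  E (fun w => e w i 0 ^+ 4) <= error_kurtosis.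
Proof.
have [m [s]] := gauss (delta_mx i 0).
rewrite (_ : (fun w => _) = (fun w => e w i 0)); last first.
  by apply/funext => w; rewrite trmx_delta -rowE mxE.
move=> law; have [i4 le4] := gaussian_kurtosis (rv_error H i) (integ_error_sqr H i) law.
split=> //; rewrite /error_kurtosis -(error_var H i).
by under [X in _ <= _ * X ^+ 2]eq_Rintegral do rewrite -expr2.
Qed.

(** p and q index the two entries of M in the expansion of (e^T M e)^2. *)
Definition tensor p q (v : 'cV[R]_n.+1) : R := v p.1 0 * v p.2 0 * (v q.1 0 * v q.2 0).

Lemma mxfun_tensor p q : mxfun n.+1 1 (tensor p q).
Proof. by apply: mxfun_mul; exact: mxfun_coord2. Qed.

Lemma tensor_bound p q : integ (fun w => tensor p q (e w)) /\
  `|E (fun w => tensor p q (e w))| <= error_kurtosis.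
Proof.
have four i := error_fourth i.
pose S w := 4^-1 * (e w p.1 0 ^+ 4 + e w p.2 0 ^+ 4 + (e w q.1 0 ^+ 4 + e w q.2 0 ^+ 4)).
have iS12 : integ (fun w => e w p.1 0 ^+ 4 + e w p.2 0 ^+ 4) :=
  integrableD measurableT (four p.1).1 (four p.2).1.
have iS34 : integ (fun w => e w q.1 0 ^+ 4 + e w q.2 0 ^+ 4) :=
  integrableD measurableT (four q.1).1 (four q.2).1.
have iS : integ (fun w => e w p.1 0 ^+ 4 + e w p.2 0 ^+ 4 +
   (e w q.1 0 ^+ 4 + e w q.2 0 ^+ 4)) := integrableD measurableT iS12 iS34.
have [iS' ES'] := integZ 4^-1 iS.
have ES : E S <= error_kurtosis.
  rewrite [leLHS]ES' RintegralD//.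
  rewrite (RintegralD measurableT (four p.1).1 (four p.2).1).
  rewrite (RintegralD measurableT (four q.1).1 (four q.2).1).
  have := (four p.1).2; have := (four p.2).2; have := (four q.1).2; have := (four q.2).2.
  lra.
have pw w : `|tensor p q (e w)| <= S w.
  rewrite /tensor /S !normrM.
  set x := e w p.1 0; set y := e w p.2 0; set z := e w q.1 0; set t := e w q.2 0.
  have amgm (a b : R) : 0 <= a -> 0 <= b -> a * b <= (a ^+ 2 + b ^+ 2) / 2.
    by move=> _ _; have := sqr_ge0 (a - b); lra.
  have q4 (a : R) : a ^+ 4 = (`|a| ^+ 2) ^+ 2 by rewrite real_normK ?num_real// -exprM.
  rewrite !q4.
  have h1 := amgm `|x| `|y| (normr_ge0 _) (normr_ge0 _).
  have h2 := amgm `|z| `|t| (normr_ge0 _) (normr_ge0 _).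
  have := sqr_ge0 (`|x| * `|y| - `|z| * `|t|).
  have := sqr_ge0 (`|x| ^+ 2 - `|y| ^+ 2); have := sqr_ge0 (`|z| ^+ 2 - `|t| ^+ 2).
  by rewrite !sqrrB !exprMn; lra.
have it : integ (fun w => tensor p q (e w)).
  apply: (integ_le _ pw iS'); exact: random_mx_comp (random_error H) (mxfun_tensor p q).
split=> //; apply: le_trans ES; apply: (le_trans (le_normr_Rintegral _ it)) => //.
apply: le_Rintegral => //.
by have := integrable_norm it; apply: eq_integrable.
Qed.

Lemma tensor_unpaired p q h :
  (p.1 == h) (+) (p.2 == h) (+) (q.1 == h) (+) (q.2 == h) ->
  E (fun w => tensor p q (e w)) = 0.
Proof.
move=> odd; have it := (tensor_bound p q).1.
have := rotation_integral H (flip_orth h) (mxfun_tensor p q) it.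
have flipT v : tensor p q (flip h *m v) = -1 * tensor p q v.
  have fl j : (flip h *m v) j 0 = (-1) ^+ (j == h) * v j 0.
    by rewrite flipE; case: (j == h); rewrite ?mulN1r ?mul1r.
  rewrite /tensor !fl.
  rewrite [in RHS](_ : -1 = (-1) ^+ (p.1 == h) * (-1) ^+ (p.2 == h) * (-1) ^+ (q.1 == h) *
     (-1) ^+ (q.2 == h) :> R); last by rewrite -!signr_addb odd.
  by move: (_ ^+ _) (_ ^+ _) (_ ^+ _) (_ ^+ _) => s1 s2 s3 s4; ring.
under [X in X = _ -> _]eq_Rintegral do rewrite flipT.
rewrite RintegralZl//; lra.
Qed.

Lemma tensor_le p q : `|E (fun w => tensor p q (e w))| <= error_kurtosis * pairings R p q.
Proof.
have [paired|unp] := boolP [|| (p.1 == p.2) && (q.1 == q.2), p == q | q == (p.2, p.1)].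
  apply: (le_trans (tensor_bound p q).2).
  by rewrite ler_peMr ?error_kurtosis_ge0// pairings_ge1.
have [h odd] := odd_index unp.
by rewrite (tensor_unpaired odd) normr0 mulr_ge0 ?error_kurtosis_ge0 ?pairings_ge0.
Qed.

Variables (m : method) (K : nat).
Local Notation gram := (gram L Q m K).
Local Notation phi := (suboptimality m L Q xs x0 K).

Lemma integ_gram2 p q : integ (fun w => gram w p.1 p.2 * gram w q.1 q.2).
Proof.
apply: (@integ_bounded _ _ _ _ _ ((n.+1%:R * L) ^+ 2)).
  by apply: measurable_funM; exact: (rv_gram H).
move=> w; rewrite normrM expr2; apply: ler_pM => //; exact: (gram_entry_le L0 H).
Qed.

Lemma phi_sqrE w : phi w ^+ 2 =
  4^-1 * \sum_p \sum_q tensor p q (e w) * (gram w p.1 p.2 * gram w q.1 q.2).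
Proof.
rewrite (phi_quad H) exprMn (_ : 2^-1 ^+ 2 = 4^-1); last by rewrite exprVn -natrX.
congr (_ * _); rewrite quadE pair_bigA expr2 big_distrlr /=.
by apply: eq_bigr => p _; apply: eq_bigr => q _; rewrite /tensor; ring.
Qed.

Lemma mean_phi_sqr_le_trace : integ (fun w => phi w ^+ 2) /\
  E (fun w => phi w ^+ 2) <= 3 / 4 * error_kurtosis * E (fun w => \tr (gram w) ^+ 2).
Proof.
have mg p q : mxfun n.+1 n.+1 (fun M => horner_mx M ('X * residual m L^-1 K ^+ 2) p.1 p.2 *
    horner_mx M ('X * residual m L^-1 K ^+ 2) q.1 q.2).
  by apply: mxfun_mul; exact: mxfun_horner.
have T1 p q := independent_stat H (mxfun_tensor p q) (mg p q) (tensor_bound p q).1 (integ_gram2 p q).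
have T2 p := integ_sum (fun q => (T1 p q).1).
have [T31 T32] := integ_sum (fun p => (T2 p).1).
have [T41 T42] := integZ 4^-1 T31.
have phiE' : (fun w => phi w ^+ 2) =
  (fun w => 4^-1 * \sum_p \sum_q tensor p q (e w) * (gram w p.1 p.2 * gram w q.1 q.2)).
  by apply/funext => w; exact: phi_sqrE.
rewrite phiE'; split=> //.
rewrite [leLHS]T42 T32.
have iN p q : integ (fun w => `|gram w p.1 p.2 * gram w q.1 q.2|).
  by have := integrable_norm (integ_gram2 p q); apply: eq_integrable.
have N1 p q := integZ (pairings R p q) (iN p q).
have N2 p := integ_sum (fun q => (N1 p q).1).
have [N31 N32] := integ_sum (fun p => (N2 p).1).
have itr : integ (fun w => \tr (gram w) ^+ 2).
  have -> : (fun w => \tr (gram w) ^+ 2) = (fun w => \sum_i \sum_j gram w i i * gram w j j).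
    by apply/funext => w; rewrite expr2 /mxtrace big_distrlr.
  have h i := integ_sum (fun j => integ_gram2 (i, i) (j, j)).
  exact: (integ_sum (fun i => (h i).1)).1.
have [itr3 Etr3] := integZ 3 itr.
have bound : \sum_p E (fun w => \sum_q tensor p q (e w) * (gram w p.1 p.2 * gram w q.1 q.2)) <=
   error_kurtosis * (3 * E (fun w => \tr (gram w) ^+ 2)).
  apply: (@le_trans _ _ (error_kurtosis * E (fun w => \sum_p \sum_q
      pairings R p q * `|gram w p.1 p.2 * gram w q.1 q.2|))).
    rewrite N32 mulr_sumr; apply: ler_sum => p _.
    rewrite (T2 p).2 (N2 p).2 mulr_sumr; apply: ler_sum => q _.
    rewrite (T1 p q).2 (N1 p q).2 mulrA.
    apply: (le_trans (ler_norm _)); rewrite normrM; apply: ler_pM => //.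
      exact: tensor_le.
    by apply: le_normr_Rintegral => //; exact: integ_gram2.
  rewrite ler_wpM2l ?error_kurtosis_ge0// -Etr3; apply: le_Rintegral => // w _.
  apply: psd_pairings; exact: (gram_psd H).
lra.
Qed.

Definition mean_weight_sqr : R := fine (\int[nu]_(x in `[0%R, L]) (weight L m K x ^+ 2)%:E)%E.

Lemma weight_sqr_le_L x : 0 <= x <= L -> 0 <= weight L m K x ^+ 2 <= L ^+ 2.
Proof.
move=> xL; have /andP[h0 h1] := weight_le_L L0 m K xL.
by rewrite sqr_ge0/=; apply: lerXn2r => //; rewrite nnegrE// ltW.
Qed.

Lemma integ_weight2 i j : integ (fun w => weight L m K (lam w 0 i) * weight L m K (lam w 0 j)).
Proof.
have mw k : rv (fun w => weight L m K (lam w 0 k)).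
  apply: (@measurableT_comp _ _ _ _ _ _ (weight L m K)); first exact: measurable_weight.
  exact: (ri_measurable_lam H).
apply: (@integ_bounded _ _ _ _ _ (L * L)); first by apply: measurable_funM; exact: mw.
move=> w; rewrite normrM.
have /(weight_le_L L0 m K)/andP[h1 h2] := ri_range H w i.
have /(weight_le_L L0 m K)/andP[h3 h4] := ri_range H w j.
by apply: ler_pM; rewrite ?normr_ge0// ger0_norm.
Qed.

Lemma mean_weight_sqrE i : E (fun w => weight L m K (lam w 0 i) * weight L m K (lam w 0 i)) =
  mean_weight_sqr.
Proof.
rewrite /Rintegral /mean_weight_sqr.
rewrite -(law_lam (f := fun x => weight L m K x ^+ 2) H i)//.
  by apply: measurable_funX; exact: measurable_weight.
by move=> x /weight_sqr_le_L/andP[].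
Qed.

Lemma mean_weight_sqr_fin :
  (\int[nu]_(x in `[0%R, L]) (weight L m K x ^+ 2)%:E = mean_weight_sqr%:E)%E.
Proof.
rewrite /mean_weight_sqr fineK// -(law_lam (f := fun x => weight L m K x ^+ 2) H ord0)//.
- exact: (integrable_fin_num _ (integ_weight2 ord0 ord0)).
- by apply: measurable_funX; exact: measurable_weight.
- by move=> x /weight_sqr_le_L/andP[].
Qed.

Variable rho : nat -> {poly R}.
Hypothesis rhoP : residual_polynomials m L^-1 rho.
Hypothesis negcor : negatively_correlated_weights P rho lam.

Lemma weight_cov_le i j : i != j ->
  E (fun w => weight L m K (lam w 0 i) * weight L m K (lam w 0 j)) <= mean_weight L nu m K ^+ 2.
Proof.
move=> ij; have sw k : spectral_weight rho lam K k = (fun w => weight L m K (lam w 0 k)).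
  apply/funext => w; rewrite /spectral_weight /weight.
  by rewrite (residual_polynomials_horner K rhoP)//; have /andP[] := ri_range H w k.
have := negcor K ij; rewrite /= !sw.
rewrite !expectationE; [|exact: (integ_weight L0 H)|exact: (integ_weight L0 H)|exact: integ_weight2].
by rewrite -EFinM lee_fin !(mean_weightE L0 H) expr2.
Qed.

(** (tr M)^2 is the double sum of the products w_i w_j: the diagonal terms are d copies of
    E w^2, and negative correlation bounds the others by (E w)^2. *)
Lemma mean_trace_sqr_le : E (fun w => \tr (gram w) ^+ 2) <=
  n.+1%:R * mean_weight_sqr + n.+1%:R ^+ 2 * mean_weight L nu m K ^+ 2.
Proof.
have -> : (fun w => \tr (gram w) ^+ 2) = (fun w => \sum_i \sum_j
    weight L m K (lam w 0 i) * weight L m K (lam w 0 j)).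
  by apply/funext => w; rewrite (gram_trace H) expr2 big_distrlr.
have h i := integ_sum (fun j => integ_weight2 i j).
rewrite (integ_sum (fun i => (h i).1)).2.
apply: (@le_trans _ _ (\sum_(i < n.+1) (mean_weight_sqr + n.+1%:R * mean_weight L nu m K ^+ 2))).
  apply: ler_sum => i _; rewrite (h i).2 (bigD1 i)//= mean_weight_sqrE lerD2l.
  apply: (@le_trans _ _ (\sum_(j < n.+1 | j != i) mean_weight L nu m K ^+ 2)).
    by apply: ler_sum => j ji; rewrite weight_cov_le// eq_sym.
  rewrite mulr_natl -[X in _ *+ X]card_ord -sumr_const.
  rewrite [leRHS](bigD1 i)//= lerDr sqr_ge0//.
rewrite sumr_const card_ord -mulr_natl; rewrite le_eqVlt; apply/orP; left; apply/eqP; ring.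
Qed.

Lemma mean_phi_sqr_le : integ (fun w => phi w ^+ 2) /\
  E (fun w => phi w ^+ 2) <= kurtosis_bound * r ^+ 4 *
     (n.+1%:R^-1 * mean_weight_sqr + mean_weight L nu m K ^+ 2).
Proof.
have [i2 le2] := mean_phi_sqr_le_trace; split=> //; apply: (le_trans le2).
have N0 : n.+1%:R != 0 :> R by rewrite pnatr_eq0.
have N1 : 0 < n.+1%:R :> R by rewrite ltr0n.
have k0 := error_kurtosis_ge0.
apply: (@le_trans _ _ (error_kurtosis * (n.+1%:R * mean_weight_sqr + n.+1%:R ^+ 2 * mean_weight L nu m K ^+ 2))).
  have := mean_trace_sqr_le.
  have t0 : 0 <= E (fun w => \tr (gram w) ^+ 2) by apply: Rintegral_ge0 => w _; exact: sqr_ge0.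
  move=> h; apply: (@le_trans _ _ (error_kurtosis * E (fun w => \tr (gram w) ^+ 2))).
    by rewrite ler_wpM2r// ler_piMl//; lra.
  by rewrite ler_wpM2l.
rewrite /error_kurtosis; rewrite le_eqVlt; apply/orP; left; apply/eqP; field.
by rewrite addrC natr1.
Qed.
End fourth_moment.

(** * Comparison of the two rates *)

Section rates.
Context {R : realType}.
Implicit Types (a s : R) (m : method).

Lemma mean_log_le m a s K : 0 < s -> (1 <= K)%N -> mean_log m a K <= (1 + s^-1) * K%:R `^ s.
Proof.
move=> s0 K1; have K0 : 0 < K%:R :> R by rewrite ltr0n.
have si : 0 < s^-1 by rewrite invr_gt0.
have Ks : 1 <= K%:R `^ s.
  by rewrite -[leLHS](powRr0 (K%:R : R)); apply: ler_powR; rewrite ?ler1n// ltW.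
have one : 1 <= (1 + s^-1) * K%:R `^ s by nra.
case: m => //=; case: ifP => // _.
have : ln (K%:R `^ s) <= K%:R `^ s by apply/ltW/ln_sublinear; exact: powR_gt0.
rewrite ln_powR -ler_pdivlMl// => h.
by apply: (le_trans h); rewrite ler_wpM2r ?powR_ge0//; lra.
Qed.

Lemma rms_rate_ge m a : exists K0, forall K, (K0 <= K)%N ->
  K%:R `^ (- rms_exponent m a) <= rms_rate m a K.
Proof.
have [K0 hK] := ln_nat_large (1 : R); exists K0 => K /hK l1.
rewrite /rms_rate ler_peMr ?powR_ge0//; case: m => //=.
by case: ifP => // _; rewrite -[leLHS]sqrtr1 ler_wsqrtr.
Qed.

Lemma rms_rate_ge0 m a K : 0 <= rms_rate m a K.
Proof. by rewrite mulr_ge0 ?powR_ge0//; case: m => //=; case: ifP. Qed.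

(** The critical exponents -1/2 and 0 of the two rates are not the same, so all three
    intervals of a have to be compared. *)
Lemma exponent_gap m a : -1 < a -> rms_exponent m a < mean_exponent m a.
Proof.
move=> a1; case: m => /=; first lra.
by rewrite /mean_exponent /rms_exponent; case: ifPn => [h1|]; case: ifPn => [h2|]; rewrite -?ltNge => *; lra.
Qed.

(** The gap between the exponents is 2 s with s > 0; one K^-s absorbs the logarithm of the
    mean rate. *)
Lemma mean_rate_negligible m a eps : -1 < a -> 0 < eps ->
  exists K0, forall K, (K0 <= K)%N -> mean_rate m a K <= eps * rms_rate m a K.
Proof.
move=> a1 eps0.
pose s := (mean_exponent m a - rms_exponent m a) / 2.
have s0 : 0 < s by rewrite divr_gt0// subr_gt0 exponent_gap.
have c0 : 0 < 1 + s^-1 by rewrite ltr_wpDl// invr_gt0.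
have [K1 h1] := rms_rate_ge m a.
have [K2 h2] := @natpow_small R s (eps / (1 + s^-1)) s0 (divr_gt0 eps0 c0).
exists (maxn 1 (maxn K1 K2)) => K; rewrite !geq_max => /and3P[K0 /h1 {}h1 /h2 {}h2].
have Kp : 0 < K%:R :> R by rewrite ltr0n.
apply: (@le_trans _ _ (eps * K%:R `^ (- rms_exponent m a))); last by rewrite ler_wpM2l// ltW.
apply: (@le_trans _ _ (K%:R `^ (- mean_exponent m a) * ((1 + s^-1) * K%:R `^ s))).
  by rewrite ler_wpM2l ?powR_ge0// mean_log_le.
have -> : - mean_exponent m a = - s - s - rms_exponent m a by rewrite /s; field.
rewrite !gt0_powRD//; set x := _ `^ (- s); set y := _ `^ (- _).
have xs : x * K%:R `^ s = 1 by rewrite -gt0_powRD// addNr powRr0.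
rewrite (_ : x * x * y * _ = (x * K%:R `^ s) * (x * (1 + s^-1) * y)); last by ring.
rewrite xs mul1r ler_wpM2r ?powR_ge0//.
by rewrite -ler_pdivlMr.
Qed.
End rates.

Section assembly.
Context {d : measure_display} {T : measurableType d} {R : realType} (P : probability T R).
Local Notation rv X := (measurable_fun [set: T] (X : T -> measurableTypeR R)).
Local Notation integ X := (P.-integrable [set: T] (EFin \o X)).
Local Notation E X := (\int[P]_w X w)%R.

Lemma L2_boundE alpha (X : T -> R) : 0 < alpha -> integ (fun w => X w ^+ 2) ->
  L2_bound P alpha X = ((Num.sqrt alpha)^-1 * Num.sqrt (E (fun w => X w ^+ 2)))%:E.
Proof.
move=> al0 iX; rewrite /L2_bound (expectationE iX) -EFinM /=.
by rewrite sqrtrM ?invr_ge0 ?(ltW al0)// sqrtrV// ltW.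
Qed.

Lemma mean_le_L2 (X : T -> R) : integ X -> integ (fun w => X w ^+ 2) ->
  E X <= Num.sqrt (E (fun w => X w ^+ 2)).
Proof.
move=> iX iX2; apply: (le_trans (ler_norm _)); rewrite -sqrtr_sqr ler_wsqrtr//.
set mu := E X; have [i1 E1] := integZ (2 * mu) iX.
have ic : integ (cst (mu ^+ 2)) by exact: finite_measure_integrable_cst.
have iB := integrableB measurableT i1 ic.
have -> : mu ^+ 2 = E (fun w => 2 * mu * X w - cst (mu ^+ 2) w).
  rewrite (RintegralB measurableT i1 ic) E1 Rintegral_cst//.
  by rewrite (_ : fine _ = 1) ?mulr1; [rewrite -/mu; ring|rewrite [X in fine X]probability_setT].
by apply: le_Rintegral => // w _ /=; have := sqr_ge0 (X w - mu); lra.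
Qed.
End assembly.

(** * Bounds on one instance, and the theorem *)

Section instance_bounds.
Context {d : measure_display} {T : measurableType d} {R : realType} (P : probability T R).
Variables (L r : R) (nu : probability (measurableTypeR R) R) (n : nat).
Variables (Q : T -> 'M[R]_n.+1) (xs x0 : T -> 'cV[R]_n.+1) (lam : T -> 'rV[R]_n.+1).
Hypothesis L0 : 0 < L.
Hypothesis r0 : 0 < r.
Hypothesis H : random_instance P L r nu Q xs x0 lam.
Hypothesis gauss : gaussian_vector P (fun w => x0 w - xs w).
Variables (m : method) (rho : nat -> {poly R}) (alpha : R).
Hypothesis rhoP : residual_polynomials m L^-1 rho.
Hypothesis negcor : negatively_correlated_weights P rho lam.
Hypothesis al0 : 0 < alpha.
Local Notation E X := (\int[P]_w X w)%R.
Local Notation phi := (suboptimality m L Q xs x0).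
Local Notation sq x := (Num.sqrt x).

(** E phi^2 is at most a multiple of r^4 (int w^2 dnu / d + (int w dnu)^2), whose second
    term is a multiple of (E phi)^2; the square root is subadditive. *)
Lemma L2_bound_le K (D : R) (g : R) : 0 <= D -> 0 <= g ->
  (\int[nu]_(x in `[0%R, L]) (weight L m K x ^+ 2)%:E <= (D * g ^+ 2)%:E)%E ->
  (L2_bound P alpha (phi K) <=
     (sq kurtosis_bound * (r ^+ 2 * sq D + 2) * (sq alpha)^-1)%:E *
        (((sq n.+1%:R)^-1 * g)%:E + 'E_P[phi K]))%E.
Proof.
move=> D0 g0; rewrite (mean_weight_sqr_fin L0 H) lee_fin => w2.
have [iphi Ephi] := mean_phi L0 H m K.
have [iphi2 Ephi2] := mean_phi_sqr_le L0 H gauss K rhoP negcor.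
rewrite L2_boundE// (expectationE iphi) -EFinD -EFinM lee_fin.
set v := E (phi K) in Ephi *; set N := n.+1%:R : R in Ephi2 *.
have N0 : 0 < N by rewrite ltr0n.
have k0 : 0 <= kurtosis_bound :> R by rewrite /kurtosis_bound !expr2; lra.
have v0 : 0 <= v by apply: Rintegral_ge0 => w _; exact: (phi_ge0 H).
have r20 : 0 < r ^+ 2 by rewrite exprn_gt0.
have rD0 : 0 <= r ^+ 2 * sq D by rewrite mulr_ge0 ?sqrtr_ge0// ltW.
have w1 : mean_weight L nu m K = 2 * v / r ^+ 2 by rewrite Ephi; field; rewrite gt_eqF.
set u := (sq N)^-1 * g.
have u0 : 0 <= u by rewrite mulr_ge0// invr_ge0.
have u2 : N^-1 * (D * g ^+ 2) = (sq D * u) ^+ 2.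
  by rewrite /u !exprMn exprVn !sqr_sqrtr ?(ltW N0)//; ring.
have le1 : E (fun w => phi K w ^+ 2) <= kurtosis_bound * (r ^+ 2 * sq D * u + 2 * v) ^+ 2.
  apply: (le_trans Ephi2); rewrite -mulrA ler_wpM2l//.
  apply: (@le_trans _ _ (r ^+ 4 * ((sq D * u) ^+ 2 + (2 * v / r ^+ 2) ^+ 2))).
    rewrite ler_wpM2l ?exprn_ge0 ?(ltW r0)// -u2 w1 lerD2r.
    by rewrite ler_wpM2l ?invr_ge0 ?(ltW N0).
  have -> : r ^+ 4 * ((sq D * u) ^+ 2 + (2 * v / r ^+ 2) ^+ 2) =
     (r ^+ 2 * sq D * u) ^+ 2 + (2 * v) ^+ 2 by field; rewrite gt_eqF.
  by rewrite sqrrD addrAC lerDl mulrn_wge0// mulr_ge0// mulr_ge0.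
rewrite [leRHS]mulrAC [leRHS]mulrC ler_wpM2l ?invr_ge0//.
apply: (@le_trans _ _ (sq (kurtosis_bound * (r ^+ 2 * sq D * u + 2 * v) ^+ 2))).
  exact: ler_wsqrtr.
rewrite sqrtrM// sqrtr_sqr ger0_norm; last first.
  by rewrite addr_ge0// mulr_ge0.
rewrite -[leRHS]mulrA ler_wpM2l ?sqrtr_ge0// [leRHS]mulrDl; apply: lerD.
  by rewrite ler_wpM2l// lerDl.
by rewrite ler_wpM2l// lerDr.
Qed.

Lemma L2_bound_ge K : (((sq alpha)^-1 * E (phi K))%:E <= L2_bound P alpha (phi K))%E.
Proof.
have [iphi _] := mean_phi L0 H m K.
have [iphi2 _] := mean_phi_sqr_le L0 H gauss K rhoP negcor.
by rewrite L2_boundE// lee_fin ler_wpM2l ?invr_ge0// mean_le_L2.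
Qed.
End instance_bounds.

Theorem proposition1 (R : realType) (L r a p0 : R)
    (nu : probability (measurableTypeR R) R) (p : R -> R)
    (L_gt0 : 0 < L) (r_gt0 : 0 < r) (a_gtN1 : -1 < a) (p0_gt0 : 0 < p0)
    (nu_density : has_density nu p)
    (p_near0 : p x / (p0 * x `^ a) @[x --> 0^'+] --> (1 : R))
    (m : method) :
  (* (i) *)
  (forall (n : nat) (dT : measure_display) (T : measurableType dT)
      (P : probability T R) (Q : T -> 'M[R]_n.+1) (xs x0 : T -> 'cV[R]_n.+1)
      (lam : T -> 'rV[R]_n.+1) (alpha : R),
    random_instance P L r nu Q xs x0 lam -> 0 < alpha <= 1 ->
    let phi := suboptimality m L Q xs x0 in
    ((fun K : nat => fine (CVaR P alpha (phi K))
                     / (alpha^-1 * fine 'E_P[phi K])%R) @ \oo --> (1 : R))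
    /\ (fun K : nat => fine 'E_P[phi K]) =Theta_\oo mean_rate m a)
  /\
  (* (ii) *)
  (forall rho : nat -> {poly R}, residual_polynomials m L^-1 rho ->
    let admissible n (dT : measure_display) (T : measurableType dT)
        (P : probability T R) (Q : T -> 'M[R]_n.+1)
        (xs x0 : T -> 'cV[R]_n.+1) (lam : T -> 'rV[R]_n.+1) :=
      [/\ random_instance P L r nu Q xs x0 lam,
          gaussian_vector P (fun w => x0 w - xs w) &
          negatively_correlated_weights P rho lam] in
    (* CVaR <= sqrt(E phi^2 / alpha) *)
    [/\ forall (n : nat) (dT : measure_display) (T : measurableType dT)
          (P : probability T R) (Q : T -> 'M[R]_n.+1)
          (xs x0 : T -> 'cV[R]_n.+1) (lam : T -> 'rV[R]_n.+1) (alpha : R),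
        admissible n dT T P Q xs x0 lam -> 0 < alpha <= 1 ->
        let phi := suboptimality m L Q xs x0 in
        forall K : nat, (CVaR P alpha (phi K) <= L2_bound P alpha (phi K))%E,
    (* the O-bound, with constants uniform in the dimension and in alpha *)
        exists (C : R) (K0 : nat),
        forall (n : nat) (dT : measure_display) (T : measurableType dT)
          (P : probability T R) (Q : T -> 'M[R]_n.+1)
          (xs x0 : T -> 'cV[R]_n.+1) (lam : T -> 'rV[R]_n.+1) (alpha : R),
        admissible n dT T P Q xs x0 lam -> 0 < alpha <= 1 ->
        let phi := suboptimality m L Q xs x0 in
        forall K : nat, (K0 <= K)%N ->
          (L2_bound P alpha (phi K) <=
             (C * (Num.sqrt alpha)^-1)%:E *
             (((Num.sqrt n.+1%:R)^-1 * rms_rate m a K)%:E + 'E_P[phi K]))%E,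
    (* in a fixed dimension the expectation is of lower order *)
        forall (n : nat) (dT : measure_display) (T : measurableType dT)
          (P : probability T R) (Q : T -> 'M[R]_n.+1)
          (xs x0 : T -> 'cV[R]_n.+1) (lam : T -> 'rV[R]_n.+1),
        admissible n dT T P Q xs x0 lam ->
        let phi := suboptimality m L Q xs x0 in
        (fun K : nat => fine 'E_P[phi K]) =o_\oo
          (fun K : nat => (Num.sqrt n.+1%:R)^-1 * rms_rate m a K),
    (* the simplified bound, with a threshold depending on the dimension *)
        exists C : R, forall n : nat, exists K0 : nat,
        forall (dT : measure_display) (T : measurableType dT)
          (P : probability T R) (Q : T -> 'M[R]_n.+1)
          (xs x0 : T -> 'cV[R]_n.+1) (lam : T -> 'rV[R]_n.+1) (alpha : R),
        admissible n dT T P Q xs x0 lam -> 0 < alpha <= 1 ->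
        let phi := suboptimality m L Q xs x0 in
        forall K : nat, (K0 <= K)%N ->
          (L2_bound P alpha (phi K) <=
             (C * (Num.sqrt alpha)^-1 * (Num.sqrt n.+1%:R)^-1 *
              rms_rate m a K)%:E)%E &
    (* no constants make the simplified bound uniform in the dimension *)
        forall (C : R) (K0 : nat), exists N : nat,
        forall (n : nat) (dT : measure_display) (T : measurableType dT)
          (P : probability T R) (Q : T -> 'M[R]_n.+1)
          (xs x0 : T -> 'cV[R]_n.+1) (lam : T -> 'rV[R]_n.+1) (alpha : R),
        (N <= n)%N ->
        admissible n dT T P Q xs x0 lam -> 0 < alpha <= 1 ->
        let phi := suboptimality m L Q xs x0 in
        exists2 K : nat, (K0 <= K)%N &
          ((C * (Num.sqrt alpha)^-1 * (Num.sqrt n.+1%:R)^-1 *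
            rms_rate m a K)%:E < L2_bound P alpha (phi K))%E]).
Proof.
have [delta deltaL near0] := density_near0 L_gt0 p0_gt0 p_near0.
split.
  move=> n dT T P Q xs x0 lam alpha H al01 phi; split.
    exact: (CVaR_equivalent L_gt0 r_gt0 nu_density near0 deltaL a_gtN1 H m al01).
  exact: (mean_phi_Theta L_gt0 r_gt0 nu_density near0 deltaL a_gtN1 H m).
move=> rho rhoP admissible.
have [D1 D10 up1] := mean_upper L_gt0 nu_density near0 deltaL a_gtN1 m.
have [D2 D20 up2] := rms_upper L_gt0 nu_density near0 deltaL a_gtN1 m.
have [D3 D30 [K3 low]] := mean_lower L_gt0 nu_density near0 deltaL a_gtN1 m.
have r22 : 0 < r ^+ 2 / 2 by rewrite divr_gt0// exprn_gt0.
have negl n : exists K0, forall K, (K0 <= K)%N -> r ^+ 2 / 2 * (D1 * mean_rate m a K) <=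
    (Num.sqrt n.+1%:R)^-1 * rms_rate m a K.
  have s0 : 0 < (Num.sqrt n.+1%:R)^-1 / (r ^+ 2 / 2 * D1) :> R.
    by rewrite divr_gt0 ?mulr_gt0 ?invr_gt0 ?sqrtr_gt0 ?ltr0n.
  have [K0 hK] := mean_rate_negligible m a_gtN1 s0.
  exists K0 => K /hK; rewrite mulrAC ler_pdivlMr ?mulr_gt0// => h.
  by apply: le_trans h; rewrite mulrA mulrC.
have Ephi n dT T P Q xs x0 lam K : (2 <= K)%N -> @random_instance R dT T P L r nu n.+1 Q xs x0 lam ->
   (('E_P[suboptimality m L Q xs x0 K] <= (r ^+ 2 / 2 * (D1 * mean_rate m a K))%:E)%E).
  move=> K2 H; have [iphi Ep] := mean_phi L_gt0 H m K.
  rewrite (expectationE iphi) Ep lee_fin ler_wpM2l ?(ltW r22)//.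
  by have := up1 K K2; rewrite (mean_weight_fin L_gt0 H) lee_fin.
pose C0 : R := Num.sqrt kurtosis_bound * (r ^+ 2 * Num.sqrt D2 + 2).
have C00 : 0 <= C0.
  by rewrite mulr_ge0 ?sqrtr_ge0// addr_ge0// mulr_ge0 ?sqrtr_ge0// sqr_ge0.
have Obound n dT T P Q xs x0 lam alpha K : admissible n dT T P Q xs x0 lam -> 0 < alpha <= 1 ->
   (2 <= K)%N -> (L2_bound P alpha (suboptimality m L Q xs x0 K) <=
             (C0 * (Num.sqrt alpha)^-1)%:E *
             (((Num.sqrt n.+1%:R)^-1 * rms_rate m a K)%:E + 'E_P[suboptimality m L Q xs x0 K]))%E.
  move=> [H gauss negcor] /andP[al0 al1] K2.
  by apply: (L2_bound_le L_gt0 r_gt0 H gauss rhoP negcor al0 (ltW D20) (rms_rate_ge0 m a K) (up2 K K2)).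
split.
- move=> n dT T P Q xs x0 lam alpha [H _ _] /andP[al0 al1] phi K.
  by apply: CVaR_le_L2 => //; apply: integrable_rv; exact: (mean_phi L_gt0 H m K).1.
- exists C0, 2%N => n dT T P Q xs x0 lam alpha adm al01 phi K K2.
  exact: (Obound n dT T P Q xs x0 lam alpha K adm al01 K2).
- move=> n dT T P Q xs x0 lam [H _ _] phi; apply/eqoP => eps eps0.
  have e0 : 0 < eps * (Num.sqrt n.+1%:R)^-1 / (r ^+ 2 / 2 * D1) :> R.
    by rewrite divr_gt0 ?mulr_gt0 ?invr_gt0 ?sqrtr_gt0 ?ltr0n.
  have [K0 hK] := mean_rate_negligible m a_gtN1 e0.
  exists (maxn 2 K0) => //= K; rewrite /= geq_max => /andP[K2 /hK h].
  have [iphi _] := mean_phi L_gt0 H m K.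
  have := Ephi _ _ _ _ _ _ _ _ _ K2 H; rewrite (expectationE iphi) lee_fin /= => h2.
  rewrite ger0_norm; last by apply: Rintegral_ge0 => w _; exact: (phi_ge0 H).
  rewrite ger0_norm; last by rewrite mulr_ge0 ?invr_ge0 ?sqrtr_ge0 ?rms_rate_ge0.
  apply: (le_trans h2); rewrite mulrA.
  have rD : 0 < r ^+ 2 / 2 * D1 by rewrite mulr_gt0.
  move: h; rewrite mulrAC ler_pdivlMr// => h3; rewrite [leLHS]mulrC.
  by apply: (le_trans h3); rewrite [leRHS]mulrA.
- exists (C0 * 2) => n; have [K0 hK] := negl n.
  exists (maxn 2 K0) => dT T P Q xs x0 lam alpha adm al01 phi K.
  rewrite geq_max => /andP[K2 /hK h].
  apply: (le_trans (Obound _ _ _ _ _ _ _ _ _ _ adm al01 K2)).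
  have [H _ _] := adm; have [iphi _] := mean_phi L_gt0 H m K.
  have := Ephi _ _ _ _ _ _ _ _ _ K2 H; rewrite (expectationE iphi) lee_fin => h2.
  rewrite -EFinD -EFinM lee_fin.
  set g := (Num.sqrt n.+1%:R)^-1 * rms_rate m a K in h *.
  rewrite (_ : C0 * 2 * _ * _ * _ = C0 * (Num.sqrt alpha)^-1 * (2 * g)); last by rewrite /g; ring.
  apply: ler_wpM2l; first by rewrite mulr_ge0// invr_ge0.
  by rewrite mulr2n mulrDl mul1r lerD2l (le_trans h2).
(* For a fixed K the mean does not depend on n, while n.+1^(-1/2) tends to 0. *)
- move=> C K0; pose K := maxn K0 (maxn 2 K3).
  have K2 : (2 <= K)%N by rewrite !leq_max leqnn orbT.
  have KK0 : (K0 <= K)%N by rewrite leq_max leqnn.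
  have KK3 : (K3 <= K)%N by rewrite !leq_max leqnn !orbT.
  pose b := r ^+ 2 / 2 * (D3 * mean_rate m a K).
  have b0 : 0 < b by rewrite mulr_gt0// mulr_gt0// mean_rate_gt0.
  pose q := `|C| * rms_rate m a K / b.
  have q0 : 0 <= q by rewrite divr_ge0 ?(ltW b0)// mulr_ge0 ?rms_rate_ge0.
  exists (Num.bound (q ^+ 2)) => n dT T P Q xs x0 lam alpha Nn [H gauss negcor] /andP[al0 al1] phi.
  exists K => //.
  apply: lt_le_trans (L2_bound_ge L_gt0 H gauss rhoP negcor al0 K).
  have sal : 0 < (Num.sqrt alpha)^-1 by rewrite invr_gt0 sqrtr_gt0.
  have [iphi Ep] := mean_phi L_gt0 H m K.
  have lo : b <= \int[P]_w phi K w.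
    rewrite Ep ler_wpM2l ?(ltW r22)//.
    by have := low K KK3; rewrite (mean_weight_fin L_gt0 H) lee_fin.
  rewrite lte_fin [C * _]mulrC -!mulrA ltr_pM2l//; apply: lt_le_trans lo.
  have N0 : 0 < Num.sqrt n.+1%:R :> R by rewrite sqrtr_gt0 ltr0n.
  have qN : q < Num.sqrt n.+1%:R.
    rewrite -[q]ger0_norm// -sqrtr_sqr ltr_sqrt ?ltr0n//.
    apply: lt_le_trans (archi_boundP (sqr_ge0 q)) _.
    by rewrite ler_nat (leq_trans Nn).
  rewrite mulrCA mulrC ltr_pdivrMr//.
  apply: (@le_lt_trans _ _ (q * b)); last by rewrite mulrC ltr_pM2l.
  by rewrite /q divfK ?gt_eqF// ler_wpM2r ?rms_rate_ge0// ler_norm.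
Qed.
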